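(* (1) Let $(\nu_t)_{t\geq 0}$ be a family of probability measures on $\mathbb{R}$ with Cauchy transforms $M_t(z)=\int_{\mathbb{R}}\frac{1}{z-u}\,\nu_t(du)$, and assume that $t\mapsto M_t(z)$ is measurable on $[0,\infty)$ for every $z\in\mathbb{H}$. For $0\le s\le t$ let $\varphi_{s,t}:\mathbb{H}\to\mathbb{H}$ be the (unique) solution of $$\frac{\partial}{\partial t}\varphi_{s,t}(z) = -M_t(\varphi_{s,t}(z))\quad\text{for a.e. } t\in[s,\infty),\qquad \varphi_{s,s}(z)=z\in\mathbb{H}. \qquad (\mathrm{L})$$ Then for each $0\le s\le t$ the mapping $\varphi_{s,t}$ is the $F$-transform of a probability measure $\sigma_{s,t}$ on $\mathbb{R}$, and $(\sigma_{s,t})_{0\le s\le t}$ is a normal monotone evolution family. (2) Conversely, let $(\sigma_{s,t})_{0\le s\le t}$ be a normal monotone evolution family and let $\varphi_{s,t}$ be the $F$-transform of $\sigma_{s,t}$. Then there exists a family $(\nu_t)_{t\ge0}$ of probability measures on $\mathbb{R}$, with Cauchy transforms $M_t$, such that $t\mapsto M_t(z)$ is measurable for every $z\in\mathbb{H}$ and $\varphi_{s,t}$ satisfies (L).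
   Context: $\mathbb{H}=\{z\in\mathbb{C}: \operatorname{Im} z>0\}$. Measures are Borel measures on $\mathbb{R}$, with not necessarily bounded support. ''a.e.'' means almost every with respect to Lebesgue measure. The Cauchy transform of a probability measure $\mu$ on $\mathbb{R}$ is $G_\mu(z)=\int_{\mathbb{R}}\frac{1}{z-x}\,\mu(dx)$, $z\in\mathbb{C}\setminus\mathbb{R}$. Its $F$-transform is $F_\mu:\mathbb{H}\to\mathbb{H}$, $F_\mu(z)=1/G_\mu(z)$. The monotone convolution $\mu\rhd\nu$ of probability measures $\mu,\nu$ on $\mathbb{R}$ is the probability measure defined by $F_{\mu\rhd\nu}=F_\mu\circ F_\nu$. A collection $(\sigma_{s,t})_{0\le s\le t}$ of probability measures on $\mathbb{R}$ is a monotone evolution family if (a) $\sigma_{t,t}=\delta_0$ for all $t\ge 0$; (b) $\sigma_{s,t}=\sigma_{u,t}\rhd\sigma_{s,u}$ whenever $0\le s\le u\le t$; (c) $\sigma_{s,u}$ converges weakly to $\sigma_{s,t}$ as $u\to t$. It is called normal if in addition the first and second moments exist and (d) $\int_{\mathbb{R}}x\,\sigma_{s,t}(dx)=0$ and $\int_{\mathbb{R}}x^2\,\sigma_{s,t}(dx)=t-s$ for all $0\le s\le t$. Equation (L) is understood as a Carathéodory ODE: for each $s\ge0$ and $z\in\mathbb{H}$, the function $t\mapsto\varphi_{s,t}(z)\in\mathbb{H}$ is locally absolutely continuous on $[s,\infty)$ and satisfies the equation for a.e. $t$. It is known that under the measurability assumption (L) has a unique solution, defined for all $t\ge s$. *)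

(* Defs.v *)
From mathcomp Require Import all_boot all_order all_algebra.
From mathcomp Require Import complex.
From mathcomp Require Import all_classical all_reals all_analysis.

Set Implicit Arguments.
Unset Strict Implicit.
Unset Printing Implicit Defensive.

Import Order.TTheory GRing.Theory Num.Theory.
Import numFieldNormedType.Exports.

Local Open Scope classical_set_scope.
Local Open Scope ring_scope.
Local Open Scope complex_scope.

Notation prob R := (probability (measurableTypeR R) R).

(** Complex-valued functions are integrated, differentiated and tested for
    measurability through their real and imaginary parts. *)
Definition Cintegral (R : realType) (mu : prob R) (f : R -> R[i]) : R[i] :=
  (\int[mu]_x complex.Re (f x)) +i* (\int[mu]_x complex.Im (f x)).

Definition is_Cderive (R : realType) (f : R -> R[i]) (t : R) (l : R[i]) :
    Prop :=
  is_derive t (1 : R) (fun u => complex.Re (f u)) (complex.Re l) /\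
  is_derive t (1 : R) (fun u => complex.Im (f u)) (complex.Im l).

Definition Cmeasurable_fun (R : realType) (D : set R) (f : R -> R[i]) : Prop :=
  measurable_fun (D : set (measurableTypeR R))
    (fun t : measurableTypeR R => complex.Re (f t)) /\
  measurable_fun (D : set (measurableTypeR R))
    (fun t : measurableTypeR R => complex.Im (f t)).

Definition upper_half_plane (R : realType) : set R[i] :=
  [set z | 0 < complex.Im z].

Definition cauchy_transform (R : realType) (mu : prob R) (z : R[i]) : R[i] :=
  Cintegral mu (fun x => 1 / (z - x%:C)).

Definition F_transform (R : realType) (mu : prob R) (z : R[i]) : R[i] :=
  1 / cauchy_transform mu z.

Definition is_F_transform (R : realType) (phi : R[i] -> R[i]) (mu : prob R) :
    Prop :=
  forall z, upper_half_plane z -> phi z = F_transform mu z.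

(** rho is the monotone convolution of mu (on the left) and nu (on the right):
    a probability measure is determined by its F-transform, so at most one rho
    satisfies this relation. *)
Definition is_monotone_convolution (R : realType) (mu nu rho : prob R) : Prop :=
  forall z, upper_half_plane z ->
    F_transform rho z = F_transform mu (F_transform nu z).

(** A two-parameter family is a total function of s and t; only its values for
    0 <= s <= t are constrained or used. *)
Record monotone_evolution_family (R : realType)
    (sigma : R -> R -> prob R) : Prop := {
  evol_diag : forall t : R, 0 <= t ->
    forall A : set (measurableTypeR R), measurable A ->
      sigma t t A = \d_(0 : R) A ;
  evol_conv : forall s u t : R, 0 <= s -> s <= u -> u <= t ->
    is_monotone_convolution (sigma u t) (sigma s u) (sigma s t) ;
  evol_weak_continuity : forall s t : R, 0 <= s -> s <= t ->
    forall f : R -> R, continuous f -> bounded_fun f ->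
      (\int[sigma s u]_x f x) @[u --> within [set u | s <= u] (nbhs t)]
        --> \int[sigma s t]_x f x
}.

Record normal_monotone_evolution_family (R : realType)
    (sigma : R -> R -> prob R) : Prop := {
  normal_evol : monotone_evolution_family sigma ;
  normal_moment1 : forall s t : R, 0 <= s -> s <= t ->
    (sigma s t).-integrable setT (fun x => x%:E) ;
  normal_moment2 : forall s t : R, 0 <= s -> s <= t ->
    (sigma s t).-integrable setT (fun x => (x ^+ 2)%:E) ;
  normal_mean : forall s t : R, 0 <= s -> s <= t ->
    \int[sigma s t]_x x = 0 ;
  normal_variance : forall s t : R, 0 <= s -> s <= t ->
    \int[sigma s t]_x (x ^+ 2) = t - s
}.

Definition absolutely_continuous_on (R : realType) (a b : R) (f : R -> R[i]) :
    Prop :=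
  forall e : R, 0 < e -> exists2 d : R, 0 < d &
    forall (n : nat) (u v : 'I_n -> R),
      (forall i, a <= u i /\ u i <= v i /\ v i <= b) ->
      trivIset setT (fun i => `]u i, v i[%classic) ->
      \sum_(i < n) (v i - u i) < d ->
      \sum_(i < n) `|f (v i) - f (u i)| < e%:C.

Definition measurable_cauchy_family (R : realType) (nu : R -> prob R) : Prop :=
  forall z, upper_half_plane z ->
    Cmeasurable_fun `[0, +oo[ (fun t => cauchy_transform (nu t) z).

(** Caratheodory solutions, on every half-line [s, +oo[, of
      d/dt phi_{s,t}(z) = - M_t(phi_{s,t}(z)),   phi_{s,s}(z) = z,
    where M_t is the Cauchy transform of nu_t. The exceptional null set of
    times may depend on s and z; in particular it may contain the endpoint s,
    so a two-sided derivative can be used. *)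
Record loewner_solution (R : realType) (nu : R -> prob R)
    (phi : R -> R -> R[i] -> R[i]) : Prop := {
  loewner_upper : forall (s t : R) (z : R[i]), 0 <= s -> s <= t ->
    upper_half_plane z -> upper_half_plane (phi s t z) ;
  loewner_init : forall (s : R) (z : R[i]), 0 <= s -> upper_half_plane z ->
    phi s s z = z ;
  loewner_ac : forall (s T : R) (z : R[i]), 0 <= s -> s <= T ->
    upper_half_plane z ->
    absolutely_continuous_on s T (fun t => phi s t z) ;
  loewner_ode : forall (s : R) (z : R[i]), 0 <= s -> upper_half_plane z ->
    {ae (@lebesgue_measure R), forall t, s <= t ->
      is_Cderive (fun u => phi s u z) t (- cauchy_transform (nu t) (phi s t z))}
}.

(* Main.v *)
Require Import Defs.
From HB Require Import structures.
From mathcomp Require Import all_boot all_order all_algebra.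
From mathcomp Require Import complex.
From mathcomp Require Import all_classical all_reals all_analysis.
From mathcomp Require Import measurable_realfun.
From mathcomp Require Import ring lra.

(** The field - M_t points upwards and is bounded by 1 / Im z. Trajectories of
    the equation therefore stay above their starting point, whose imaginary part
    controls all constants.

    From the equation to the measures. The difference of two trajectories solves
    a linear equation with bounded coefficient, and Gronwall's inequality gives
    uniqueness, hence phi_{u,t} o phi_{s,u} = phi_{s,t} ([flow_semigroup]). That
    1 / phi_{s,t} is a Cauchy transform is classically a matter of holomorphy in
    z and of Cauchy's integral theorem. Holomorphy is used here in a quantitative
    form, [tame]: Lipschitz with Lipschitz divided differences. Gronwall's
    inequality propagates it along the equation ([flow_lip2], [flow_divided]),
    and it is enough for a version of Cauchy's theorem in which integrals are
    Riemann sums ([gridsum_bound]). This version and Helly's theorem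
    ([helly_cauchy]) yield a representation theorem for functions with nonpositive
    imaginary part and decay 1 / |w| ([herglotz]). It is applied to
    1 / phi_{s,t}(z + i e), then e tends to 0 ([flow_F_transform]). The variance
    of sigma_{s,t} is the limit of y (Im phi_{s,t}(iy) - y), found to be t - s by
    integrating the equation ([flow_Im_growth], [second_moment_of_transform]).
    Weak continuity follows from the continuity of the transforms, as Poisson
    kernels approximate bounded continuous functions up to an error that the
    variances control ([weak_cvg]).

    From the measures to the equation. If sigma is centered with variance v, the
    Cauchy-Schwarz inequality gives |F z - z| <= v / Im z ([transform_sub_id]).
    With the semigroup property, t |-> phi_{s,t}(z) is Lipschitz, hence
    differentiable almost everywhere ([lipschitz_Cderivable]). Its difference
    quotients over [t, t + h] are, up to sign and a factor tending to 1, Cauchy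
    transforms of the probability measures x^2 sigma_{t,t+h}(dx) / h
    ([increment_measure]). A Helly limit nu_t of these, as h tends to 0, solves the
    equation wherever the derivative exists ([regular_derive]). Two points remain.
    Off a single null set of times the transforms converge on the whole half
    plane, by rational starting data and equicontinuity ([nonexceptional_cvg]);
    hence their limits are measurable in t. And nu_t has mass 1 for almost
    every t: its mass is at most 1, and the growth y (Im phi_{0,T}(iy) - y) -> T
    leaves no room for less ([mass1_ae]). *)

Import Order.TTheory GRing.Theory Num.Theory.
Import numFieldNormedType.Exports.
Local Open Scope classical_set_scope.
Local Open Scope ring_scope.
Set Implicit Arguments.
Unset Strict Implicit.
Unset Printing Implicit Defensive.

(** * Complex numbers *)

Local Open Scope complex_scope.
Notation Re := complex.Re.
Notation Im := complex.Im.
(* The real-valued modulus: the norm of R[i] takes its values in R[i]. *)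
Notation nc := (@ComplexField.Normc.normc _).

Section ComplexNorm.
Variable R : realType.
Implicit Types z w : R[i].

Lemma nc_norm z : `|z| = (nc z)%:C.
Proof. by case: z. Qed.

Lemma nc_ge0 z : 0 <= nc z.
Proof. by case: z => a b; exact: sqrtr_ge0. Qed.

Lemma nc_sq z : nc z ^+ 2 = Re z ^+ 2 + Im z ^+ 2.
Proof. by case: z => a b /=; rewrite sqr_sqrtr // addr_ge0 ?sqr_ge0. Qed.

Lemma ncD z w : nc (z + w) <= nc z + nc w.
Proof. by rewrite -lecR rmorphD /= -!nc_norm ler_normD. Qed.

Lemma ncM z w : nc (z * w) = nc z * nc w.
Proof. exact: ComplexField.Normc.normcM. Qed.

Lemma ncV z : nc z^-1 = (nc z)^-1.
Proof. exact: ComplexField.Normc.normcV. Qed.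

Lemma ncN z : nc (- z) = nc z.
Proof. by case: z => a b /=; rewrite !sqrrN. Qed.

Lemma ncB z w : nc (z - w) <= nc z + nc w.
Proof. by rewrite -(ncN w) ncD. Qed.

Lemma nc_distC z w : nc (z - w) = nc (w - z).
Proof. by rewrite -ncN opprB. Qed.

Lemma nc0 : nc (0 : R[i]) = 0.
Proof. exact: ComplexField.Normc.normc0. Qed.

Lemma nc_eq0 z : nc z = 0 -> z = 0.
Proof. exact: ComplexField.Normc.eq0_normc. Qed.

Lemma nc_gt0 z : (0 < nc z) = (z != 0).
Proof.
rewrite lt0r nc_ge0 andbT; apply/idP/idP; apply: contra => /eqP.
  by move=> ->; rewrite nc0.
by move/nc_eq0 ->.
Qed.

Lemma ncR (x : R) : nc x%:C = `|x|.
Proof. by rewrite /= expr0n /= addr0 sqrtr_sqr. Qed.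

Lemma nc1 : nc (1 : R[i]) = 1.
Proof. exact: ComplexField.Normc.normc1. Qed.

Lemma nci : nc ('i : R[i]) = 1.
Proof. by rewrite /= expr0n /= add0r expr1n sqrtr1. Qed.

Definition cj z : R[i] := Re z -i* Im z.

Lemma nc_conj z : nc (cj z) = nc z.
Proof. by case: z => a b /=; rewrite sqrrN. Qed.

Lemma cjD z w : (cj (z + w)) = (cj z) + (cj w).
Proof. by case: z w => a b [c d]; apply/eqP; rewrite eq_complex /= opprD !eqxx. Qed.

Lemma cjN z : (cj (- z)) = - (cj z).
Proof. by case: z. Qed.

Lemma cjM z w : (cj (z * w)) = (cj z) * (cj w).
Proof.
case: z w => a b [c d]; apply/eqP; rewrite eq_complex /=.
by apply/andP; split; apply/eqP; ring.
Qed.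

Lemma cjV z : (cj (z^-1)) = (cj z)^-1.
Proof. by case: z => a b; apply/eqP; rewrite eq_complex /= sqrrN mulNr !eqxx. Qed.

Lemma cjR (x : R) : (cj (x%:C)) = x%:C :> R[i].
Proof. by rewrite /cj /= oppr0. Qed.

Lemma cjK z : (cj (cj z)) = z.
Proof. by case: z => a b; rewrite /cj /= opprK. Qed.

Lemma cj_sum (I : Type) (r : seq I) (f : I -> R[i]) :
  (cj (\sum_(i <- r) f i)) = \sum_(i <- r) (cj (f i)).
Proof.
elim/big_rec2: _ => [|i y x _ <-]; first by rewrite -[0]/(0%:C) cjR.
exact: cjD.
Qed.

Lemma Re_le_nc z : `|Re z| <= nc z.
Proof.
by rewrite -(@ler_pXn2r _ 2) ?nnegrE ?nc_ge0 // nc_sq real_normK ?num_real //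
  lerDl sqr_ge0.
Qed.

Lemma Im_le_nc z : `|Im z| <= nc z.
Proof.
by rewrite -(@ler_pXn2r _ 2) ?nnegrE ?nc_ge0 // nc_sq real_normK ?num_real //
  lerDr sqr_ge0.
Qed.

Lemma nc_le_ReIm z : nc z <= `|Re z| + `|Im z|.
Proof.
rewrite -(@ler_pXn2r _ 2) ?nnegrE ?nc_ge0 ?addr_ge0 // nc_sq sqrrD.
rewrite !real_normK ?num_real // addrAC lerDl.
by rewrite mulrn_wge0 // mulr_ge0.
Qed.

Lemma ReD z w : Re (z + w) = Re z + Re w. Proof. by case: z w => ? ? []. Qed.
Lemma ImD z w : Im (z + w) = Im z + Im w. Proof. by case: z w => ? ? []. Qed.
Lemma ReN z : Re (- z) = - Re z. Proof. by case: z. Qed.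
Lemma ImN z : Im (- z) = - Im z. Proof. by case: z. Qed.
Lemma ReB z w : Re (z - w) = Re z - Re w. Proof. by rewrite ReD ReN. Qed.
Lemma ImB z w : Im (z - w) = Im z - Im w. Proof. by rewrite ImD ImN. Qed.
Lemma ReM z w : Re (z * w) = Re z * Re w - Im z * Im w.
Proof. by case: z w => ? ? []. Qed.
Lemma ImM z w : Im (z * w) = Re z * Im w + Im z * Re w.
Proof. by case: z w => ? ? []. Qed.
Lemma ReV z : Re z^-1 = Re z / nc z ^+ 2.
Proof. by rewrite nc_sq; case: z. Qed.
Lemma ImV z : Im z^-1 = - (Im z / nc z ^+ 2).
Proof. by rewrite nc_sq; case: z. Qed.

Lemma Re_sum (I : Type) (r : seq I) (f : I -> R[i]) :
  Re (\sum_(i <- r) f i) = \sum_(i <- r) Re (f i).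
Proof. by elim/big_rec2: _ => // i y x _ <-; rewrite ReD. Qed.
Lemma Im_sum (I : Type) (r : seq I) (f : I -> R[i]) :
  Im (\sum_(i <- r) f i) = \sum_(i <- r) Im (f i).
Proof. by elim/big_rec2: _ => // i y x _ <-; rewrite ImD. Qed.
Lemma nc_sum (I : Type) (r : seq I) (f : I -> R[i]) :
  nc (\sum_(i <- r) f i) <= \sum_(i <- r) nc (f i).
Proof.
elim/big_rec2: _ => [|i y x _ h]; first by rewrite nc0.
by apply: le_trans (ncD _ _) _; rewrite lerD2l.
Qed.

Lemma ceq z w : Re z = Re w -> Im z = Im w -> z = w.
Proof. by case: z w => a b [c d] /= -> ->. Qed.

Lemma Im_gt0_neq0 z : 0 < Im z -> z != 0.
Proof. by apply: contraTneq => ->; rewrite ltxx. Qed.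

Lemma nc_resolvent z (x e : R) : e <= Im z -> e <= nc (z - x%:C).
Proof.
move=> ez; apply: le_trans (Im_le_nc _); rewrite ImB /= subr0.
exact: le_trans ez (ler_norm _).
Qed.

Lemma resolvent_neq0 z (x : R) : 0 < Im z -> z - x%:C != 0.
Proof. by move=> z0; rewrite -nc_gt0 (lt_le_trans z0) // nc_resolvent. Qed.

Lemma nc_inv_le z (e : R) : 0 < e -> e <= nc z -> nc z^-1 <= e^-1.
Proof. by move=> e0 ez; rewrite ncV lef_pV2 ?posrE // (lt_le_trans e0). Qed.

End ComplexNorm.

(** * Cauchy transforms of finite measures *)

Notation bmeasure R := {measure set (measurableTypeR R) -> \bar R}.

Section RealIntegrals.
Variable R : realType.
Variable mu : bmeasure R.
Implicit Types f g : R -> R.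

Definition lipfun f := exists K, forall x y, `|f x - f y| <= K * `|x - y|.

Lemma lipfun_continuous f : lipfun f -> continuous f.
Proof.
move=> [K fK] x; apply/cvgrPdist_lt => /= e e0.
near=> y.
apply: le_lt_trans (fK x y) _.
have K1 : 0 < `|K| + 1 by rewrite ltr_wpDl.
apply: (@le_lt_trans _ _ ((`|K| + 1) * `|x - y|)).
  by rewrite ler_wpM2r // (le_trans (ler_norm _)) // lerDl.
rewrite mulrC -ltr_pdivlMr //.
near: y; apply: cvgr_dist_lt; last exact: divr_gt0.
exact: cvg_id.
Unshelve. all: by end_near. Qed.

Lemma lipfun_measurable f : lipfun f ->
  measurable_fun setT (f : measurableTypeR R -> measurableTypeR R).
Proof. by move=> /lipfun_continuous; exact: continuous_measurable_fun. Qed.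

Lemma bounded_integrable f (B : R) : (mu setT < +oo)%E ->
  measurable_fun setT (f : measurableTypeR R -> measurableTypeR R) ->
  (forall x, `|f x| <= B) -> mu.-integrable setT (EFin \o f).
Proof.
move=> mufin mf fB; apply: measurable_bounded_integrable => //.
exists B; split; first exact: num_real.
by move=> M BM x _; apply: le_trans (fB x) (ltW BM).
Qed.

Lemma cst_integrable (c : R) : (mu setT < +oo)%E ->
  mu.-integrable setT (EFin \o (fun _ => c)).
Proof.
move=> mufin; by apply: (@bounded_integrable _ `|c|).
Qed.

Lemma le_Rintegral_mass f (B m : R) : (mu setT <= m%:E)%E -> 0 <= B ->
  mu.-integrable setT (EFin \o f) -> (forall x, f x <= B) ->
  \int[mu]_x f x <= B * m.
Proof.
move=> mum B0 fi fB.
have mufin : (mu setT < +oo)%E by rewrite (le_lt_trans mum) ?ltry.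
apply: (@le_trans _ _ (\int[mu]_x B)).
  by apply: le_Rintegral => //; exact: cst_integrable.
rewrite Rintegral_cst // ler_wpM2l //.
have fm : mu setT \is a fin_num by rewrite ge0_fin_numE.
by rewrite -lee_fin fineK.
Qed.

End RealIntegrals.

Section ComplexIntegrals.
Variable R : realType.
Variable mu : bmeasure R.
Implicit Types f g : R -> R[i].

Definition cint f : R[i] := (\int[mu]_x Re (f x)) +i* (\int[mu]_x Im (f x)).

Definition cintegrable f :=
  mu.-integrable setT (EFin \o (fun x => Re (f x))) /\
  mu.-integrable setT (EFin \o (fun x => Im (f x))).

Lemma cintD f g : cintegrable f -> cintegrable g ->
  cint (fun x => f x + g x) = cint f + cint g.
Proof.
move=> [f1 f2] [g1 g2]; apply: ceq; rewrite ?ReD ?ImD /=.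
  by rewrite -RintegralD //; apply: eq_Rintegral => x _; rewrite ReD.
by rewrite -RintegralD //; apply: eq_Rintegral => x _; rewrite ImD.
Qed.

Lemma cintZ c f : cintegrable f -> cint (fun x => c * f x) = c * cint f.
Proof.
have Z h (r : R) : mu.-integrable setT (EFin \o h) ->
    mu.-integrable setT (EFin \o (fun x => r * h x)).
  by move=> hi; have := @integrableZl _ _ _ mu setT measurableT r _ hi.
move=> [f1 f2]; apply: ceq; rewrite ?ReM ?ImM /=.
  rewrite -!RintegralZl // -RintegralB //; try exact: Z.
  by apply: eq_Rintegral => x _; rewrite ReM.
rewrite -!RintegralZl // -RintegralD //; try exact: Z.
by apply: eq_Rintegral => x _; rewrite ImM.
Qed.

Lemma cintegrableZ c f : cintegrable f -> cintegrable (fun x => c * f x).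
Proof.
have Z h (r : R) : mu.-integrable setT (EFin \o h) ->
    mu.-integrable setT (EFin \o (fun x => r * h x)).
  by move=> hi; have := @integrableZl _ _ _ mu setT measurableT r _ hi.
move=> [f1 f2]; split.
  have := integrableB measurableT (Z _ (Re c) f1) (Z _ (Im c) f2).
  by congr integrable; apply/funext => x /=; rewrite ReM EFinB.
have := integrableD measurableT (Z _ (Re c) f2) (Z _ (Im c) f1).
by congr integrable; apply/funext => x /=; rewrite ImM EFinD.
Qed.

Lemma cintegrableD f g : cintegrable f -> cintegrable g ->
  cintegrable (fun x => f x + g x).
Proof.
move=> [f1 f2] [g1 g2]; split.
  have := integrableD measurableT f1 g1.
  by congr integrable; apply/funext => x /=; rewrite ReD EFinD.
have := integrableD measurableT f2 g2.
by congr integrable; apply/funext => x /=; rewrite ImD EFinD.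
Qed.

Lemma cintB f g : cintegrable f -> cintegrable g ->
  cint (fun x => f x - g x) = cint f - cint g.
Proof.
move=> fi gi; rewrite -mulN1r -cintZ // -cintD //; last exact: cintegrableZ.
by congr cint; apply/funext => x; rewrite mulN1r.
Qed.

(** Rotating the value of the integral onto the positive real axis reduces the
    estimate to that of the real part of a rotated integrand. *)
Lemma nc_cint f (h : R -> R) : cintegrable f ->
  mu.-integrable setT (EFin \o h) ->
  (forall x, nc (f x) <= h x) -> nc (cint f) <= \int[mu]_x h x.
Proof.
move=> fi hi fh; set I := cint f.
have [->|I0] := eqVneq I 0.
  rewrite nc0; apply: Rintegral_ge0 => x _; exact: le_trans (nc_ge0 _) (fh x).
have Ip : 0 < nc I by rewrite nc_gt0.
have e1 : Re (cj I * I) = nc I ^+ 2.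
  rewrite nc_sq ReM; case: (I) => a b /=; ring.
have [Ri _] := cintegrableZ (cj I) fi.
have : Re (cj I * I) <= \int[mu]_x (nc I * h x).
  rewrite -[I in _ * I]/(cint f) -cintZ //=.
  apply: le_Rintegral => //.
    by have := @integrableZl _ _ _ mu setT measurableT (nc I) _ hi.
  move=> x _; apply: le_trans (ler_norm _) _; apply: le_trans (Re_le_nc _) _.
  by rewrite ncM nc_conj ler_pM2l.
by rewrite e1 RintegralZl // expr2 ler_pM2l.
Qed.

Lemma nc_cint_mass f (B m : R) : (mu setT <= m%:E)%E -> 0 <= B ->
  cintegrable f -> (forall x, nc (f x) <= B) -> nc (cint f) <= B * m.
Proof.
move=> mum B0 fi fB.
have mufin : (mu setT < +oo)%E by rewrite (le_lt_trans mum) ?ltry.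
apply: le_trans (nc_cint fi (cst_integrable B mufin) fB) _.
by apply: le_Rintegral_mass => //; exact: cst_integrable.
Qed.

(** Bounded Lipschitz integrands: a class stable under products, measurable
    and integrable against every finite measure. *)
Definition blip f := exists B, (forall x, nc (f x) <= B) /\
  (forall x y, nc (f x - f y) <= B * `|x - y|).

Lemma blipM f g : blip f -> blip g -> blip (fun x => f x * g x).
Proof.
move=> [B [fB fL]] [C [gC gL]].
have B0 : 0 <= B by apply: le_trans (nc_ge0 _) (fB 0).
have C0 : 0 <= C by apply: le_trans (nc_ge0 _) (gC 0).
exists (B * C + B * C); split => [x|x y].
  apply: (@le_trans _ _ (B * C)); last by rewrite lerDl mulr_ge0.
  by rewrite ncM ler_pM ?nc_ge0.
have -> : f x * g x - f y * g y = (f x - f y) * g x + f y * (g x - g y) by ring.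
apply: le_trans (ncD _ _) _; rewrite !ncM mulrDl lerD //.
  rewrite mulrAC; apply: ler_pM; rewrite ?nc_ge0 //.
by rewrite -mulrA; apply: ler_pM; rewrite ?nc_ge0 //.
Qed.

Lemma blip_cintegrable f : (mu setT < +oo)%E -> blip f -> cintegrable f.
Proof.
move=> mufin [B [fB fL]]; split; apply: (@bounded_integrable _ _ _ B) => //.
- apply: lipfun_measurable; exists B => x y; rewrite -ReB.
  exact: le_trans (Re_le_nc _) (fL x y).
- by move=> x; apply: le_trans (Re_le_nc _) _.
- apply: lipfun_measurable; exists B => x y; rewrite -ImB.
  exact: le_trans (Im_le_nc _) (fL x y).
- by move=> x; apply: le_trans (Im_le_nc _) _.
Qed.

End ComplexIntegrals.

Section CauchyTransform.
Variable R : realType.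
Implicit Types (mu : bmeasure R) (z w : R[i]) (x : R).

Definition res z x : R[i] := (z - x%:C)^-1.

Lemma nc_res z x (e : R) : 0 < e -> e <= Im z -> nc (res z x) <= e^-1.
Proof. by move=> e0 ez; apply: nc_inv_le => //; exact: nc_resolvent. Qed.

Lemma res_sub z w x : 0 < Im z -> 0 < Im w ->
  res z x - res w x = (w - z) * (res z x * res w x).
Proof.
move=> z0 w0; rewrite /res.
have h1 := resolvent_neq0 x z0; have h2 := resolvent_neq0 x w0.
by field; rewrite h1 h2.
Qed.

Lemma res_lip z x y (e : R) : 0 < e -> e <= Im z ->
  nc (res z x - res z y) <= e ^- 2 * `|x - y|.
Proof.
move=> e0 ez; have z0 := lt_le_trans e0 ez.
have -> : res z x - res z y = (x - y)%:C * (res z x * res z y).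
  rewrite /res rmorphB /=.
  have h1 := resolvent_neq0 x z0; have h2 := resolvent_neq0 y z0.
  by field; rewrite h1 h2.
rewrite ncM ncR mulrC ler_wpM2r // ncM.
by rewrite -exprVn expr2 ler_pM ?nc_ge0 // nc_res.
Qed.

Lemma blip_res z : 0 < Im z -> blip (res z).
Proof.
move=> z0; set e := Im z in z0 *.
have ei : 0 <= e^-1 by rewrite invr_ge0 ltW.
exists (e^-1 + e^-2); split=> [x|x y].
  apply: (@le_trans _ _ e^-1); last by rewrite lerDl invr_ge0 sqr_ge0.
  by apply: nc_res.
apply: le_trans (res_lip x y z0 (lexx _)) _.
by rewrite ler_wpM2r // lerDr.
Qed.

Definition cauchy mu z : R[i] := cint mu (res z).

Lemma cauchy_transformE (mu : prob R) z :
  cauchy_transform mu z = cauchy mu z.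
Proof.
rewrite /cauchy_transform /Cintegral /cauchy /cint /res.
by apply: ceq => /=; apply: eq_Rintegral => x _; rewrite div1r.
Qed.

Lemma res_cintegrable mu z : (mu setT < +oo)%E -> 0 < Im z ->
  cintegrable mu (res z).
Proof. by move=> mufin z0; apply: blip_cintegrable => //; exact: blip_res. Qed.

Lemma res2_cintegrable mu z w : (mu setT < +oo)%E -> 0 < Im z -> 0 < Im w ->
  cintegrable mu (fun x => res z x * res w x).
Proof.
by move=> mufin z0 w0; apply: blip_cintegrable => //; apply: blipM; exact: blip_res.
Qed.

Definition cauchy2 mu z w : R[i] := cint mu (fun x => res z x * res w x).

Lemma cauchy_sub mu z w : (mu setT < +oo)%E -> 0 < Im z -> 0 < Im w ->
  cauchy mu z - cauchy mu w = (w - z) * cauchy2 mu z w.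
Proof.
move=> mufin z0 w0.
rewrite /cauchy -(cintB (res_cintegrable mufin z0) (res_cintegrable mufin w0)).
rewrite /cauchy2 -(cintZ (w - z) (res2_cintegrable mufin z0 w0)).
by congr cint; apply/funext => x; rewrite res_sub.
Qed.

Lemma nc_cauchy mu z (m e : R) : (mu setT <= m%:E)%E -> 0 < e -> e <= Im z ->
  nc (cauchy mu z) <= e^-1 * m.
Proof.
move=> mum e0 ez; apply: nc_cint_mass => //.
- by rewrite invr_ge0 ltW.
- apply: res_cintegrable; first by rewrite (le_lt_trans mum) ?ltry.
  exact: lt_le_trans ez.
- by move=> x; exact: nc_res.
Qed.

Lemma nc_cauchy2 mu z w (m e : R) : (mu setT <= m%:E)%E ->
  0 < e -> e <= Im z -> e <= Im w -> nc (cauchy2 mu z w) <= e^-2 * m.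
Proof.
move=> mum e0 ez ew; apply: nc_cint_mass => //.
- by rewrite invr_ge0 sqr_ge0.
- apply: res2_cintegrable; first by rewrite (le_lt_trans mum) ?ltry.
  + exact: lt_le_trans ez.
  + exact: lt_le_trans ew.
- by move=> x; rewrite ncM -exprVn expr2 ler_pM ?nc_ge0 // nc_res.
Qed.

Lemma cauchy_lip mu z w (m e : R) : (mu setT <= m%:E)%E ->
  0 < e -> e <= Im z -> e <= Im w ->
  nc (cauchy mu z - cauchy mu w) <= e^-2 * m * nc (z - w).
Proof.
move=> mum e0 ez ew.
rewrite cauchy_sub ?(lt_le_trans e0) // ?(le_lt_trans mum) ?ltry //.
by rewrite ncM nc_distC mulrC ler_wpM2r ?nc_ge0 // nc_cauchy2.
Qed.

Lemma Im_res z x : Im (res z x) = - (Im z / nc (z - x%:C) ^+ 2).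
Proof. by rewrite /res ImV ImB /= subr0. Qed.

Lemma Im_res_le0 z x : 0 <= Im z -> Im (res z x) <= 0.
Proof. by move=> z0; rewrite Im_res oppr_le0 divr_ge0 // sqr_ge0. Qed.

Lemma Im_cauchy_le0 mu z : (mu setT < +oo)%E -> 0 < Im z ->
  Im (cauchy mu z) <= 0.
Proof.
move=> mufin z0 /=; have [_ Ii] := res_cintegrable mufin z0.
rewrite -[leRHS](mul0r (fine (mu setT))) -Rintegral_cst //.
apply: le_Rintegral => //; first exact: cst_integrable.
by move=> x _; apply: Im_res_le0; exact: ltW.
Qed.

End CauchyTransform.

(** * Mean value and Gronwall inequalities for absolutely continuous paths *)

Section AbsolutelyContinuous.
Variable R : realType.
Implicit Types (f : R -> R) (d : R -> R[i]) (a b : R).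
Notation leb := (@lebesgue_measure R).

(** Absolute continuity of a real-valued function, as in
    [absolutely_continuous_on]. *)
Definition rac a b f := forall e : R, 0 < e -> exists2 d : R, 0 < d &
  forall (n : nat) (u v : 'I_n -> R),
    (forall i, a <= u i /\ u i <= v i /\ v i <= b) ->
    trivIset setT (fun i => `]u i, v i[%classic) ->
    \sum_(i < n) (v i - u i) < d ->
    \sum_(i < n) `|f (v i) - f (u i)| < e.

Lemma cac_rac a b d (c : R[i]) : absolutely_continuous_on a b d ->
  rac a b (fun t => Re (c * d t)).
Proof.
move=> acd e e0.
have c1 : 0 < nc c + 1 by rewrite ltr_wpDl ?nc_ge0.
have [r r0 rP] := acd _ (divr_gt0 e0 c1).
exists r => // n u v uv tuv luv.
have := rP n u v uv tuv luv.
have -> : \sum_(i < n) `|d (v i) - d (u i)| = (\sum_(i < n) nc (d (v i) - d (u i)))%:C.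
  rewrite rmorph_sum; apply: eq_bigr => i _; exact: nc_norm.
rewrite ltcR ltr_pdivlMr // => h; apply: le_lt_trans h.
rewrite mulr_suml; apply: ler_sum => i _.
rewrite -ReB -mulrBr; apply: le_trans (Re_le_nc _) _.
by rewrite ncM mulrC ler_wpM2l ?nc_ge0 // lerDl.
Qed.

Lemma is_derive_local f (t l : R) : is_derive t (1 : R) f l ->
  forall e, 0 < e -> exists2 r, 0 < r &
    forall y, `|y - t| < r -> `|f y - f t - l * (y - t)| <= e * `|y - t|.
Proof.
move=> [df vf] e e0.
have : h^-1 *: (f (h *: (1 : R) + t) - f t) @[h --> 0^'] --> l.
  by rewrite -vf; exact: df.
move/cvgrPdist_lt => /(_ _ e0); rewrite near_withinE.
move=> [r /= r0 rP]; exists r => // y yr.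
have [->|yt] := eqVneq y t; first by rewrite !subrr mulr0 subr0 normr0 mulr0.
have := rP (y - t); rewrite /= sub0r normrN subr_eq0 => /(_ yr yt).
rewrite /GRing.scale /= mulr1 subrK => h.
have yt0 : y - t != 0 by rewrite subr_eq0.
have -> : f y - f t - l * (y - t) = - (l - (y - t)^-1 * (f y - f t)) * (y - t).
  by field.
by rewrite normrM normrN ler_wpM2r // ltW.
Qed.

Section Cover.
Variables (a b B e : R) (f : R -> R) (U : set R).
Hypotheses (mU : measurable U) (Be0 : 0 <= B + e).

(** Absolute continuity is to be applied to the intervals of the list, whose
    total length is controlled by the measure of U. Keeping them in decreasing
    order makes them disjoint and lets the list grow at its head. *)
Definition reached (x : R) := a <= x /\ x <= b /\ exists l : seq (R * R),
  [/\ pairwise (fun p q : R * R => q.2 <= p.1) l,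
      (forall p, p \in l -> [/\ a <= p.1, p.1 <= p.2 & p.2 <= x]),
      ((\sum_(p <- l) (p.2 - p.1))%:E <= leb (U `&` `[a, x]))%E &
      f x - f a <= (B + e) * (x - a) + \sum_(p <- l) `|f p.2 - f p.1|].

Lemma reached_start : a <= b -> reached a.
Proof.
move=> ab; split=> //; split => //; exists [::]; split=> //.
  by rewrite big_nil measure_ge0.
by rewrite big_nil !subrr mulr0 addr0.
Qed.

Lemma reached_step x y : reached x -> x < y -> y <= b ->
  (f y - f x <= (B + e) * (y - x) \/ `]x, y[ `<=` U) -> reached y.
Proof.
move=> [ax [xb [l [l1 l2 l3 l4]]]] xy yb h.
have ay : a <= y by rewrite (le_trans ax) // ltW.
have mU1 z : measurable (U `&` `[a, z]) by apply: measurableI.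
split=> //; split=> //.
case: h => [h|h].
  exists l; split => //.
  - by move=> p /l2[p1 p2 p3]; split => //; rewrite (le_trans p3) // ltW.
  - apply: le_trans l3 _.
    apply: le_measure; rewrite ?inE; [exact: mU1|exact: mU1|apply: setIS].
    apply: subset_itvl; rewrite bnd_simp ltW //.
  - have -> : f y - f a = (f y - f x) + (f x - f a) by ring.
    have -> : (B + e) * (y - a) = (B + e) * (y - x) + (B + e) * (x - a) by ring.
    by rewrite -[leRHS]addrA; exact: lerD.
exists ((x, y) :: l); split.
- rewrite /= l1 andbT; apply/allP => p /l2[]//.
- move=> p; rewrite inE => /orP[/eqP -> /=|/l2[p1 p2 p3]]; split => //.
    exact: ltW.
  by rewrite (le_trans p3) // ltW.
- rewrite big_cons /= EFinD.
  have -> : (y - x)%:E = leb `]x, y[%classic.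
    by rewrite lebesgue_measure_itv /= lte_fin xy.
  apply: (@le_trans _ _ (leb (`]x, y[%classic `|` (U `&` `[a, x])))).
    rewrite measureU; [by rewrite leeD2l|by []|exact: mU1|].
    rewrite -subset0 => z [/=]; rewrite !in_itv /= => /andP[xz _] [_ /andP[_ zx]].
    by move: (lt_le_trans xz zx); rewrite ltxx.
  apply: le_measure; rewrite ?inE; [by apply: measurableU; [|exact: mU1]|exact: mU1|].
  move=> z [xyz|[Uz b0]]; split => //=; rewrite ?in_itv /=.
  + exact: h.
  + move: xyz; rewrite /= in_itv /= => /andP[xz zy].
    by rewrite (le_trans ax (ltW xz)) ltW.
  + by move: b0; rewrite /= in_itv /= => /andP[-> zx] /=; rewrite (le_trans zx) // ltW.
- rewrite big_cons /=.
  have -> : f y - f a = (f y - f x) + (f x - f a) by ring.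
  rewrite [leRHS]addrCA lerD //; first exact: ler_norm.
  apply: le_trans l4 _; rewrite lerD2r ler_wpM2l // lerD2r.
  exact: ltW.
Qed.

(** Cousin's argument: if every point has a neighbourhood in which the step
    across it is admissible, the supremum of the reached points is b. *)
Lemma reached_end : a <= b ->
  (forall c, a <= c -> c <= b -> exists2 r, 0 < r &
     forall x y, c - r < x -> x <= c -> c <= y -> y < c + r ->
       a <= x -> y <= b -> x < y ->
       f y - f x <= (B + e) * (y - x) \/ `]x, y[ `<=` U) ->
  reached b.
Proof.
move=> ab loc.
have Ra := reached_start ab.
have hS : has_sup [set x | reached x].
  by split; [exists a|exists b => x [_ []]].
set c := sup [set x | reached x].
have ac : a <= c by apply: ub_le_sup => //; exact: hS.2.
have cb : c <= b by apply: ge_sup; [exists a|move=> x [_ []]].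
have [r r0 rP] := loc c ac cb.
have Rc : reached c.
  have [x Rx cx] := sup_adherent r0 hS.
  have xc : x <= c by apply: ub_le_sup => //; exact: hS.2.
  move: xc; rewrite le_eqVlt => /orP[/eqP <- //|xc].
  apply: (reached_step Rx xc cb); apply: rP => //; first exact: ltW.
  - by rewrite ltrDl.
  - by case: Rx.
move: cb; rewrite le_eqVlt => /orP[/eqP <- //|cb].
pose y := Num.min b (c + r / 2).
have cy : c < y by rewrite lt_min cb /= ltrDl divr_gt0.
have yb : y <= b by rewrite ge_min lexx.
have Ry : reached y.
  apply: (reached_step Rc cy yb); apply: rP => //.
  - by rewrite gtrBl.
  - exact: ltW.
  - rewrite gt_min; apply/orP; right; rewrite ltrD2l.
    by rewrite ltr_pdivrMr // mulr_natr mulr2n ltrDl.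
have : y <= c by apply: ub_le_sup => //; exact: hS.2.
by rewrite leNgt cy.
Qed.

End Cover.

(** The null set is covered by an open set so small that absolute continuity
    bounds the increments over it; everywhere else the derivative bounds the
    increments locally. *)
Lemma rac_le a b (B : R) f (N : set R) : a <= b -> 0 <= B -> rac a b f ->
  leb.-negligible N ->
  (forall t, a <= t -> t <= b -> ~ N t -> exists2 l, l <= B & is_derive t (1 : R) f l) ->
  f b - f a <= B * (b - a).
Proof.
move=> ab B0 acf [N' [mN' N'0 NN']] df.
have N0 : @lebesgue_measure R N' = 0%E by exact: N'0.
have key e : 0 < e -> f b - f a <= (B + e) * (b - a) + e.
  move=> e0; have [d d0 dP] := acf e e0.
  have Be0 : 0 <= B + e by rewrite addr_ge0 // ltW.
  have [|U [oU NU Ud]] := @lebesgue_regularity_outer R N' (d) mN' _ d0.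
    by apply: (@le_lt_trans _ _ 0%E); [rewrite le_eqVlt; apply/orP; left; apply/eqP; exact: N0|exact: ltry].
  have mU : measurable U by exact: open_measurable.
  have lU : (leb U < d%:E)%E.
    apply: le_lt_trans Ud; rewrite -[leLHS](_ : leb (N' `|` (U `\` N')) = _); last first.
      by rewrite setDUK.
    apply: le_trans (measureU2 _ mN' _) _; first exact: measurableD.
    by rewrite [X in (X + _)%E]N0 add0e.
  have : reached a b B e f U b.
    apply: reached_end => // c ac cb.
    have [Nc|Nc] := pselect (N' c).
      have /nbhs_ballP[r /= r0 rU] := open_nbhs_nbhs (conj oU (NU _ Nc)).
      exists r => // x y cx xc cy yc _ _ xy; right => z /=.
      rewrite in_itv /= => /andP[xz zy]; apply: rU.
      rewrite /ball /= ltr_distlC; apply/andP; split.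
        exact: lt_trans xz.
      exact: lt_trans yc.
    have [l lB dl] := df c ac cb (fun n => Nc (NN' _ n)).
    have [r r0 rP] := is_derive_local dl e0.
    exists r => // x y cx xc cy yc _ _ xy; left.
    have h1 : f y - f c <= (B + e) * (y - c).
      have := rP y; rewrite ger0_norm ?subr_ge0 // ltrBlDl => /(_ yc).
      move/(le_trans (ler_norm _)); rewrite lerBlDr -mulrDl => h.
      apply: le_trans h _; rewrite ler_wpM2r ?subr_ge0 // addrC lerD2r //.
    have h2 : f c - f x <= (B + e) * (c - x).
      have := rP x; rewrite distrC ger0_norm ?subr_ge0 // ltrBlDl -ltrBlDr => /(_ cx).
      rewrite -normrN => /(le_trans (ler_norm _)).
      rewrite (_ : - (f x - f c - l * (x - c)) = f c - f x - l * (c - x)); last by ring.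
      rewrite lerBlDr -mulrDl => h.
      apply: le_trans h _; rewrite ler_wpM2r ?subr_ge0 // addrC lerD2r //.
    rewrite (_ : f y - f x = (f y - f c) + (f c - f x)); last by ring.
    rewrite (_ : (B + e) * (y - x) = (B + e) * (y - c) + (B + e) * (c - x)); last by ring.
    exact: lerD.
  move=> [_ [_ [l [l1 l2 l3 l4]]]].
  apply: le_trans l4 _; rewrite lerD2l.
  pose u (i : 'I_(size l)) := (nth (0, 0) l i).1.
  pose v (i : 'I_(size l)) := (nth (0, 0) l i).2.
  have e1 (g : R * R -> R) : \sum_(p <- l) g p = \sum_(i < size l) g (u i, v i).
    by rewrite (big_nth (0, 0)) big_mkord; apply: eq_bigr => i _; rewrite /u /v -surjective_pairing.
  rewrite (e1 (fun p => `|f p.2 - f p.1|)) /=; apply: ltW; apply: dP.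
  - by move=> i; have [] := l2 _ (mem_nth (0, 0) (ltn_ord i)).
  - have tr (i j : 'I_(size l)) : (i < j)%N -> v j <= u i.
      move=> ij; have /(pairwiseP (0,0)) := l1.
      by move/(_ i j); rewrite !inE; apply.
    move=> i j _ _ [z [/=]]; rewrite !in_itv /= => /andP[i1 i2] /andP[j1 j2].
    case: (ltngtP i j) => [ij|ij|/ord_inj//].
      by move: (tr _ _ ij); rewrite leNgt (lt_trans i1 j2).
    by move: (tr _ _ ij); rewrite leNgt (lt_trans j1 i2).
  - rewrite -(e1 (fun p => p.2 - p.1)) -lte_fin.
    apply: le_lt_trans l3 _; apply: le_lt_trans lU.
    by apply: le_measure; rewrite ?inE //; exact: measurableI.
apply/ler_addgt0Pr => e e0.
have p0 : 0 < b - a + 1 by rewrite ltr_wpDl // subr_ge0.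
apply: le_trans (key (e / (b - a + 1)) _) _; first exact: divr_gt0.
rewrite mulrDl -addrA lerD2l -[X in _ + X]mulr1 -mulrDr divfK //.
by rewrite gt_eqF.
Qed.

End AbsolutelyContinuous.

Section Gronwall.
Variable R : realType.
Implicit Types (d : R -> R[i]) (a b : R).
Notation leb := (@lebesgue_measure R).

Lemma cac_sub a b a' b' d : a <= a' -> b' <= b ->
  absolutely_continuous_on a b d -> absolutely_continuous_on a' b' d.
Proof.
move=> aa bb acd e e0; have [r r0 rP] := acd e e0.
exists r => // n u v uv; apply: rP => i; have [h1 [h2 h3]] := uv i.
by split; [exact: le_trans h1|split => //; exact: le_trans bb].
Qed.

Lemma is_Cderive_Re d (t : R) (l c : R[i]) : is_Cderive d t l ->
  is_derive t (1 : R) (fun t => Re (c * d t)) (Re (c * l)).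
Proof.
move=> [d1 d2].
have := is_deriveB (is_deriveZ (Re c) d1) (is_deriveZ (Im c) d2).
have -> : (fun t => Re (c * d t)) =
    Re c \*: (fun u => Re (d u)) - Im c \*: (fun u => Im (d u)).
  by apply/funext => u; rewrite ReM.
by rewrite ReM.
Qed.

(** The real inequality is applied to the component in the direction of the
    increment. *)
Lemma cac_le a b (B : R) d (N : set R) : a <= b -> 0 <= B ->
  absolutely_continuous_on a b d -> leb.-negligible N ->
  (forall t, a <= t -> t <= b -> ~ N t ->
     exists2 l, nc l <= B & is_Cderive d t l) ->
  nc (d b - d a) <= B * (b - a).
Proof.
move=> ab B0 acd nN dd; set D := d b - d a.
have [->|D0] := eqVneq D 0; first by rewrite nc0 mulr_ge0 // subr_ge0.
have Dp : 0 < nc D by rewrite nc_gt0.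
have : Re (cj D * d b) - Re (cj D * d a) <= (nc D * B) * (b - a).
  apply: (@rac_le _ _ _ _ (fun t => Re (cj D * d t)) N) => //.
  - by rewrite mulr_ge0 ?nc_ge0.
  - exact: cac_rac.
  - move=> t ta tb Nt; have [l lB dl] := dd t ta tb Nt.
    exists (Re (cj D * l)); last exact: is_Cderive_Re.
    apply: le_trans (ler_norm _) _; apply: le_trans (Re_le_nc _) _.
    by rewrite ncM nc_conj ler_wpM2l // nc_ge0.
rewrite -ReB -mulrBr -/D (_ : Re (cj D * D) = nc D ^+ 2); last first.
  by rewrite nc_sq ReM; case: (D) => x y /=; ring.
by rewrite expr2 -mulrA ler_pM2l.
Qed.

Section Short.
Variables (K c S : R) (N : set R) (d : R -> R[i]).
Hypotheses (K0 : 0 <= K) (c0 : 0 <= c) (nN : leb.-negligible N).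

Definition linear_growth a b := forall t, a <= t -> t <= b -> ~ N t ->
  exists2 l, nc l <= K * nc (d t) + c & is_Cderive d t l.

Lemma linear_growth_sub a b a' b' : a <= a' -> b' <= b ->
  linear_growth a b -> linear_growth a' b'.
Proof.
by move=> aa bb h t ta tb; apply: h; [exact: le_trans ta|exact: le_trans bb].
Qed.

(** On a short interval the supremum of |d| can be absorbed into the left-hand
    side; S serves only to know that this supremum is finite. *)
Lemma gronwall_short a b : a <= b -> K * (b - a) <= 2^-1 ->
  absolutely_continuous_on a b d ->
  (forall t, a <= t -> t <= b -> nc (d t) <= S) ->
  linear_growth a b ->
  forall t, a <= t -> t <= b -> nc (d t) <= 2 * (nc (d a) + c * (b - a)).
Proof.
move=> ab Kab acd dS gr.
pose E := [set nc (d t) | t in [set t | a <= t /\ t <= b]].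
have hE : has_sup E.
  split; first by exists (nc (d a)), a.
  by exists S => _ [t [ta tb] <-]; exact: dS.
have dE t : a <= t -> t <= b -> nc (d t) <= sup E.
  by move=> ta tb; apply: ub_le_sup; [exact: hE.2|exists t].
have E0 : 0 <= sup E by apply: le_trans (nc_ge0 _) (dE a _ _).
suff h : sup E <= nc (d a) + c * (b - a) + sup E / 2.
  move=> t ta tb; apply: le_trans (dE t ta tb) _; lra.
apply: ge_sup; first by case: hE.
move=> _ [t [ta tb] <-].
have : nc (d t - d a) <= (K * sup E + c) * (t - a).
  apply: (@cac_le _ _ _ d N) => //.
  - by rewrite addr_ge0 // mulr_ge0.
  - exact: cac_sub acd.
  - move=> u ua ut Nu; have [l lB dl] := gr u ua (le_trans ut tb) Nu.
    exists l => //; apply: le_trans lB _; rewrite lerD2r ler_wpM2l //.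
    by apply: dE => //; exact: le_trans tb.
have : nc (d t) <= nc (d a) + nc (d t - d a).
  by rewrite -[d t in leLHS](subrKC (d a)) ncD.
have h1 : (K * sup E + c) * (t - a) <= (K * sup E + c) * (b - a).
  by rewrite ler_wpM2l ?lerD2r // addr_ge0 // mulr_ge0.
have h2 : K * (b - a) * sup E <= 2^-1 * sup E by rewrite ler_wpM2r.
rewrite mulrDl [K * _]mulrC -mulrA [sup E * _]mulrC in h1.
lra.
Qed.

Lemma gronwall_arith (A T h : R) : c * h <= c * T -> 0 <= A * T -> 0 <= A ->
  2 * (A + c * h) <= (3 + 2 * T) * (A + c).
Proof. by move: c0 => ? *; lra. Qed.

(** The interval is cut into n + 1 pieces, each short enough for the previous
    lemma; the factor 3 + 2 T is paid once for each piece. *)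
Lemma gronwall_iter n (T : R) a b : 0 <= T -> a <= b -> b - a <= T ->
  K * (b - a) <= n.+1%:R / 2 ->
  absolutely_continuous_on a b d ->
  (forall t, a <= t -> t <= b -> nc (d t) <= S) ->
  linear_growth a b ->
  forall t, a <= t -> t <= b -> nc (d t) <= (3 + 2 * T) ^+ n.+1 * (nc (d a) + c).
Proof.
move=> T0; elim: n a b => [|n IH] a b ab bT Kab acd dS gr t ta tb.
  rewrite mul1r in Kab.
  apply: le_trans (gronwall_short ab Kab acd dS gr ta tb) _.
  have h1 : c * (b - a) <= c * T by rewrite ler_wpM2l.
  have h2 : 0 <= nc (d a) * T by rewrite mulr_ge0 ?nc_ge0.
  have h3 := nc_ge0 (d a).
  rewrite expr1; exact: gronwall_arith h1 h2 h3.
pose m := a + (b - a) / n.+2%:R.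
have n20 : 0 < n.+2%:R :> R by rewrite ltr0n.
have am : a <= m by rewrite lerDl divr_ge0 ?subr_ge0 // ler0n.
have mb : m <= b.
  rewrite -lerBrDl ler_pdivrMr // ler_peMr ?subr_ge0 // ler1n //.
have Kam : K * (m - a) <= 2^-1.
  have -> : m - a = (b - a) / n.+2%:R by rewrite /m addrAC subrr add0r.
  by rewrite mulrA ler_pdivrMr // [2^-1 * _]mulrC.
have Kmb : K * (b - m) <= n.+1%:R / 2.
  have -> : b - m = (b - a) * n.+1%:R / n.+2%:R.
    have e : n.+2%:R = n.+1%:R + 1 :> R by rewrite natr1.
    move: n20; rewrite /m e; move: (n.+1%:R) => k k0.
    by field; rewrite gt_eqF.
  rewrite mulrA ler_pdivrMr // mulrA.
  have := ler_wpM2r (ler0n R n.+1) Kab; lra.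
have acam := cac_sub (lexx a) mb acd.
have dSam u (ua : a <= u) (um : u <= m) := dS u ua (le_trans um mb).
have gram := linear_growth_sub (lexx a) mb gr.
have hm := gronwall_short am Kam acam dSam gram.
have X0 : 0 <= nc (d a) + c by rewrite addr_ge0 ?nc_ge0.
have m2 : m - a <= T by apply: le_trans bT; rewrite lerD2r.
have cm2 : c * (m - a) <= c * T by rewrite ler_wpM2l.
have na0 := nc_ge0 (d a).
have nT : 0 <= nc (d a) * T by rewrite mulr_ge0.
have c0' := c0; have [tm|mt] := leP t m.
  apply: le_trans (hm t ta tm) _.
  apply: (@le_trans _ _ ((3 + 2 * T) * (nc (d a) + c))); first by lra.
  rewrite ler_wpM2r // exprS ler_peMr; [by []|lra|].
  by apply: exprn_ege1; lra.
apply: le_trans (IH m b mb _ Kmb (cac_sub am (lexx b) acd) _ _ t (ltW mt) tb) _.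
- by apply: le_trans bT; rewrite lerD2l lerN2.
- by move=> u um ub; apply: dS => //; exact: le_trans um.
- exact: linear_growth_sub gr.
rewrite [X in _ <= X * _]exprSr -mulrA ler_wpM2l //.
  by rewrite exprn_ge0 //; lra.
have := hm m am (lexx m); lra.
Qed.

End Short.

(** The constant depends on K and T alone, so that the inequality turns
    estimates on the initial value and on the source term c into estimates on
    the solution that are uniform in all other parameters. *)
Lemma gronwall (K T : R) : 0 <= K -> 0 <= T -> exists2 C : R, 0 <= C &
  forall (c S : R) (N : set R) d a b, 0 <= c -> leb.-negligible N ->
    a <= b -> b - a <= T ->
    absolutely_continuous_on a b d ->
    (forall t, a <= t -> t <= b -> nc (d t) <= S) ->
    linear_growth K c N d a b ->
    forall t, a <= t -> t <= b -> nc (d t) <= C * (nc (d a) + c).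
Proof.
move=> K0 T0.
pose n := Num.truncn (2 * (K * T)).
exists ((3 + 2 * T) ^+ n.+1); first by rewrite exprn_ge0 //; lra.
move=> c S N d a b c0 nN ab bT acd dS gr t ta tb.
apply: (gronwall_iter (S := S) K0 c0 nN T0 ab bT _ acd dS gr ta tb).
apply: (@le_trans _ _ (K * T)); first by rewrite ler_wpM2l.
rewrite ler_pdivlMr // mulrC ltW //; exact: truncnS_gt.
Qed.

End Gronwall.

(** * Helly's theorem and limits of Cauchy transforms *)

Section UltrafilterLimit.
Variable R : realType.

Lemma ultra_bounded_cvg (U : set_system nat) (x : nat -> R) (C : R) :
  UltraFilter U -> (forall n, 0 <= x n <= C) ->
  exists l : R, x n @[n --> U] --> l.
Proof.
move=> UU xC; have UP : ProperFilter U by exact: ultra_proper.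
have UI : (x n @[n --> U]) `[0, C]%classic.
  by apply: nearW => n /=; rewrite in_itv /= xC.
have [l [_ cl]] := @segment_compact R 0 C (x n @[n --> U]) _ UI.
exists l => B Bl; have [//|UB] := in_ultra_setVsetC (x @^-1` B) UU.
have [y [nBy By]] : (~` B `&` B) !=set0 by apply: cl.
by have := nBy By.
Qed.

End UltrafilterLimit.

Section StepApproximation.
Variable R : realType.
Implicit Types (nu : bmeasure R) (f c D a : nat -> R).

(** Abel summation: D is not assumed small, only summable, while c varies
    slowly. *)
Lemma summation_by_parts (c D : nat -> R) (w : R) m :
  (forall k, 0 <= D k) -> (forall k, (k < m)%N -> `|c k.+1 - c k| <= w) ->
  `|\sum_(k < m) c k * (D k.+1 - D k) - c m * D m + c 0 * D 0|
    <= w * \sum_(k < m) D k.+1.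
Proof.
move=> D0; elim: m => [|m IH] cw.
  by rewrite !big_ord0 sub0r addNr normr0 mulr0.
rewrite !big_ord_recr /=.
have -> : \sum_(i < m) c i * (D i.+1 - D i) + c m * (D m.+1 - D m)
    - c m.+1 * D m.+1 + c 0 * D 0
  = (\sum_(i < m) c i * (D i.+1 - D i) - c m * D m + c 0 * D 0)
    - (c m.+1 - c m) * D m.+1 by ring.
apply: le_trans (ler_normB _ _) _; rewrite mulrDr lerD //.
  by apply: IH => k km; apply: cw; exact: ltn_trans km _.
by rewrite normrM (ger0_norm (D0 _)) ler_wpM2r // cw.
Qed.

Variables (f : R -> R) (a : nat -> R).
Hypothesis a_mono : forall k, a k < a k.+1.

Fixpoint step m (x : R) : R := if m is k.+1 then
  step k x + f (a k) * \1_(`]a k, a k.+1] : set R) x else 0.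

Lemma a_le j k : (j <= k)%N -> a j <= a k.
Proof.
move=> /subnK <-; elim: (k - j)%N => [|n IH] //.
by rewrite addSn (le_trans IH) // ltW.
Qed.

Lemma step_out m x : x <= a 0 \/ a m < x -> step m x = 0.
Proof.
elim: m => [//|m IH] h /=.
rewrite IH ?add0r; last first.
  by case: h => [h|h]; [left|right; exact: le_lt_trans (ltW (a_mono m)) h].
rewrite indicE memNset ?mulr0 //= in_itv /= => /andP[h1 h2].
case: h => h; first by move: (lt_le_trans h1 h); rewrite ltNge a_le.
by move: (le_lt_trans h2 h); rewrite ltxx.
Qed.

Lemma step_in m (w : R) : 
  (forall k x, (k < m)%N -> a k < x -> x <= a k.+1 -> `|f x - f (a k)| <= w) ->
  forall x, a 0 < x -> x <= a m -> `|f x - step m x| <= w.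
Proof.
elim: m => [|m IH] fw x x0 xm.
  by move: (lt_le_trans x0 xm); rewrite ltxx.
have [xam|amx] := leP x (a m).
  rewrite /= indicE memNset ?mulr0 ?addr0; last first.
    by rewrite /= in_itv /= ltNge xam.
  by apply: IH => // k y km; apply: fw; exact: ltn_trans km _.
rewrite /= step_out ?add0r; last by right.
rewrite indicE mem_set ?mulr1; first exact: fw.
by rewrite /= in_itv /= amx.
Qed.

Lemma step_integral nu (Phi : R -> R) m : (nu setT < +oo)%E ->
  (forall x y, x < y -> nu `]x, y]%classic = (Phi y - Phi x)%:E) ->
  nu.-integrable setT (EFin \o step m) /\
  \int[nu]_x step m x = \sum_(k < m) f (a k) * (Phi (a k.+1) - Phi (a k)).
Proof.
move=> nufin nuE; elim: m => [|m [IHi IH]].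
  split; first exact: cst_integrable.
  by rewrite big_ord0 /= Rintegral_cst // mul0r.
have I1 : nu.-integrable setT (EFin \o (\1_(`]a m, a m.+1] : set R) : R -> R)).
  apply: (@bounded_integrable _ nu _ 1) => // x.
  by rewrite indicE; case: (_ \in _); rewrite ?normr1 ?normr0.
have I2 : nu.-integrable setT (EFin \o (fun x => f (a m) * \1_(`]a m, a m.+1] : set R) x)).
  exact: (@integrableZl _ _ _ nu setT measurableT (f (a m)) _ I1).
split; first exact: (integrableD measurableT IHi I2).
rewrite big_ord_recr /= RintegralD // IH RintegralZl //; congr (_ + _ * _).
by rewrite /Rintegral integral_indic // setIT nuE.
Qed.

(** For a function that is nearly constant on the cells and nearly zero
    outside of them, the integral is a Riemann-Stieltjes sum up to w C. *)
Lemma step_approx nu (Phi : R -> R) (C w : R) m : (nu setT <= C%:E)%E ->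
  0 <= w -> lipfun f ->
  (forall x y, x < y -> nu `]x, y]%classic = (Phi y - Phi x)%:E) ->
  (forall k x, (k < m)%N -> a k < x -> x <= a k.+1 -> `|f x - f (a k)| <= w) ->
  (forall x, x <= a 0 \/ a m < x -> `|f x| <= w) ->
  `|\int[nu]_x f x - \sum_(k < m) f (a k) * (Phi (a k.+1) - Phi (a k))|
    <= w * C.
Proof.
move=> nuC w0 fL nuE fw fout.
have nufin : (nu setT < +oo)%E by rewrite (le_lt_trans nuC) ?ltry.
have fs x : `|f x - step m x| <= w.
  have [x0|x0] := leP x (a 0).
    by rewrite step_out ?subr0; [apply: fout; left|left].
  have [xm|xm] := leP x (a m); first exact: step_in.
  by rewrite step_out ?subr0; [apply: fout; right|right].
have [si <-] := step_integral m nufin nuE.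
have mfs : measurable_fun setT ((fun x => f x - step m x) : measurableTypeR R -> measurableTypeR R).
  apply: measurable_funB; first exact: lipfun_measurable.
  by have /integrableP[/measurable_EFinP] := si.
have fsi := bounded_integrable nufin mfs fs.
have fi : nu.-integrable setT (EFin \o f).
  have := integrableD measurableT fsi si.
  by congr integrable; apply/funext => x /=; rewrite -EFinD subrK.
rewrite -RintegralB //.
apply: le_trans (le_normr_Rintegral measurableT fsi) _.
apply: le_Rintegral_mass => //.
apply: (@bounded_integrable _ nu _ w) => //.
  exact: measurableT_comp mfs.
by move=> x; rewrite normr_id.
Qed.

End StepApproximation.

Section Helly.
Variable R : realType.
Implicit Types (nu : bmeasure R).

(** The right-continuous regularisation of a bounded monotone function. *)
Definition rreg (L : R -> R) (x : R) : R := inf [set L y | y in [set y | x < y]].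

Section Regularisation.
Variables (L : R -> R) (C : R).
Hypotheses (L_mono : forall x y, x <= y -> L x <= L y)
  (L_ge0 : forall x, 0 <= L x) (L_le : forall x, L x <= C).

Let hi x : has_inf [set L y | y in [set y | x < y]].
Proof.
split; first by exists (L (x + 1)), (x + 1) => //=; rewrite ltrDl.
by exists 0 => _ [y _ <-].
Qed.

Lemma rreg_ge x : L x <= rreg L x.
Proof.
apply: lb_le_inf; first by case: (hi x).
by move=> _ [y /= xy <-]; apply: L_mono; exact: ltW.
Qed.

Lemma rreg_le x y : x < y -> rreg L x <= L y.
Proof. by move=> xy; apply: ge_inf; [case: (hi x)|exists y]. Qed.

Lemma rreg_mono x y : x <= y -> rreg L x <= rreg L y.
Proof.
rewrite le_eqVlt => /orP[/eqP -> //|xy].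
exact: le_trans (rreg_le xy) (rreg_ge y).
Qed.

Lemma rreg_right x : rreg L y @[y --> x^'+] --> rreg L x.
Proof.
apply/cvgrPdist_lt => e e0.
have [_ [y /= xy <-] ye] := inf_adherent e0 (hi x).
near=> z.
have xz : x < z by [].
have zy : z < y by near: z; exact: nbhs_right_lt.
rewrite distrC ger0_norm ?subr_ge0; last by apply: rreg_mono; exact: ltW.
rewrite ltrBlDl; apply: le_lt_trans ye; exact: rreg_le.
Unshelve. all: by end_near. Qed.

HB.instance Definition _ := isCumulative.Build R _ R (rreg L)
  (fun x y => @rreg_mono x y) rreg_right.

Definition rreg_measure : bmeasure R :=
  lebesgue_stieltjes_measure (rreg L : cumulative R R).

Lemma rreg_measure_itv x y : x < y ->
  rreg_measure `]x, y]%classic = (rreg L y - rreg L x)%:E.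
Proof.
move=> xy; rewrite /rreg_measure /= /lebesgue_stieltjes_measure.
rewrite /measure_extension measurable_mu_extE /=; last exact: is_ocitv.
by rewrite wlength_itv_bnd // ltW.
Qed.

Lemma rreg_measure_le : (rreg_measure setT <= C%:E)%E.
Proof.
rewrite -(bigcup_itvT false false).
pose I n : set R := `]- (n%:R), n%:R]%classic.
have cv : (rreg_measure \o I) n @[n --> \oo] --> rreg_measure (\bigcup_n I n).
  apply: nondecreasing_cvg_mu; rewrite /I //; first exact: bigcup_measurable.
  by move=> *; apply/subsetPset/subset_itv; rewrite leBSide/= ?lerN2 ler_nat.
apply: (cvge_to_le cv); apply: nearW => n /=; rewrite /I.
case: n => [|n].
  rewrite oppr0 set_itv_ge ?bnd_simp ?ltxx // measure0 lee_fin.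
  exact: le_trans (L_ge0 0) (L_le 0).
rewrite rreg_measure_itv ?gtrN ?ltr0n // lee_fin lerBlDr.
apply: (@le_trans _ _ C).
  by apply: le_trans (L_le (n.+1%:R + 1)); apply: rreg_le; rewrite ltrDl.
by rewrite lerDl; apply: le_trans (L_ge0 _) (rreg_ge _).
Qed.

End Regularisation.

Lemma measure_itv_cdf nu x y : (nu setT < +oo)%E -> x < y ->
  nu `]x, y]%classic = (fine (nu `]-oo, y]%classic) - fine (nu `]-oo, x]%classic))%:E.
Proof.
move=> nufin xy.
have fin A : measurable A -> nu A \is a fin_num.
  move=> mA; rewrite ge0_fin_numE //; apply: le_lt_trans nufin.
  by apply: le_measure; rewrite ?inE.
have : nu `]-oo, y]%classic = (nu `]-oo, x]%classic + nu `]x, y]%classic)%E.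
  rewrite -measureU //.
    congr (nu _); apply/seteqP; split => z /=; rewrite !in_itv /=.
      by move=> zy; have [zx|zx] := leP z x; [left|right; rewrite zy].
    by case => [zx|/andP[]//]; rewrite (le_trans zx) // ltW.
  apply/seteqP; split => z //=; rewrite !in_itv /= => -[zx /andP[xz _]].
  by move: (le_lt_trans zx xz); rewrite ltxx.
move=> ->; rewrite fineD ?fin // addrAC subrr add0r fineK //; exact: fin.
Qed.

(** Helly's theorem, with a limit along an ultrafilter in place of a
    subsequence: the ultrafilter limit of the distribution functions, made
    right continuous, is the distribution function of nu0. Regularising changes
    values by amounts of bounded sum, so that Abel summation makes the
    change negligible. *)
Lemma helly (nu : nat -> bmeasure R) (C : R) :
  (forall n, (nu n setT <= C%:E)%E) ->
  exists2 nu0 : bmeasure R, (nu0 setT <= C%:E)%E &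
    forall f : R -> R, lipfun f ->
      (forall e, 0 < e -> exists2 A : R, 0 < A & forall x, A <= `|x| -> `|f x| <= e) ->
      forall l : R, \int[nu n]_x f x @[n --> \oo] --> l ->
      \int[nu0]_x f x = l.
Proof.
move=> nuC.
have C0 : 0 <= C by rewrite -lee_fin (le_trans _ (nuC 0%N)) // measure_ge0.
have nufin n : (nu n setT < +oo)%E by rewrite (le_lt_trans (nuC n)) ?ltry.
pose F n x := fine (nu n `]-oo, x]%classic).
have FE n x : nu n `]-oo, x]%classic = (F n x)%:E.
  rewrite /F fineK // ge0_fin_numE //; apply: le_lt_trans (nufin n).
  by apply: le_measure; rewrite ?inE.
have F01 n x : 0 <= F n x <= C.
  rewrite fine_ge0 //= -lee_fin -FE; apply: le_trans (nuC n).
  by apply: le_measure; rewrite ?inE.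
have Fm n x y : x <= y -> F n x <= F n y.
  move=> xy; rewrite -lee_fin -!FE; apply: le_measure; rewrite ?inE //.
  by move=> z /=; rewrite !in_itv /= => zx; exact: le_trans xy.
have [U [UU oU]] := @ultraFilterLemma nat \oo _.
have UP : ProperFilter U by exact: ultra_proper.
have /choice[L LP] x : exists l : R, F n x @[n --> U] --> l.
  exact: (ultra_bounded_cvg UU (fun n => F01 n x)).
have L_mono x y : x <= y -> L x <= L y.
  move=> xy; apply: (ler_cvg_to (LP x) (LP y)); apply: nearW => n; exact: Fm.
have L_ge0 x : 0 <= L x.
  by apply: (cvgr_to_ge (LP x)); apply: nearW => n; case/andP: (F01 n x).
have L_le x : L x <= C.
  by apply: (cvgr_to_le (LP x)); apply: nearW => n; case/andP: (F01 n x).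
exists (rreg_measure L_mono L_ge0); first exact: rreg_measure_le.
move=> f fL fdec l fl.
suff key e : 0 < e -> `|\int[rreg_measure L_mono L_ge0]_x f x - l| <= e * (5 * C + 2).
  apply/eqP; rewrite -subr_eq0 -normr_le0; apply/ler_addgt0Pr => e e0.
  have p0 : 0 < 5 * C + 2 by rewrite ltr_wpDl // mulr_ge0.
  by rewrite add0r (le_trans (key _ (divr_gt0 e0 p0))) // divfK // gt_eqF.
move=> e0; have [A A0 fA] := fdec e e0.
have [K fK] := fL.
have K1 : 0 < `|K| + 1 by rewrite ltr_wpDl.
(* [-A, A] is cut into m cells so short that f varies by at most e on each. *)
pose m := (Num.truncn (2 * A * (`|K| + 1) / e)).+1.
pose dl := 2 * A / m%:R.
have m0 : 0 < m%:R :> R by rewrite ltr0n.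
have dl0 : 0 < dl by rewrite divr_gt0 // mulr_gt0.
have Kdl : K * dl <= e.
  apply: (@le_trans _ _ ((`|K| + 1) * dl)).
    by rewrite ler_wpM2r ?(ltW dl0) // (le_trans (ler_norm _)) // lerDl.
  have h : 2 * A * (`|K| + 1) / e <= m%:R by apply: ltW; exact: truncnS_gt.
  rewrite /dl mulrA ler_pdivrMr // [e * _]mulrC -ler_pdivrMr //.
  by apply: le_trans h; rewrite [(_ + 1) * _]mulrC.
pose a k : R := - A + k%:R * dl.
have aS k : a k.+1 = a k + dl by rewrite /a -natr1 mulrDl mul1r addrA.
have a_mono k : a k < a k.+1 by rewrite aS ltrDl.
have a0 : a 0 = - A by rewrite /a mul0r addr0.
have am : a m = A by rewrite /a /dl mulrC divfK ?gt_eqF //; lra.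
have Ksign : forall x y, x <= y -> y <= x + dl -> `|f y - f x| <= e.
  move=> x y xy yx; apply: le_trans (fK y x) _.
  have [K0|K0] := leP 0 K.
    apply: le_trans Kdl; rewrite ler_wpM2l // ger0_norm ?subr_ge0 //.
    by rewrite lerBlDl.
  by apply: le_trans (ltW e0); rewrite mulr_le0_ge0 // ltW.
have fw k x : (k < m)%N -> a k < x -> x <= a k.+1 -> `|f x - f (a k)| <= e.
  by move=> _ ax xa; apply: Ksign; [exact: ltW|rewrite -aS].
have fout x : x <= a 0 \/ a m < x -> `|f x| <= e.
  rewrite a0 am => -[h|h]; apply: fA.
    by rewrite -normrN (le_trans _ (ler_norm _)) // lerNr.
  by rewrite (le_trans (ltW h)) // ler_norm.
pose S (Phi : R -> R) := \sum_(k < m) f (a k) * (Phi (a k.+1) - Phi (a k)).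
have h0 : `|\int[rreg_measure L_mono L_ge0]_x f x - S (rreg L)| <= e * C.
  apply: step_approx => //.
  - exact: rreg_measure_le.
  - exact: ltW.
  - by move=> x y xy; exact: rreg_measure_itv.
have hn n : `|\int[nu n]_x f x - S (F n)| <= e * C.
  apply: step_approx => //; first exact: ltW.
  by move=> x y xy; rewrite (measure_itv_cdf (nufin n) xy).
have hL : `|S (rreg L) - S L| <= e * (3 * C).
  pose D k := rreg L (a k) - L (a k).
  have D0 k : 0 <= D k by rewrite subr_ge0; exact: rreg_ge.
  have DC k : D k <= C.
    rewrite lerBlDr (le_trans (rreg_le L_ge0 (a_mono k))) //.
    by rewrite (le_trans (L_le _)) // lerDl.
  have -> : S (rreg L) - S L = \sum_(k < m) f (a k) * (D k.+1 - D k).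
    by rewrite -sumrB; apply: eq_bigr => k _; rewrite /D; ring.
  have := @summation_by_parts _ (f \o a) D e m D0.
  have cw k : (k < m)%N -> `|(f \o a) k.+1 - (f \o a) k| <= e.
    by move=> _; apply: Ksign; [exact: ltW|rewrite -aS].
  move=> /(_ cw) /=; set X := \sum_(k < m) f _ * _.
  have DS : \sum_(k < m) D k.+1 <= C.
    have : \sum_(k < m) D k.+1 <= \sum_(k < m) (L (a k.+2) - L (a k.+1)).
      by apply: ler_sum => k _; rewrite lerD2r; exact: rreg_le.
    have : \sum_(k < m) (L (a k.+2) - L (a k.+1)) = L (a m.+1) - L (a 1%N).
      rewrite -(big_mkord xpredT (fun k => L (a k.+2) - L (a k.+1))).
      by rewrite (telescope_sumr (fun k => L (a k.+1)) (leq0n m)).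
    move=> -> /le_trans; apply; rewrite lerBlDr (le_trans (L_le _)) // lerDl.
    exact: L_ge0.
  have f0 : `|f (a 0)| <= e by apply: fout; left.
  have fm : `|f (a m)| <= e by rewrite am; apply: fA; rewrite ger0_norm // ltW.
  have b0 : `|f (a 0) * D 0%N| <= e * C.
    by rewrite normrM (ger0_norm (D0 _)) ler_pM.
  have bm : `|f (a m) * D m| <= e * C.
    by rewrite normrM (ger0_norm (D0 _)) ler_pM.
  have bS : e * \sum_(k < m) D k.+1 <= e * C by rewrite ler_wpM2l // ltW.
  move=> h.
  have -> : X = (X - f (a m) * D m + f (a 0) * D 0%N) + (f (a m) * D m - f (a 0) * D 0%N).
    by ring.
  apply: le_trans (ler_normD _ _) _.
  have := ler_normB (f (a m) * D m) (f (a 0) * D 0%N).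
  lra.
have SL : S (F n) @[n --> U] --> S L.
  rewrite /S; elim: (m) => [|k IH].
    by under eq_fun do rewrite big_ord0; rewrite big_ord0; exact: cvg_cst.
  under eq_fun do rewrite big_ord_recr /=.
  rewrite big_ord_recr /=; apply: cvgD => //.
  by apply: cvgM; [exact: cvg_cst|exact: cvgB].
have fU : \int[nu n]_x f x @[n --> U] --> l by move=> B /fl /oU.
have : \forall n \near U, `|S L - S (F n)| <= e /\ `|l - \int[nu n]_x f x| <= e.
  near=> n; split; near: n.
    by move/cvgrPdist_le: SL; apply.
  by move/cvgrPdist_le: fU; apply.
move/filter_ex => [n [q1 q2]].
have := hn n; move: h0 hL q1 q2; rewrite !ler_norml; lra.
Unshelve. all: by end_near. Qed.

End Helly.

Section CauchyClosed.
Variable R : realType.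

Lemma res_decay (z : R[i]) (e : R) : 0 < e ->
  exists2 A : R, 0 < A & forall x, A <= `|x| -> nc (res z x) <= e.
Proof.
move=> e0; exists (nc z + e^-1); first by rewrite ltr_wpDl ?nc_ge0 // invr_gt0.
move=> x Ax; rewrite -[e]invrK; apply: nc_inv_le; first by rewrite invr_gt0.
have : nc x%:C <= nc z + nc (x%:C - z).
  by rewrite -[x%:C in leLHS](subrKC z) ncD.
rewrite ncR (nc_distC _ z); lra.
Qed.

Definition ccvg (u : nat -> R[i]) (l : R[i]) := nc (u n - l) @[n --> \oo] --> (0 : R).

Lemma ccvg_Re u l : ccvg u l -> Re (u n) @[n --> \oo] --> Re l.
Proof.
move=> ul; apply/cvgrPdist_le => e e0; near=> n.
rewrite distrC -ReB; apply: le_trans (Re_le_nc _) _.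
have : `|0 - nc (u n - l)| <= e by near: n; move/cvgrPdist_le: ul; apply.
by rewrite sub0r normrN ger0_norm ?nc_ge0.
Unshelve. all: by end_near. Qed.

Lemma ccvg_Im u l : ccvg u l -> Im (u n) @[n --> \oo] --> Im l.
Proof.
move=> ul; apply/cvgrPdist_le => e e0; near=> n.
rewrite distrC -ImB; apply: le_trans (Im_le_nc _) _.
have : `|0 - nc (u n - l)| <= e by near: n; move/cvgrPdist_le: ul; apply.
by rewrite sub0r normrN ger0_norm ?nc_ge0.
Unshelve. all: by end_near. Qed.

Lemma ccvg_le u l (v : nat -> R) : (\forall n \near \oo, nc (u n - l) <= v n) ->
  v n @[n --> \oo] --> (0 : R) -> ccvg u l.
Proof.
move=> uv v0; apply/cvgrPdist_le => e e0; near=> n.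
rewrite sub0r normrN ger0_norm ?nc_ge0 //.
have : `|0 - v n| <= e by near: n; move/cvgrPdist_le: v0; apply.
rewrite sub0r normrN => h; apply: le_trans h; apply: le_trans (ler_norm _).
by near: n.
Unshelve. all: by end_near. Qed.

(** The measure nu0 is fixed before z: it identifies the limit at every single
    point where the transforms happen to converge. *)
Lemma helly_cauchy (nu : nat -> bmeasure R) (C : R) :
  (forall n, (nu n setT <= C%:E)%E) ->
  exists2 nu0 : bmeasure R, (nu0 setT <= C%:E)%E &
    forall z l, 0 < Im z -> ccvg (fun n => cauchy (nu n) z) l -> cauchy nu0 z = l.
Proof.
move=> nuC; have [nu0 nu0C nu0P] := helly nuC.
exists nu0 => // z l z0 nul.
have [B [_ rL]] := blip_res z0.
apply: ceq; rewrite /cauchy /cint /=; apply: nu0P.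
- by exists B => x y; rewrite -ReB; apply: le_trans (Re_le_nc _) _.
- move=> e e0; have [A A0 AP] := res_decay z e0.
  by exists A => // x Ax; apply: le_trans (Re_le_nc _) (AP x Ax).
- exact: ccvg_Re nul.
- by exists B => x y; rewrite -ImB; apply: le_trans (Im_le_nc _) _.
- move=> e e0; have [A A0 AP] := res_decay z e0.
  by exists A => // x Ax; apply: le_trans (Im_le_nc _) (AP x Ax).
- exact: ccvg_Im nul.
Qed.

Lemma cauchy_closed (nu : nat -> bmeasure R) (C : R) (g : R[i] -> R[i]) :
  (forall n, (nu n setT <= C%:E)%E) ->
  (forall z, 0 < Im z -> ccvg (fun n => cauchy (nu n) z) (g z)) ->
  exists2 nu0 : bmeasure R, (nu0 setT <= C%:E)%E &
    forall z, 0 < Im z -> cauchy nu0 z = g z.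
Proof.
move=> nuC nug; have [nu0 nu0C nu0P] := helly_cauchy nuC.
by exists nu0 => // z z0; apply: nu0P => //; exact: nug.
Qed.

End CauchyClosed.

(** * Tame functions and Cauchy's theorem for Riemann sums *)

Section Tame.
Variable R : realType.
Variable D : set R[i].
Implicit Types (f g : R[i] -> R[i]) (w : R[i]).

(** (w1 - w)(w2 - w) times the difference of the two divided differences of f
    at w, written without division. *)
Definition ddiff f w w1 w2 := (f w1 - f w) * (w2 - w) - (f w2 - f w) * (w1 - w).

(** Lipschitz, with Lipschitz divided differences. For functions on a half
    plane this is a quantitative substitute for holomorphy that needs no limit
    and is stable under algebraic operations. *)
Definition lip2 f (K : R) := 0 <= K /\
  forall w w1 w2, D w -> D w1 -> D w2 ->
    nc (f w1 - f w) <= K * nc (w1 - w) /\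
    nc (ddiff f w w1 w2) <= K * (nc (w1 - w) * nc (w2 - w) * nc (w1 - w2)).

Definition tame f K := lip2 f K /\ forall w, D w -> nc (f w) <= K.

Lemma tame_cst c : tame (fun _ => c) (nc c).
Proof.
split; last by move=> *.
split; first exact: nc_ge0.
move=> w w1 w2 _ _ _; rewrite /ddiff subrr !mul0r subrr nc0.
by split; rewrite !mulr_ge0 ?nc_ge0.
Qed.

Lemma tameD f g K L : tame f K -> tame g L -> tame (fun w => f w + g w) (K + L).
Proof.
move=> [[K0 fL] fB] [[L0 gL] gB]; split; last first.
  by move=> w Dw; apply: le_trans (ncD _ _) _; rewrite lerD ?fB ?gB.
split; first exact: addr_ge0.
move=> w w1 w2 Dw D1 D2; have [f1 f2] := fL _ _ _ Dw D1 D2.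
have [g1 g2] := gL _ _ _ Dw D1 D2; split.
  by rewrite opprD addrACA mulrDl (le_trans (ncD _ _)) // lerD.
have -> : ddiff (fun w => f w + g w) w w1 w2 = ddiff f w w1 w2 + ddiff g w w1 w2.
  by rewrite /ddiff; ring.
by rewrite mulrDl (le_trans (ncD _ _)) // lerD.
Qed.

Lemma tameM f g K L : tame f K -> tame g L ->
  tame (fun w => f w * g w) (3 * (K * L)).
Proof.
move=> [[K0 fL] fB] [[L0 gL] gB].
have KL : 0 <= K * L by rewrite mulr_ge0.
split; last first.
  move=> w Dw; rewrite ncM; apply: (@le_trans _ _ (K * L)); last by lra.
  by rewrite ler_pM ?nc_ge0 ?fB ?gB.
split; first by lra.
move=> w w1 w2 Dw D1 D2; have [f1 f2] := fL _ _ _ Dw D1 D2.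
have [g1 g2] := gL _ _ _ Dw D1 D2; split.
  have -> : f w1 * g w1 - f w * g w = (f w1 - f w) * g w1 + f w * (g w1 - g w).
    by ring.
  apply: (@le_trans _ _ (K * nc (w1 - w) * L + K * (L * nc (w1 - w)))).
    by apply: le_trans (ncD _ _) _; rewrite !ncM lerD // ler_pM ?nc_ge0 ?fB ?gB.
  have : 0 <= K * L * nc (w1 - w) by rewrite mulr_ge0 ?nc_ge0.
  by lra.
have -> : ddiff (fun w => f w * g w) w w1 w2 = ddiff f w w1 w2 * g w1 +
    ((f w2 - f w) * (w1 - w) * (g w1 - g w2) + f w * ddiff g w w1 w2).
  by rewrite /ddiff; ring.
set X := nc (w1 - w) * nc (w2 - w) * nc (w1 - w2).
apply: (@le_trans _ _ (K * X * L + ((K * nc (w2 - w)) * nc (w1 - w) * (L * nc (w1 - w2)) + K * (L * X)))).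
  apply: le_trans (ncD _ _) _; apply: lerD.
    by rewrite ncM ler_pM ?nc_ge0 ?gB.
  apply: le_trans (ncD _ _) _; apply: lerD; rewrite !ncM.
    apply: ler_pM; rewrite ?mulr_ge0 ?nc_ge0 //.
      by apply: ler_wpM2r; rewrite ?nc_ge0 //; have [] := fL _ _ _ Dw D2 D2.
    by have [] := gL _ _ _ D2 D1 D2.
  by rewrite ler_pM ?nc_ge0 ?fB.
by rewrite /X le_eqVlt; apply/orP; left; apply/eqP; ring.
Qed.

(** The pole c does not enter the constant, so the class is preserved when the
    resolvents of f are integrated over real poles. *)
Lemma tame_inv f K (c : R[i]) (e : R) : lip2 f K -> 0 < e ->
  (forall w, D w -> e <= nc (f w - c)) ->
  tame (fun w => (f w - c)^-1) (e^-1 + K * e ^- 2 + K * K * e ^- 3).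
Proof.
move=> [K0 fL] e0 fc.
have i0 : 0 <= e^-1 by rewrite invr_ge0 ltW.
rewrite -!exprVn; set i := e^-1 in i0 *.
have p1 : 0 <= K * i ^+ 2 by rewrite mulr_ge0 ?exprn_ge0.
have p2 : 0 <= K * K * i ^+ 3 by rewrite !mulr_ge0 ?exprn_ge0.
have ri w : D w -> nc (f w - c)^-1 <= i by move=> Dw; apply: nc_inv_le => //; exact: fc.
have n0 w : D w -> f w - c != 0.
  by move=> Dw; rewrite -nc_gt0 (lt_le_trans e0) // fc.
have rL w w1 : D w -> D w1 -> nc ((f w1 - c)^-1 - (f w - c)^-1) <= K * i ^+ 2 * nc (w1 - w).
  move=> Dw D1; have [f1 _] := fL _ _ _ Dw D1 D1.
  have -> : (f w1 - c)^-1 - (f w - c)^-1 = - ((f w1 - f w) * ((f w1 - c)^-1 * (f w - c)^-1)).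
    by field; rewrite !n0.
  rewrite ncN !ncM; apply: (@le_trans _ _ (K * nc (w1 - w) * (i * i))).
    by apply: ler_pM; rewrite ?mulr_ge0 ?nc_ge0 // ler_pM ?nc_ge0 ?ri.
  by rewrite le_eqVlt; apply/orP; left; apply/eqP; ring.
split; last by move=> w Dw; apply: le_trans (ri w Dw) _; lra.
split; first lra.
move=> w w1 w2 Dw D1 D2; split.
  by apply: le_trans (rL _ _ Dw D1) _; rewrite ler_wpM2r ?nc_ge0 //; lra.
have -> : ddiff (fun w => (f w - c)^-1) w w1 w2 = - ((f w - c)^-1 *
    (ddiff f w w1 w2 * (f w1 - c)^-1 +
     (f w2 - f w) * (w1 - w) * ((f w1 - c)^-1 - (f w2 - c)^-1))).
  by rewrite /ddiff; field; rewrite !n0.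
have [_ f2] := fL _ _ _ Dw D1 D2; have [f1 _] := fL _ _ _ Dw D2 D2.
rewrite ncN ncM; set X := nc (w1 - w) * nc (w2 - w) * nc (w1 - w2) in f2 *.
have X0 : 0 <= X by rewrite !mulr_ge0 ?nc_ge0.
apply: (@le_trans _ _ (i * (K * X * i + (K * nc (w2 - w)) * nc (w1 - w) * (K * i ^+ 2 * nc (w1 - w2))))).
  apply: ler_pM; rewrite ?nc_ge0 ?ri //.
  apply: le_trans (ncD _ _) _; apply: lerD; rewrite !ncM.
    by rewrite ler_pM ?nc_ge0 ?ri.
  apply: ler_pM; rewrite ?mulr_ge0 ?nc_ge0 ?rL //.
  by rewrite ler_wpM2r ?nc_ge0.
have -> : i * (K * X * i + (K * nc (w2 - w)) * nc (w1 - w) * (K * i ^+ 2 * nc (w1 - w2)))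
  = (K * i ^+ 2 + K * K * i ^+ 3) * X by rewrite /X; ring.
by rewrite ler_wpM2r // -addrA lerDr.
Qed.

Lemma lip2_id : lip2 id 1.
Proof.
split=> // w w1 w2 _ _ _; rewrite mul1r lexx; split=> //.
have -> : ddiff id w w1 w2 = 0 by rewrite /ddiff; ring.
by rewrite nc0 mul1r !mulr_ge0 ?nc_ge0.
Qed.

End Tame.

Section Contour.
Variable R : realType.
Implicit Types (f : R[i] -> R[i]).

Definition uhp_closed : set R[i] := [set w | 0 <= Im w].

Variables (h : R) (N : nat).
Hypothesis h0 : 0 <= h.
Let L : R := N%:R * h.
Definition gridx k : R := (k%:R - N%:R) * h.
Definition gridsum f (y : R) : R[i] := h%:C * \sum_(k < N.*2) f (gridx k +i* y).

Let gridxS k : gridx k.+1 = gridx k + h.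
Proof. by rewrite /gridx -natr1; ring. Qed.

Lemma gridx_bound k : (k <= N.*2)%N -> `|gridx k| <= L.
Proof.
move=> kN; rewrite /gridx normrM (ger0_norm h0) ler_wpM2r // ler_norml.
rewrite lerBrDr addNr ler0n /= lerBlDr -natrD ler_nat addnn //.
Qed.

(** One step of the contour shift. By the estimate on divided differences, f
    changes under an upward move by h as i times under a move to the right by
    h, up to second order in h; the latter changes telescope. *)
Lemma gridsum_step f (K B y : R) : lip2 uhp_closed f K -> 0 <= y ->
  nc (f ((- L) +i* y)) <= B -> nc (f (L +i* y)) <= B ->
  nc (gridsum f (y + h) - gridsum f y) <= h * (2 * B + 4 * K * h * L).
Proof.
move=> [K0 fK] y0 fl fr; rewrite /gridsum -mulrBr -sumrB.
have -> : \sum_(k < N.*2) (f (gridx k +i* (y + h)) - f (gridx k +i* y)) =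
  'i * (f (L +i* y) - f ((- L) +i* y)) +
  \sum_(k < N.*2) ((f (gridx k +i* (y + h)) - f (gridx k +i* y)) -
    'i * (f (gridx k.+1 +i* y) - f (gridx k +i* y))).
  rewrite [in RHS]sumrB -[X in _ = _ + (_ - X)]mulr_sumr.
  rewrite -(big_mkord xpredT (fun k => f (gridx k.+1 +i* y) - f (gridx k +i* y))).
  rewrite (telescope_sumr (fun k => f (gridx k +i* y)) (leq0n _)).
  have -> : gridx N.*2 = L by rewrite /gridx -addnn natrD addrK.
  have -> : gridx 0 = - L by rewrite /gridx sub0r mulNr.
  by ring.
rewrite ncM ncR (ger0_norm h0) ler_wpM2l //.
apply: le_trans (ncD _ _) _; apply: lerD.
  rewrite ncM nci mul1r; apply: le_trans (ncB _ _) _; lra.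
apply: le_trans (nc_sum _ _) _.
have -> : 4 * K * h * L = \sum_(k < N.*2) 2 * K * h ^+ 2.
  by rewrite sumr_const card_ord /L -[_ *+ N.*2]mulr_natr -addnn natrD; ring.
apply: ler_sum => k _; rewrite gridxS.
move: (gridx k) => x.
have [->|hn0] := eqVneq h 0.
  rewrite !addr0 !subrr mulr0 subr0 nc0 !mulr_ge0 //.
have hp : 0 < h by rewrite lt0r hn0.
have D0 : uhp_closed (x +i* y) by [].
have D1 : uhp_closed (x +i* (y + h)) by rewrite /uhp_closed /= addr_ge0.
have D2 : uhp_closed ((x + h) +i* y) by [].
have [_] := fK _ _ _ D0 D1 D2.
have e1 : x +i* (y + h) - (x +i* y) = 'i * h%:C by apply: ceq; rewrite ?ReB ?ImB ?ReM ?ImM /=; ring.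
have e2 : (x + h) +i* y - (x +i* y) = h%:C by apply: ceq; rewrite ?ReB ?ImB ?ReM ?ImM /=; ring.
have e3 : x +i* (y + h) - ((x + h) +i* y) = h%:C * ('i - 1).
  by apply: ceq; rewrite ?ReB ?ImB ?ReM ?ImM /= ?ReB ?ImB /=; ring.
rewrite /ddiff e1 e2 e3 !ncM nci mul1r ncR (ger0_norm h0) => hh.
have ni : nc ('i - 1 : R[i]) <= 2.
  by apply: le_trans (ncB _ _) _; rewrite nci nc1; lra.
rewrite -(ler_pM2l hp) -{1}(ger0_norm h0) -ncR -ncM.
have -> : h%:C * (f (x +i* (y + h)) - f (x +i* y) - 'i * (f ((x + h) +i* y) - f (x +i* y)))
  = (f (x +i* (y + h)) - f (x +i* y)) * h%:C - (f ((x + h) +i* y) - f (x +i* y)) * ('i * h%:C) by ring.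
apply: le_trans hh _.
have -> : h * (2 * K * h ^+ 2) = K * (h * h * (h * 2)) by ring.
by rewrite ler_wpM2l // ler_wpM2l ?mulr_ge0 // ler_wpM2l.
Qed.

(** Cauchy's theorem for Riemann sums on the rectangle with base [-L, L] and
    height L: N steps lead from the base to the top, each leaving behind the
    values at the two sides and an error of second order. *)
Lemma gridsum_bound f (K B : R) : lip2 uhp_closed f K -> 0 <= B ->
  (forall y, 0 <= y -> y <= L -> nc (f ((- L) +i* y)) <= B) ->
  (forall y, 0 <= y -> y <= L -> nc (f (L +i* y)) <= B) ->
  (forall x, `|x| <= L -> nc (f (x +i* L)) <= B) ->
  nc (gridsum f 0) <= 4 * L * B + 4 * K * h * L ^+ 2.
Proof.
move=> fK B0 fl fr ft.
have L0 : 0 <= L by rewrite mulr_ge0.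
have hK : 0 <= K by case: fK.
have steps j : (j <= N)%N ->
    nc (gridsum f (j%:R * h) - gridsum f 0) <= j%:R * (h * (2 * B + 4 * K * h * L)).
  elim: j => [|j IH] jN; first by rewrite !mul0r subrr nc0.
  have jL : j%:R * h <= L by rewrite ler_wpM2r // ler_nat ltnW.
  have j0 : 0 <= j%:R * h by rewrite mulr_ge0.
  have := gridsum_step fK j0 (fl _ j0 jL) (fr _ j0 jL).
  have := IH (ltnW jN).
  rewrite -[j.+1%:R]natr1 ![(j%:R + 1) * _]mulrDl !mul1r.
  set a := gridsum f 0; set b := gridsum f (j%:R * h); set c := gridsum f _.
  have := ncD (c - b) (b - a).
  rewrite subrKA; lra.
have := steps N (leqnn N); rewrite -/L.
have top : nc (gridsum f L) <= 2 * L * B.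
  rewrite /gridsum ncM ncR (ger0_norm h0).
  apply: (@le_trans _ _ (h * \sum_(k < N.*2) B)).
    rewrite ler_wpM2l //; apply: le_trans (nc_sum _ _) _.
    apply: ler_sum => k _; apply: ft; apply: gridx_bound; exact: ltnW.
  by rewrite sumr_const card_ord -[_ *+ N.*2]mulr_natr -addnn natrD /L; lra.
have := ncB (gridsum f L) (gridsum f L - gridsum f 0).
rewrite opprB addrC subrK.
have -> : N%:R * (h * (2 * B + 4 * K * h * L)) = L * (2 * B + 4 * K * h * L).
  by rewrite /L; ring.
lra.
Qed.

End Contour.

(** * Representation of functions as Cauchy transforms *)

Section DiscreteMeasure.
Variable R : realType.

Lemma discrete_measure (x w : nat -> R) N : (forall k, 0 <= w k) ->
  exists2 nu : bmeasure R, nu setT = (\sum_(k < N) w k)%:E &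
    forall f : R -> R, lipfun f -> (exists B, forall t, `|f t| <= B) ->
      \int[nu]_t f t = \sum_(k < N) w k * f (x k).
Proof.
move=> w0.
pose m (k : nat) : bmeasure R :=
  mscale (NngNum (w0 k)) (@dirac _ (measurableTypeR R) (x k) R).
pose nu : bmeasure R := msum m N.
have nuT : nu setT = (\sum_(k < N) w k)%:E.
  rewrite /nu /= /msum -sumEFin; apply: eq_bigr => k _.
  by rewrite /m /= /mscale /= diracT mule1.
exists nu => // f fL [B fB].
have nufin : (nu setT < +oo)%E by rewrite nuT ltry.
have mf := lipfun_measurable fL.
have fi := bounded_integrable nufin mf fB.
(* Integration against a finite sum of measures is additive for nonnegative
   functions, hence the shift of f by its bound B. *)
have B0 : 0 <= B by apply: le_trans (fB 0).
have mfB : measurable_fun setT ((fun t => f t + B) : measurableTypeR R -> measurableTypeR R).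
  exact: measurable_funD.
have fB0 t : 0 <= f t + B.
  by have := fB t; rewrite ler_norml => /andP[h _]; rewrite -lerBlDr sub0r.
have h1 : \int[nu]_t (f t + B) = \sum_(k < N) w k * (f (x k) + B).
  rewrite /Rintegral /nu ge0_integral_measure_sum //; last 2 first.
  - by move=> t _; rewrite lee_fin.
  - exact/measurable_EFinP.
  rewrite (_ : (\sum_(n < N) _)%E = (\sum_(k < N) w k * (f (x k) + B))%:E) //.
  rewrite -sumEFin; apply: eq_bigr => k _.
  rewrite /m ge0_integral_mscale //=; last 2 first.
  - exact/measurable_EFinP.
  - by move=> t _; rewrite lee_fin.
  rewrite integral_dirac //; last exact/measurable_EFinP.
  by rewrite diracT mul1e.
have h2 : \int[nu]_t (f t + B) = \int[nu]_t f t + B * \sum_(k < N) w k.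
  rewrite RintegralD //; last exact: cst_integrable.
  by rewrite Rintegral_cst // nuT.
move: h2; rewrite h1 => /eqP; rewrite -subr_eq => /eqP <-.
rewrite mulr_sumr -sumrB; apply: eq_bigr => k _; ring.
Qed.

Lemma cauchy_discrete (x w : nat -> R) N (nu : bmeasure R) :
  (forall f : R -> R, lipfun f -> (exists B, forall t, `|f t| <= B) ->
      \int[nu]_t f t = \sum_(k < N) w k * f (x k)) ->
  forall z, 0 < Im z -> cauchy nu z = \sum_(k < N) (w k)%:C * res z (x k).
Proof.
move=> nuP z z0; have [B [rB rL]] := blip_res z0.
apply: ceq; rewrite ?Re_sum ?Im_sum /cauchy /cint /= nuP.
- by apply: eq_bigr => k _; rewrite ReM /= mul0r subr0.
- by exists B => s t; rewrite -ReB; apply: le_trans (Re_le_nc _) _.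
- by exists B => t; apply: le_trans (Re_le_nc _) _.
- by apply: eq_bigr => k _; rewrite ImM /= mul0r addr0.
- by exists B => s t; rewrite -ImB; apply: le_trans (Im_le_nc _) _.
- by exists B => t; apply: le_trans (Im_le_nc _) _.
Qed.

End DiscreteMeasure.

Section PoissonSum.
Variable R : realType.
Implicit Types (z : R[i]) (x h : R).

Definition poisson z x : R := - Im (res z x).

Lemma poissonE z x : poisson z x = Im z / nc (z - x%:C) ^+ 2.
Proof. by rewrite /poisson Im_res opprK. Qed.

Lemma poisson_conj z x :
  (2 * poisson z x)%:C * 'i = - res z x - (x%:C - cj z)^-1.
Proof.
have -> : (x%:C - cj z)^-1 = - cj (res z x).
  by rewrite /res cjV cjD cjN cjR -[cj z - _]opprB invrN opprK.
by rewrite /poisson; apply: ceq; rewrite ?ReB ?ImB ?ReN ?ImN ?ReM ?ImM; case: (res _ _) => u v /=; ring.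
Qed.

Lemma poisson_ge0 z x : 0 < Im z -> 0 <= poisson z x.
Proof. by move=> z0; rewrite oppr_ge0 Im_res_le0 // ltW. Qed.

(** A primitive of the Poisson kernel. *)
Definition patan z x : R := atan ((x - Re z) / Im z).

Lemma is_derive_patan z x : 0 < Im z ->
  is_derive x (1 : R) (patan z) (poisson z x).
Proof.
move=> z0; rewrite poissonE nc_sq ReB ImB /= subr0.
set a := Re z; set b := Im z in z0 *.
have d1 : is_derive x (1 : R) (fun t => (t - a) / b) (b^-1).
  have := is_deriveM (is_deriveB (is_derive_id x (1:R)) (is_derive_cst a x (1:R))) (is_derive_cst b^-1 x (1:R)).
  by rewrite scaler0 add0r subr0 /GRing.scale /= mulr1.
have d2 := is_derive1_atan ((x - a) / b).
have := is_derive1_comp (g := fun t => (t - a) / b) d2 d1.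
have b0 : b != 0 by rewrite gt_eqF.
have p0 : (a - x) ^+ 2 + b ^+ 2 != 0.
  by rewrite gt_eqF // ltr_wpDl ?sqr_ge0 // exprn_gt0.
have p1 : 1 + ((x - a) / b) ^+ 2 != 0.
  by rewrite gt_eqF // ltr_pwDl ?sqr_ge0.
suff -> : (1 + ((x - a) / b) ^+ 2)^-1 / b = b / ((a - x) ^+ 2 + b ^+ 2) by [].
have -> : 1 + ((x - a) / b) ^+ 2 = ((a - x) ^+ 2 + b ^+ 2) / b ^+ 2 by field.
by field; rewrite b0 p0.
Qed.

Lemma patan_cell z x h : 0 < Im z -> 0 < h ->
  `|h * poisson z x - (patan z (x + h) - patan z x)| <= Im z ^- 2 * h ^+ 2.
Proof.
move=> z0 h0.
have xh : x < x + h by rewrite ltrDl.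
have [||c] := @MVT _ (patan z) (poisson z) _ _ xh.
- by move=> t _; exact: is_derive_patan.
- apply: derivable_within_continuous => t _.
  by have [] := is_derive_patan t z0.
rewrite in_itv /= => /andP[xc ch] ->.
rewrite [x + h - x]addrAC subrr add0r [_ * h]mulrC -mulrBr normrM gtr0_norm //.
rewrite expr2 mulrCA ler_pM2l //.
have -> : poisson z x - poisson z c = - Im (res z x - res z c).
  by rewrite /poisson ImB; ring.
rewrite normrN; apply: le_trans (Im_le_nc _) _; apply: le_trans (res_lip x c z0 (lexx _)) _.
rewrite ler_wpM2l ?invr_ge0 ?sqr_ge0 // distrC ger0_norm ?subr_ge0; last exact: ltW.
by rewrite lerBlDl ltW.
Qed.

Lemma poisson_sum z (h : R) N : 0 < Im z -> 0 < h ->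
  `|h * \sum_(k < N.*2) poisson z (gridx h N k)
     - (patan z (N%:R * h) - patan z (- (N%:R * h)))|
  <= 2 * N%:R * (Im z ^- 2 * h ^+ 2).
Proof.
move=> z0 h0.
have gS k : gridx h N k.+1 = gridx h N k + h by rewrite /gridx -natr1; ring.
have -> : patan z (N%:R * h) - patan z (- (N%:R * h)) =
   \sum_(k < N.*2) (patan z (gridx h N k.+1) - patan z (gridx h N k)).
  rewrite -(big_mkord xpredT (fun k => patan z (gridx h N k.+1) - patan z (gridx h N k))).
  rewrite (telescope_sumr (fun k => patan z (gridx h N k)) (leq0n _)).
  by congr (patan z _ - patan z _); rewrite /gridx -?addnn ?natrD; ring.
rewrite mulr_sumr -sumrB.
apply: le_trans (ler_norm_sum _ _ _) _.
have -> : 2 * N%:R * (Im z ^- 2 * h ^+ 2) = \sum_(k < N.*2) (Im z ^- 2 * h ^+ 2).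
  by rewrite sumr_const card_ord -[_ *+ N.*2]mulr_natr -addnn natrD; ring.
by apply: ler_sum => k _; rewrite gS patan_cell.
Qed.

Lemma patan_cvg z : 0 < Im z ->
  patan z n%:R - patan z (- n%:R) @[n --> \oo] --> (pi : R).
Proof.
move=> z0.
have lin (a : R) : (n%:R - a) / Im z @[n --> \oo] --> +oo.
  apply/cvgryPge => A; near=> n.
  rewrite ler_pdivlMr // lerBrDr.
  by near: n; exact: nbhs_infty_ger.
have e n : patan z n%:R - patan z (- n%:R) =
    atan ((n%:R - Re z) / Im z) + atan ((n%:R - (- Re z)) / Im z).
  by rewrite /patan; congr (_ + _); rewrite -atanN -mulNr; congr (atan (_ / _)); ring.
under eq_fun do rewrite e.
rewrite [pi](splitr pi).
by apply: cvgD; apply: (cvg_comp _ _ (lin _)); exact: cvgy_atan.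
Unshelve. all: by end_near. Qed.

End PoissonSum.

Section Herglotz.
Variable R : realType.
Variables (G : R[i] -> R[i]) (C K : R).
Notation D := (@uhp_closed R).
Hypotheses (C0 : 0 <= C) (tG : tame D G K)
  (ImG : forall w, D w -> Im (G w) <= 0)
  (Gdecay : forall w, D w -> nc w * nc (G w) <= C)
  (Gdiv : forall z, 0 < Im z -> exists g Kg, tame D g Kg /\
     forall w, D w -> G w - G z = (w - z) * g w).

(* The rectangle has base [-n, n]; the mesh n^-3 makes the error 4 K h n^2 of
   the discrete Cauchy theorem vanish. *)
Let h n : R := (n%:R ^+ 3)^-1.
Let N n : nat := (n ^ 4)%N.
Let h0 n : 0 <= h n. Proof. by rewrite invr_ge0 exprn_ge0. Qed.
Let hp n : (0 < n)%N -> 0 < h n.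
Proof. by move=> n0; rewrite invr_gt0 exprn_gt0 // ltr0n. Qed.
Let LE n : (0 < n)%N -> (N n)%:R * h n = n%:R.
Proof.
move=> n0; rewrite /N /h natrX.
have : n%:R != 0 :> R by rewrite pnatr_eq0 -lt0n.
by move=> ?; field.
Qed.
Let gs n f := gridsum (h n) (N n) f 0.

(* The sides of the rectangle have length of order n, so decay like |w|^-2
   makes the sum over the base of order 1/n. *)
Let side (f : R[i] -> R[i]) (Kf B : R) n : (0 < n)%N -> lip2 D f Kf -> 0 <= B ->
  (forall w, D w -> n%:R <= nc w -> nc (f w) <= B / n%:R ^+ 2) ->
  nc (gs n f) <= (4 * B + 4 * Kf) / n%:R.
Proof.
move=> n0 fK B0 fB.
have nR : 0 < n%:R :> R by rewrite ltr0n.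
have Bn : 0 <= B / n%:R ^+ 2 by rewrite divr_ge0 // sqr_ge0.
have le w : D w -> n%:R <= `|Re w| \/ n%:R <= `|Im w| -> nc (f w) <= B / n%:R ^+ 2.
  move=> Dw [] /le_trans nw; apply: fB => //; apply: nw.
    exact: Re_le_nc.
  exact: Im_le_nc.
have nn : `|n%:R : R| = n%:R by rewrite ger0_norm.
have := @gridsum_bound _ (h n) (N n) (h0 n) f Kf (B / n%:R ^+ 2) fK Bn.
rewrite LE // => /(_ _ _ _)/le_trans; apply.
- by move=> y y0 _; apply: le => //; left => /=; rewrite normrN nn.
- by move=> y y0 _; apply: le => //; left => /=; rewrite nn.
- by move=> x _; apply: le; [exact: ltW|right => /=; rewrite nn].
rewrite le_eqVlt; apply/orP; left; apply/eqP.
by rewrite /h; have : n%:R != 0 :> R; [rewrite gt_eqF|move=> ?; field].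
Qed.

Let K0 : 0 <= K. Proof. by case: tG => -[]. Qed.

(* Decay like |w|^-1 still keeps the sum bounded; this will bound the mass of
   the approximating measures. *)
Let mass_le n : (0 < n)%N -> nc (gs n G) <= 4 * C + 4 * K.
Proof.
move=> n0; have nR : 1 <= n%:R :> R by rewrite ler1n.
have nR0 : 0 < n%:R :> R by rewrite ltr0n.
have Cn : 0 <= C / n%:R by rewrite divr_ge0.
have le w : D w -> n%:R <= `|Re w| \/ n%:R <= `|Im w| -> nc (G w) <= C / n%:R.
  move=> Dw h1; have nw : n%:R <= nc w.
    by case: h1 => /le_trans; apply; [exact: Re_le_nc|exact: Im_le_nc].
  rewrite ler_pdivlMr //; apply: le_trans (Gdecay Dw).
  by rewrite mulrC ler_wpM2r ?nc_ge0.
have nn : `|n%:R : R| = n%:R by rewrite ger0_norm.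
have := @gridsum_bound _ (h n) (N n) (h0 n) G K (C / n%:R) tG.1 Cn.
rewrite LE // => /(_ _ _ _)/le_trans; apply.
- by move=> y y0 _; apply: le => //; left => /=; rewrite normrN nn.
- by move=> y y0 _; apply: le => //; left => /=; rewrite nn.
- by move=> x _; apply: le; [exact: ltW|right => /=; rewrite nn].
have -> : 4 * n%:R * (C / n%:R) + 4 * K * h n * n%:R ^+ 2 = 4 * C + 4 * K * n%:R^-1.
  by rewrite /h; have : n%:R != 0 :> R; [rewrite gt_eqF|move=> ?; field].
rewrite lerD2l ler_piMr ?mulr_ge0 // invf_le1 //.
Qed.

(* Riemann sum of the density - Im G / pi on the real line. *)
Let wt n k : R := h n / pi * - Im (G ((gridx (h n) (N n) k) +i* 0)).
Let wt_ge0 n k : 0 <= wt n k.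
Proof.
rewrite /wt mulr_ge0 //; first by rewrite divr_ge0 // pi_ge0.
by rewrite oppr_ge0 ImG // /uhp_closed /=.
Qed.

(* The contour sums of G / (w - conj z) and of (G w - G z c w) / (w - z), with
   c w = (z - conj z) / (w - conj z), are small. The factor c takes the value
   1 at z and provides decay like |w|^-2. Subtracting the conjugate of the
   first from the second leaves the sum of Im G w / (w - z), which is therefore
   close to a Poisson sum times G z. *)
Let nu_cauchy z : 0 < Im z -> exists B : R, \forall n \near \oo,
  nc (\sum_(k < (N n).*2) (wt n k)%:C * res z (gridx (h n) (N n) k) - G z)
    <= B / n%:R + nc (G z) / pi *
       `|pi - (patan z n%:R - patan z (- n%:R))|.
Proof.
move=> z0; have [g [Kg [tg gP]]] := Gdiv z0.
set b := Im z in z0 *.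
have b0 : 0 <= b by exact: ltW.
pose rb w : R[i] := (w - cj z)^-1.
have zc : Im (cj z) = - b by rewrite /b; case: (z).
have Dzc w : D w -> b <= nc (w - cj z).
  move=> Dw; apply: le_trans (Im_le_nc _); rewrite ImB zc opprK.
  by rewrite (le_trans _ (ler_norm _)) // lerDr.
have trb := tame_inv (lip2_id D) z0 Dzc.
rewrite -/rb in trb; set Kr := (X in tame _ _ X) in trb.
have tf1 := tameM tG trb.
have tf2 := tameD tg (tameM (tame_cst D (G z)) trb).
set K1 := (X in tame _ _ X) in tf1; set K2 := (X in tame _ _ X) in tf2.
pose f1 w := G w * rb w; pose f2 w := g w + G z * rb w.
pose B1 := 2 * C; pose B2 := 2 * (C + 4 * b * nc (G z)).
have B10 : 0 <= B1 by rewrite mulr_ge0.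
have B20 : 0 <= B2 by rewrite mulr_ge0 // addr_ge0 // !mulr_ge0 ?nc_ge0.
pose A1 := 4 * B1 + 4 * K1; pose A2 := 4 * B2 + 4 * K2.
exists ((A1 + A2 + nc (G z) * 4 * (b ^- 2)) / pi).
near=> n.
have n0 : (0 < n)%N by near: n; exact: nbhs_infty_gt.
have nR : 0 < n%:R :> R by rewrite ltr0n.
have n1 : 1 <= n%:R :> R by rewrite ler1n.
have nz : 2 * nc z <= n%:R by near: n; exact: nbhs_infty_ger.
have far w : n%:R <= nc w -> n%:R / 2 <= nc (w - cj z) /\ n%:R / 2 <= nc (w - z).
  move=> nw; split.
    have : nc w <= nc (w - cj z) + nc (cj z) by rewrite -{1}(subrK (cj z) w) ncD.
    rewrite nc_conj; lra.
  have : nc w <= nc (w - z) + nc z by rewrite -{1}(subrK z w) ncD.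
  lra.
have n2 : 0 < n%:R / 2 :> R by rewrite divr_gt0.
have rbn w : n%:R <= nc w -> nc (rb w) <= 2 / n%:R.
  by move=> /far[h1 _]; rewrite -invf_div; exact: nc_inv_le.
have Gn w : D w -> n%:R <= nc w -> nc (G w) <= C / n%:R.
  move=> Dw nw; rewrite ler_pdivlMr //; apply: le_trans (Gdecay Dw).
  by rewrite mulrC ler_wpM2r ?nc_ge0.
have nn0 : n%:R != 0 :> R by rewrite gt_eqF.
have S1 : nc (gs n f1) <= A1 / n%:R.
  apply: side => //; first exact: tf1.1.
  move=> w Dw nw; rewrite ncM.
  have -> : B1 / n%:R ^+ 2 = (C / n%:R) * (2 / n%:R) by rewrite /B1; field.
  by apply: ler_pM; rewrite ?nc_ge0 ?Gn ?rbn.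
have S2 : nc (gs n f2) <= A2 / n%:R.
  apply: side => //; first exact: tf2.1.
  move=> w Dw nw; have [_ nwz] := far w nw.
  have wz : 0 < nc (w - z) by exact: lt_le_trans nwz.
  have wc0 : w - cj z != 0 by rewrite -nc_gt0 (lt_le_trans z0) // Dzc.
  have e : (w - z) * f2 w = G w - G z * ((z - cj z) * rb w).
    have e1 := gP w Dw; rewrite /f2 mulrDr -e1 /rb.
    by field.
  have zz : nc (z - cj z) <= 2 * b.
    have -> : z - cj z = (2 * b)%:C * 'i.
      by apply: ceq; rewrite ?ReB ?ImB ?ReM ?ImM /b; case: (z) => p q /=; ring.
    by rewrite ncM nci mulr1 ncR ger0_norm // mulr_ge0.
  have h1 : nc (w - z) * nc (f2 w) <= (C + 4 * b * nc (G z)) / n%:R.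
    rewrite -ncM e; apply: le_trans (ncB _ _) _; rewrite [leRHS]mulrDl lerD ?Gn //.
    rewrite !ncM; have -> : 4 * b * nc (G z) / n%:R = nc (G z) * ((2 * b) * (2 / n%:R)) by field.
    by apply: ler_wpM2l; rewrite ?nc_ge0 //; apply: ler_pM; rewrite ?nc_ge0 ?rbn.
  have h2 : n%:R / 2 * nc (f2 w) <= (C + 4 * b * nc (G z)) / n%:R.
    by apply: le_trans h1; rewrite ler_wpM2r ?nc_ge0.
  have -> : B2 / n%:R ^+ 2 = ((C + 4 * b * nc (G z)) / n%:R) / (n%:R / 2) by rewrite /B2; field.
  by rewrite ler_pdivlMr // mulrC.
set x := gridx (h n) (N n).
pose P := h n * \sum_(k < (N n).*2) poisson z (x k).
have key : gs n f2 - cj (gs n f1) =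
    (2 * pi)%:C * 'i * (\sum_(k < (N n).*2) (wt n k)%:C * res z (x k))
    - (2 * P)%:C * 'i * G z.
  rewrite /gs /gridsum cjM cjR cj_sum -/x.
  rewrite -mulrBr -sumrB !mulr_sumr.
  have -> : (2 * P)%:C * 'i * G z = \sum_(k < (N n).*2) (2 * (h n * poisson z (x k)))%:C * 'i * G z.
    by rewrite -!mulr_suml -rmorph_sum /P /= -!mulr_sumr.
  rewrite -sumrB; apply: eq_bigr => k _; rewrite -/(x k) complexr0.
  have xz : (x k)%:C - z != 0 by rewrite -oppr_eq0 opprB; exact: resolvent_neq0.
  have DX : D (x k)%:C by rewrite /uhp_closed /=.
  have ge : g (x k)%:C = - res z (x k) * (G (x k)%:C - G z).
    rewrite (gP _ DX) /res -[z - _]opprB invrN opprK.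
    by field.
  have p1 := poisson_conj z (x k).
  have rc : cj (rb (x k)%:C) = - res z (x k).
    by rewrite /rb /res cjV cjD cjN cjR cjK -[z - _]opprB invrN opprK.
  rewrite /f2 /f1 cjM rc ge /wt -/(x k) complexr0.
  have Gc : cj (G (x k)%:C) = G (x k)%:C - (2 * Im (G (x k)%:C))%:C * 'i.
    by apply: ceq; rewrite ?ReB ?ImB ?ReM ?ImM; case: (G _) => u v /=; ring.
  rewrite Gc.
  have p2 : rb (x k)%:C = - res z (x k) - (2 * poisson z (x k))%:C * 'i.
    by rewrite p1 /rb; ring.
  move: (Im (G _)) (res _ _) p2 => t r p2.
  have q1 : (2 * pi)%:C * (h n / pi * - t)%:C = - ((h n)%:C * (2 * t)%:C) :> R[i].
    rewrite -!rmorphM -rmorphN /=; congr (_%:C).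
    have pi0 : pi != 0 :> R by rewrite gt_eqF // pi_gt0.
    have -> : 2 * pi * (h n / pi * - t) = - (h n * (2 * t)) * (pi / pi) by ring.
    by rewrite divff // mulr1.
  have q2 : (2 * (h n * poisson z (x k)))%:C = (h n)%:C * (2 * poisson z (x k))%:C :> R[i].
    by rewrite -rmorphM /=; congr (_%:C); ring.
  rewrite p2 q2.
  have -> : (2 * pi)%:C * 'i * ((h n / pi * - t)%:C * r) =
    ((2 * pi)%:C * (h n / pi * - t)%:C) * ('i * r) by rewrite mulrACA.
  by rewrite q1; ring.
have Pn := @poisson_sum _ z (h n) (N n) z0 (hp n0).
rewrite LE // -/b in Pn.
have pi0 : 0 < pi :> R by exact: pi_gt0.
set S := \sum_(k < _) _ in key *.
have e2 : (2 * pi)%:C * 'i * (S - G z) = (gs n f2 - cj (gs n f1)) + (2 * (P - pi))%:C * 'i * G z.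
  have -> : (2 * (P - pi))%:C = (2 * P)%:C - (2 * pi)%:C :> R[i].
    by rewrite -rmorphB /= mulrBr.
  by rewrite key; ring.
have h3 : 2 * pi * nc (S - G z) <= A2 / n%:R + A1 / n%:R + 2 * `|P - pi| * nc (G z).
  have : nc ((2 * pi)%:C * 'i * (S - G z)) = 2 * pi * nc (S - G z).
    by rewrite !ncM nci mulr1 ncR ger0_norm // mulr_ge0 // ltW.
  move=> <-; rewrite e2; apply: le_trans (ncD _ _) _; apply: lerD.
    by apply: le_trans (ncB _ _) _; rewrite nc_conj lerD.
  by rewrite !ncM nci mulr1 ncR normrM (ger0_norm (ler0n _ 2)).
have h4 : `|P - pi| <= 2 * b ^- 2 / n%:R + `|pi - (patan z n%:R - patan z (- n%:R))|.
  set q := patan _ _ - _ in Pn *.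
  have -> : P - pi = (P - q) - (pi - q) by ring.
  apply: le_trans (ler_normB _ _) _; rewrite lerD2r; apply: le_trans Pn _.
  have -> : 2 * (N n)%:R * (b ^- 2 * h n ^+ 2) = 2 * b ^- 2 * (((N n)%:R * h n) * h n) by ring.
  rewrite LE // ler_wpM2l ?mulr_ge0 ?invr_ge0 ?sqr_ge0 //.
  rewrite /h exprS invfM mulrA mulfV // mul1r lef_pV2 ?posrE ?exprn_gt0 //.
  by rewrite expr2 ler_peMr // ltW.
have Gz0 := nc_ge0 (G z).
set X := nc (S - G z) in h3 *; set q := `|pi - _| in h4 *.
have A1n := le_trans (nc_ge0 _) S1; have A2n := le_trans (nc_ge0 _) S2.
have b2 : 0 <= b ^- 2 / n%:R by rewrite divr_ge0 ?invr_ge0 ?sqr_ge0.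
have b3 : 0 <= nc (G z) * (b ^- 2 / n%:R) by rewrite mulr_ge0.
have h5 : `|P - pi| * nc (G z) <= (2 * b ^- 2 / n%:R + q) * nc (G z) by rewrite ler_wpM2r.
suff : pi * X <= pi * ((A1 + A2 + nc (G z) * 4 * b ^- 2) / pi / n%:R + nc (G z) / pi * q).
  by rewrite ler_pM2l.
have -> : pi * ((A1 + A2 + nc (G z) * 4 * b ^- 2) / pi / n%:R + nc (G z) / pi * q)
  = A1 / n%:R + A2 / n%:R + 4 * (nc (G z) * (b ^- 2 / n%:R)) + nc (G z) * q.
  transitivity (pi / pi * ((A1 + A2 + nc (G z) * 4 * b ^- 2) / n%:R + nc (G z) * q)).
    by ring.
  by rewrite divff ?gt_eqF // mul1r; ring.
move: h3 h5 b3 A1n A2n; set t1 := A1 / n%:R; set t2 := A2 / n%:R.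
have -> : (2 * b ^- 2 / n%:R + q) * nc (G z) = 2 * (nc (G z) * (b ^- 2 / n%:R)) + nc (G z) * q by ring.
set t3 := nc (G z) * (b ^- 2 / n%:R); set t4 := `|P - pi|.
move: (nc (G z) * q) => t5; lra.
Unshelve. all: by end_near. Qed.

(** A Herglotz representation. The boundary density - Im G / pi is discretised;
    the discrete measures have bounded masses and their Cauchy transforms
    converge to G by the contour estimate above, so a Helly limit represents
    G. *)
Theorem herglotz : exists2 nu : bmeasure R, (nu setT < +oo)%E &
  forall z, 0 < Im z -> cauchy nu z = G z.
Proof.
have /choice[nu nuP] n : exists nu : bmeasure R,
    nu setT = (\sum_(k < (N n.+1).*2) wt n.+1 k)%:E /\
    forall z, 0 < Im z -> cauchy nu z =
      \sum_(k < (N n.+1).*2) (wt n.+1 k)%:C * res z (gridx (h n.+1) (N n.+1) k).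
  have [nu nu1 nu2] := @discrete_measure _ (gridx (h n.+1) (N n.+1)) _ (N n.+1).*2 (wt_ge0 n.+1).
  exists nu; split => // z z0; exact: cauchy_discrete.
have pi0 : 0 < pi :> R by exact: pi_gt0.
have [||nu0 nu0C nu0P] := @cauchy_closed _ nu ((4 * C + 4 * K) / pi) G.
- move=> n; rewrite (nuP n).1 lee_fin.
  rewrite ler_pdivlMr //; apply: le_trans (mass_le (ltn0Sn n)).
  apply: le_trans (Im_le_nc _); rewrite -normrN; apply: le_trans (ler_norm _).
  rewrite /gs /gridsum ImM Im_sum /= mul0r addr0 -mulrN -sumrN mulr_sumr mulr_suml.
  apply: ler_sum => k _; rewrite le_eqVlt; apply/orP; left; apply/eqP.
  by rewrite /wt mulrAC divfK // gt_eqF.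
- move=> z z0; have [B BP] := nu_cauchy z0.
  apply: (@ccvg_le _ _ _ (fun n => B / n.+1%:R + nc (G z) / pi *
       `|pi - (patan z n.+1%:R - patan z (- n.+1%:R))|)).
    have [M _ MP] := BP; near=> n; rewrite (nuP n).2 //; apply: MP => /=.
    by near: n; exists M => // k /= Mk; exact: leqW.
  pose u n : R := B / n%:R + nc (G z) / pi * `|pi - (patan z n%:R - patan z (- n%:R))|.
  suff : u n @[n --> \oo] --> (0 : R) by rewrite -(cvg_shiftS u).
  rewrite -[0](addr0 0); apply: cvgD.
    rewrite -(mulr0 B); apply: cvgM; first exact: cvg_cst.
    by rewrite gtr0_cvgV0; [exact: cvgr_idn|near=> n; rewrite ltr0n; near: n; exact: nbhs_infty_gt].
  rewrite -(mulr0 (nc (G z) / pi)); apply: cvgM; first exact: cvg_cst.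
  rewrite -(normr0 R) -(subrr pi); apply: cvg_norm; apply: cvgB; first exact: cvg_cst.
  exact: patan_cvg.
exists nu0 => //; by rewrite (le_lt_trans nu0C) ?ltry.
Unshelve. all: by end_near. Qed.

End Herglotz.

(** * Mass and moments along the imaginary axis *)

Section Moments.
Variable R : realType.
Implicit Types (mu : bmeasure R) (x : R).

(** The weight y^2 / (x^2 + y^2) at y = n: up to normalisation it is the Poisson
    kernel at the point i n, and it increases to 1. *)
Definition tau (n : nat) x : R := n%:R ^+ 2 * (x ^+ 2 + n%:R ^+ 2)^-1.

Lemma tau_ge0 n x : 0 <= tau n x.
Proof. by rewrite /tau mulr_ge0 ?sqr_ge0 // invr_ge0 addr_ge0 ?sqr_ge0. Qed.

Lemma tau0 x : tau 0 x = 0.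
Proof. by rewrite /tau expr0n /= mul0r. Qed.

Lemma tau_den_gt0 n x : 0 < x ^+ 2 + n.+1%:R ^+ 2.
Proof. by rewrite ltr_wpDl ?sqr_ge0 // exprn_gt0 // ltr0n. Qed.

Lemma oneB_tau n x : 1 - tau n.+1 x = x ^+ 2 / (x ^+ 2 + n.+1%:R ^+ 2).
Proof.
rewrite /tau; have := tau_den_gt0 n x; move: n.+1%:R => y yp.
by field; rewrite gt_eqF.
Qed.

Lemma tau_le1 n x : tau n x <= 1.
Proof.
case: n => [|n]; first by rewrite tau0.
by rewrite -subr_ge0 oneB_tau divr_ge0 ?sqr_ge0 // ltW // tau_den_gt0.
Qed.

Lemma tau_mono x : {homo (tau ^~ x) : n m / (n <= m)%N >-> n <= m}.
Proof.
move=> [|n] m nm; first by rewrite tau0 tau_ge0.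
case: m nm => // m; rewrite ltnS => nm.
rewrite -lerN2 -(lerD2l 1) !oneB_tau ler_wpM2l ?sqr_ge0 //.
rewrite lef_pV2 ?posrE ?tau_den_gt0 // lerD2l.
by rewrite lerXn2r ?nnegrE ?ler0n // ler_nat.
Qed.

Lemma tau_cvg x : tau n x @[n --> \oo] --> (1 : R).
Proof.
suff : (fun n => tau n.+1 x) @ \oo --> (1 : R) by rewrite (cvg_shiftS (tau ^~ x)).
apply/cvgrPdist_le => e e0; near=> n.
rewrite oneB_tau ger0_norm; last by rewrite divr_ge0 ?sqr_ge0 // ltW // tau_den_gt0.
rewrite ler_pdivrMr ?tau_den_gt0 //.
have h : x ^+ 2 / e <= n.+1%:R.
  have : x ^+ 2 / e <= n%:R by near: n; exact: nbhs_infty_ger.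
  by move/le_trans; apply; rewrite ler_nat.
rewrite ler_pdivrMr // in h; apply: le_trans h _.
rewrite mulrC ler_wpM2l ?(ltW e0) //.
apply: (@le_trans _ _ (n.+1%:R ^+ 2)); last by rewrite lerDr sqr_ge0.
by rewrite expr2 ler_peMl // ler1n.
Unshelve. all: by end_near. Qed.

Lemma measurable_tau n : measurable_fun setT (tau n : measurableTypeR R -> measurableTypeR R).
Proof.
case: n => [|n].
  have -> : tau 0 = fun _ => 0 by apply/funext => x; exact: tau0.
  exact: measurable_cst.
apply: continuous_measurable_fun => x.
apply: cvgM; first exact: cvg_cst.
apply: cvgV; first by rewrite gt_eqF // tau_den_gt0.
apply: cvgD; last exact: cvg_cst.
exact: exprn_continuous.
Qed.

Definition iy (n : nat) : R[i] := 0 +i* n%:R.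

Lemma res_iy n x : n%:R ^+ 2 * Re (res (iy n) x) = - (x * tau n x) /\
  n%:R * - Im (res (iy n) x) = tau n x.
Proof.
have e : nc (iy n - x%:C) ^+ 2 = x ^+ 2 + n%:R ^+ 2.
  by rewrite nc_sq ReB ImB /=; ring.
rewrite /res ReV ImV e ReB ImB /= /tau; split; ring.
Qed.

Lemma cvg_integral_tau mu (f : R -> R) : (forall x, 0 <= f x) ->
  measurable_fun setT (f : measurableTypeR R -> measurableTypeR R) ->
  (\int[mu]_x (f x * tau n x)%:E)%E @[n --> \oo] --> (\int[mu]_x (f x)%:E)%E.
Proof.
move=> f0 mf.
have := @cvg_monotone_convergence _ _ R mu setT measurableT
   (fun n x => (f x * tau n x)%:E).
have -> : (\int[mu]_x (f x)%:E)%E = (\int[mu]_x limn (fun n => (f x * tau n x)%:E))%E.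
  apply: eq_integral => x _; apply/esym/cvg_lim => //.
  apply: cvg_EFin; first exact: nearW.
  rewrite -[f x in X in _ --> X]mulr1; apply: cvgM; first exact: cvg_cst.
  exact: tau_cvg.
apply.
- move=> n; apply/measurable_EFinP; apply: measurable_funM => //; exact: measurable_tau.
- by move=> n x _; rewrite lee_fin mulr_ge0 // tau_ge0.
- by move=> x _ n m nm; rewrite lee_fin ler_wpM2l // tau_mono.
Qed.

Lemma Im_iy_gt0 n : 0 < Im (iy n.+1).
Proof. by rewrite /= ltr0n. Qed.

(** The total mass of a measure is read off the decay of its Cauchy transform
    along the imaginary axis. *)
Lemma mass_cvg mu : (mu setT < +oo)%E ->
  (n.+1%:R * - Im (cauchy mu (iy n.+1)))%:E @[n --> \oo] --> mu setT.
Proof.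
move=> mufin; have := @cvg_integral_tau mu (fun _ => 1) (fun=> ler01) (measurable_cst _).
rewrite integral_cst // mul1e => h.
have -> : (fun n => (n.+1%:R * - Im (cauchy mu (iy n.+1)))%:E) =
  (fun n => \int[mu]_x (1 * tau n.+1 x)%:E)%E.
  apply/funext => n; have [_ Ii] := res_cintegrable mufin (Im_iy_gt0 n).
  rewrite mulrN -mulNr -[Im _]/(\int[mu]_x Im (res (iy n.+1) x)) -RintegralZl //.
  rewrite /Rintegral fineK.
    by apply: eq_integral => x _; rewrite mul1r mulNr -mulrN (res_iy n.+1 x).2.
  apply: integrable_fin_num => //.
  by have := @integrableZl _ _ _ mu setT measurableT (- n.+1%:R) _ Ii.
by rewrite (cvg_shiftS (fun n => \int[mu]_x (1 * tau n x)%:E)%E).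
Qed.

(** As 1 - tau y x = x^2 / (x^2 + y^2), the second moment is a limit of
    integrals of x^2 tau, finite or not. *)
Lemma second_moment_cvg (mu : prob R) :
  (n.+1%:R ^+ 2 * (1 + n.+1%:R * Im (cauchy mu (iy n.+1))))%:E @[n --> \oo]
    --> (\int[mu]_x (x ^+ 2)%:E)%E.
Proof.
have mufin : (mu setT < +oo)%E by rewrite probability_setT ltry.
have msq : measurable_fun setT ((fun x : R => x ^+ 2) : measurableTypeR R -> measurableTypeR R).
  by apply: continuous_measurable_fun => x; exact: exprn_continuous.
have h := @cvg_integral_tau mu (fun x => x ^+ 2) (fun x => sqr_ge0 x) msq.
have -> : (fun n => (n.+1%:R ^+ 2 * (1 + n.+1%:R * Im (cauchy mu (iy n.+1))))%:E) =
  (fun n => \int[mu]_x (x ^+ 2 * tau n.+1 x)%:E)%E.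
  apply/funext => n; have [_ Ii] := res_cintegrable mufin (Im_iy_gt0 n).
  have I1 : mu.-integrable setT (EFin \o (fun=> 1 : R)) by exact: cst_integrable.
  have I2 : mu.-integrable setT (EFin \o (fun x => n.+1%:R * Im (res (iy n.+1) x))).
    by have := @integrableZl _ _ _ mu setT measurableT (n.+1%:R) _ Ii.
  have I3 : mu.-integrable setT (EFin \o (fun x => 1 + n.+1%:R * Im (res (iy n.+1) x))).
    by have := integrableD measurableT I1 I2.
  have -> : 1 + n.+1%:R * Im (cauchy mu (iy n.+1)) =
      \int[mu]_x (1 + n.+1%:R * Im (res (iy n.+1) x)).
    rewrite RintegralD // RintegralZl // Rintegral_cst // mul1r.
    by congr (_ + _); rewrite [X in fine X](@probability_setT _ _ _ mu).
  rewrite -RintegralZl // /Rintegral fineK.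
    apply: eq_integral => x _; congr (_%:E).
    have -> : 1 + n.+1%:R * Im (res (iy n.+1) x) = 1 - tau n.+1 x.
      by rewrite -(res_iy n.+1 x).2 mulrN opprK.
    rewrite oneB_tau /tau; ring.
  apply: integrable_fin_num => //.
  by have := @integrableZl _ _ _ mu setT measurableT (n.+1%:R ^+ 2) _ I3.
by rewrite (cvg_shiftS (fun n => \int[mu]_x (x ^+ 2 * tau n x)%:E)%E).
Qed.

Lemma mean_cvg (mu : prob R) : mu.-integrable setT (EFin \o (fun x : R => x)) ->
  n.+1%:R ^+ 2 * Re (cauchy mu (iy n.+1)) @[n --> \oo] --> - \int[mu]_x x.
Proof.
move=> xi.
have mufin : (mu setT < +oo)%E by rewrite probability_setT ltry.
have mx : measurable_fun setT (id : measurableTypeR R -> measurableTypeR R) by [].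
have [|||||_ _] := @dominated_convergence _ _ R mu setT measurableT
   (fun n x => (- (x * tau n x))%:E) (fun x => (- x)%:E) (fun x => (`|x|)%:E).
- move=> n; apply/measurable_EFinP; apply: measurableT_comp => //.
  by apply: measurable_funM => //; exact: measurable_tau.
- by apply/measurable_EFinP; exact: measurable_funN.
- apply: aeW => x _; apply: cvg_EFin; first exact: nearW.
  apply: cvgN; rewrite -[X in _ --> X]mulr1; apply: cvgM; first exact: cvg_cst.
  exact: tau_cvg.
- by have := integrable_norm xi.
- apply: aeW => x n _; rewrite lee_fin normrN normrM (ger0_norm (tau_ge0 _ _)).
  by rewrite ler_piMr // tau_le1.
have -> : (\int[mu]_x (- x)%:E)%E = (- \int[mu]_x x)%:E.
  rewrite EFinN /Rintegral fineK; last exact: integrable_fin_num.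
  by rewrite -integralN; [apply: eq_integral|exact: integrable_add_def].
move/fine_cvgP => [_]; rewrite /comp /= => h.
have -> : (fun n => n.+1%:R ^+ 2 * Re (cauchy mu (iy n.+1))) =
  (fun n => fine (\int[mu]_x (- (x * tau n.+1 x))%:E)%E).
  apply/funext => n; have [Ri _] := res_cintegrable mufin (Im_iy_gt0 n).
  rewrite /cauchy /cint /= -RintegralZl //.
  by congr fine; apply: eq_integral => x _; rewrite (res_iy n.+1 x).1.
by rewrite (cvg_shiftS (fun n => fine (\int[mu]_x (- (x * tau n x))%:E)%E)).
Qed.

End Moments.

(** * The Loewner flow *)

Section PathCalculus.
Variable R : realType.
Implicit Types (d e : R -> R[i]) (a b t : R) (c : R[i]).

Lemma cacE a b d : absolutely_continuous_on a b d <->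
  forall e : R, 0 < e -> exists2 r : R, 0 < r &
    forall (n : nat) (u v : 'I_n -> R),
      (forall i, a <= u i /\ u i <= v i /\ v i <= b) ->
      trivIset setT (fun i => `]u i, v i[%classic) ->
      \sum_(i < n) (v i - u i) < r ->
      \sum_(i < n) nc (d (v i) - d (u i)) < e.
Proof.
have E n (u v : 'I_n -> R) :
  \sum_(i < n) `|d (v i) - d (u i)| = (\sum_(i < n) nc (d (v i) - d (u i)))%:C.
  rewrite rmorph_sum; apply: eq_bigr => i _; exact: nc_norm.
by split=> h e e0; have [r r0 rP] := h e e0; exists r => // n u v uv tuv luv;
  have := rP n u v uv tuv luv; rewrite E ltcR.
Qed.

Lemma cac_lip a b d (K : R) :
  (forall u v, a <= u -> u <= v -> v <= b -> nc (d v - d u) <= K * (v - u)) ->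
  absolutely_continuous_on a b d.
Proof.
move=> dK; apply/cacE => e e0.
have K1 : 0 < `|K| + 1 by rewrite ltr_wpDl.
exists (e / (`|K| + 1)); first exact: divr_gt0.
move=> n u v uv _; rewrite ltr_pdivlMr // mulrC; apply: le_lt_trans.
rewrite mulr_sumr; apply: ler_sum => i _; have [h1 [h2 h3]] := uv i.
apply: le_trans (dK _ _ h1 h2 h3) _; rewrite ler_wpM2r ?subr_ge0 //.
by rewrite (le_trans (ler_norm _)) // lerDl.
Qed.

Lemma cacD a b d e : absolutely_continuous_on a b d ->
  absolutely_continuous_on a b e ->
  absolutely_continuous_on a b (fun t => d t + e t).
Proof.
move=> /cacE dA /cacE eA; apply/cacE => x x0.
have x2 : 0 < x / 2 by rewrite divr_gt0.
have [r r0 rP] := dA _ x2; have [q q0 qP] := eA _ x2.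
exists (Num.min r q); first by rewrite lt_min r0.
move=> n u v uv tuv; rewrite lt_min => /andP[lr lq].
have h1 := rP n u v uv tuv lr; have h2 := qP n u v uv tuv lq.
rewrite [x]splitr; apply: le_lt_trans (ltrD h1 h2).
rewrite -big_split /=; apply: ler_sum => i _.
by rewrite opprD addrACA ncD.
Qed.

Lemma cacZ a b d c : absolutely_continuous_on a b d ->
  absolutely_continuous_on a b (fun t => c * d t).
Proof.
move=> /cacE dA; apply/cacE => x x0.
have c1 : 0 < nc c + 1 by rewrite ltr_wpDl ?nc_ge0.
have [r r0 rP] := dA _ (divr_gt0 x0 c1); exists r => // n u v uv tuv lr.
have := rP n u v uv tuv lr; rewrite ltr_pdivlMr // mulrC; apply: le_lt_trans.
rewrite mulr_sumr; apply: ler_sum => i _.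
by rewrite -mulrBr ncM ler_wpM2r ?nc_ge0 // lerDl.
Qed.

Lemma is_CderiveD d e t (l m : R[i]) : is_Cderive d t l -> is_Cderive e t m ->
  is_Cderive (fun t => d t + e t) t (l + m).
Proof.
move=> [d1 d2] [e1 e2]; split.
  rewrite ReD (_ : (fun u => Re (d u + e u)) = (fun u => Re (d u)) + (fun u => Re (e u))).
    exact: is_deriveD.
  by apply/funext => u; rewrite ReD.
rewrite ImD (_ : (fun u => Im (d u + e u)) = (fun u => Im (d u)) + (fun u => Im (e u))).
  exact: is_deriveD.
by apply/funext => u; rewrite ImD.
Qed.

Lemma is_CderiveZ d t (l c : R[i]) : is_Cderive d t l ->
  is_Cderive (fun t => c * d t) t (c * l).
Proof.
move=> dl; split; first exact: is_Cderive_Re.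
have e (z : R[i]) : Im z = Re (- ('i : R[i]) * z) by rewrite ReM /=; ring.
rewrite e (_ : (fun u => Im (c * d u)) = (fun u => Re (- ('i : R[i]) * c * d u))).
  by rewrite mulrA; exact: is_Cderive_Re.
by apply/funext => u; rewrite e mulrA.
Qed.

Lemma is_CderiveB d e t (l m : R[i]) : is_Cderive d t l -> is_Cderive e t m ->
  is_Cderive (fun t => d t - e t) t (l - m).
Proof.
move=> dl em; rewrite -(mulN1r m).
rewrite (_ : (fun t => d t - e t) = (fun t => d t + -1 * e t)).
  by apply: is_CderiveD => //; exact: is_CderiveZ.
by apply/funext => u; rewrite mulN1r.
Qed.

Lemma cacB a b d e : absolutely_continuous_on a b d ->
  absolutely_continuous_on a b e ->
  absolutely_continuous_on a b (fun t => d t - e t).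
Proof.
move=> dA eA; rewrite (_ : (fun t => d t - e t) = (fun t => d t + -1 * e t)).
  by apply: cacD => //; exact: cacZ.
by apply/funext => u; rewrite mulN1r.
Qed.

End PathCalculus.

Section Flow.
Variable R : realType.
Variables (nu : R -> prob R) (phi : R -> R -> R[i] -> R[i]).
Hypothesis phiP : loewner_solution nu phi.
Notation leb := (@lebesgue_measure R).

Definition flow_bad s z : set R := ~` [set t | s <= t ->
  is_Cderive (fun u => phi s u z) t (- cauchy_transform (nu t) (phi s t z))].

Lemma flow_bad_null s z : 0 <= s -> 0 < Im z -> leb.-negligible (flow_bad s z).
Proof. by move=> s0 z0; exact: (loewner_ode phiP s0 z0). Qed.

Lemma flow_derive s z t : s <= t -> ~ flow_bad s z t ->
  is_Cderive (fun u => phi s u z) t (- cauchy (nu t) (phi s t z)).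
Proof.
by move=> st /contrapT /(_ st); rewrite cauchy_transformE.
Qed.

Lemma flow_Im_gt0 s t z : 0 <= s -> s <= t -> 0 < Im z -> 0 < Im (phi s t z).
Proof. by move=> s0 st z0; exact: (loewner_upper phiP s0 st z0). Qed.

Lemma flow_init s z : 0 <= s -> 0 < Im z -> phi s s z = z.
Proof. by move=> s0 z0; exact: (loewner_init phiP s0 z0). Qed.

Lemma flow_ac s a b z : 0 <= s -> s <= a -> a <= b -> 0 < Im z ->
  absolutely_continuous_on a b (fun t => phi s t z).
Proof.
move=> s0 sa ab z0.
exact: cac_sub sa (lexx b) (loewner_ac phiP s0 (le_trans sa ab) z0).
Qed.

Lemma nu_mass t : (nu t setT <= 1%:E)%E.
Proof. by rewrite probability_setT. Qed.

Lemma nu_fin t : (nu t setT < +oo)%E.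
Proof. by rewrite probability_setT ltry. Qed.

(** The vector field - M_t points upwards. *)
Lemma flow_Im_mono s a b z : 0 <= s -> s <= a -> a <= b -> 0 < Im z ->
  Im (phi s a z) <= Im (phi s b z).
Proof.
move=> s0 sa ab z0.
have e (w : R[i]) : Re (('i : R[i]) * w) = - Im w by rewrite ReM /=; ring.
have := @rac_le _ a b 0 (fun t => Re (('i : R[i]) * phi s t z)) (flow_bad s z) ab (lexx 0).
rewrite mul0r !e opprK addrC subr_le0; apply.
- exact/cac_rac/flow_ac.
- exact: flow_bad_null.
- move=> t ta tb Nt; have st := le_trans sa ta.
  exists (Re (('i : R[i]) * - cauchy (nu t) (phi s t z))).
    by rewrite mulrN ReN e opprK Im_cauchy_le0 ?nu_fin // flow_Im_gt0.
  by apply: is_Cderive_Re; exact: flow_derive.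
Qed.

Lemma flow_Im_ge s t z : 0 <= s -> s <= t -> 0 < Im z -> Im z <= Im (phi s t z).
Proof.
by move=> s0 st z0; rewrite -{1}(flow_init s0 z0) flow_Im_mono.
Qed.

Lemma flow_lip s a b z : 0 <= s -> s <= a -> a <= b -> 0 < Im z ->
  nc (phi s b z - phi s a z) <= (Im z)^-1 * (b - a).
Proof.
move=> s0 sa ab z0.
apply: (@cac_le _ a b _ (fun t => phi s t z) (flow_bad s z)) => //.
- by rewrite invr_ge0 ltW.
- exact: flow_ac.
- exact: flow_bad_null.
- move=> t ta tb Nt; have st := le_trans sa ta.
  exists (- cauchy (nu t) (phi s t z)); last exact: flow_derive.
  rewrite ncN; have := nc_cauchy (nu_mass t) z0 (flow_Im_ge s0 st z0).
  by rewrite mulr1.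
Qed.

Lemma flow_bound s t b z : 0 <= s -> s <= t -> t <= b -> 0 < Im z ->
  nc (phi s t z) <= nc z + (Im z)^-1 * (b - s).
Proof.
move=> s0 st tb z0; rewrite -{1}(subrKC z (phi s t z)).
apply: le_trans (ncD _ _) _; rewrite lerD2l.
have := flow_lip s0 (lexx s) st z0; rewrite flow_init // => /le_trans; apply.
by rewrite ler_wpM2l ?invr_ge0 ?(ltW z0) // lerD2r.
Qed.

Definition kap t (z w : R[i]) := cauchy2 (nu t) z w.

(** By the resolvent identity the difference of two solutions solves a linear
    equation, whose coefficient kap is bounded on half planes Im z >= e.
    Starting times may differ, for the sake of the semigroup property. *)
Lemma flow_diff s u z w t : 0 <= s -> s <= t -> 0 <= u -> u <= t ->
  0 < Im z -> 0 < Im w -> ~ (flow_bad s z `|` flow_bad u w) t ->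
  is_Cderive (fun r => phi s r z - phi u r w) t
    (kap t (phi s t z) (phi u t w) * (phi s t z - phi u t w)).
Proof.
move=> s0 st u0 ut z0 w0 /not_orP[Nz Nw].
have := is_CderiveB (flow_derive st Nz) (flow_derive ut Nw).
rewrite -opprD; set l := (X in is_Cderive _ _ X).
have -> // : l = kap t (phi s t z) (phi u t w) * (phi s t z - phi u t w).
rewrite /l cauchy_sub ?nu_fin // ?flow_Im_gt0 //.
by rewrite /kap -mulNr opprB mulrC.
Qed.

Lemma nc_kap t (z w : R[i]) (e : R) : 0 < e -> e <= Im z -> e <= Im w ->
  nc (kap t z w) <= e ^- 2.
Proof.
move=> e0 ez ew; have := nc_cauchy2 (nu_mass t) e0 ez ew.
by rewrite mulr1.
Qed.

(** Uniqueness of the solution that starts at time u. *)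
Lemma flow_semigroup s u t z : 0 <= s -> s <= u -> u <= t -> 0 < Im z ->
  phi u t (phi s u z) = phi s t z.
Proof.
move=> s0 su ut z0; have u0 := le_trans s0 su.
set w := phi s u z; have w0 : 0 < Im w by exact: flow_Im_gt0.
have i0 : 0 <= (Im z) ^- 2 by rewrite invr_ge0 sqr_ge0.
have tu0 : 0 <= t - u by rewrite subr_ge0.
have [C C0 CP] := gronwall i0 tu0.
pose d r := phi u r w - phi s r z.
have : nc (d t) <= C * (nc (d u) + 0).
  apply: (CP _ ((nc w + (Im w)^-1 * (t - u)) + (nc z + (Im z)^-1 * (t - s)))
    (flow_bad u w `|` flow_bad s z) d u t) => //.
  - by apply: negligibleU; exact: flow_bad_null.
  - by apply: cacB; exact: flow_ac.
  - move=> r ur rt; apply: le_trans (ncB _ _) _; apply: lerD; apply: flow_bound => //.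
    exact: le_trans su ur.
  - move=> r ur rt Nr; have sr := le_trans su ur.
    exists (kap r (phi u r w) (phi s r z) * d r).
      rewrite addr0 ncM ler_wpM2r ?nc_ge0 //; apply: nc_kap => //.
        apply: le_trans (flow_Im_ge s0 su z0) _; exact: flow_Im_ge.
      exact: flow_Im_ge.
    exact: flow_diff.
rewrite /d flow_init // subrr nc0 addr0 mulr0 => h.
by apply/eqP; rewrite -subr_eq0; apply/eqP/nc_eq0/le_anti; rewrite h nc_ge0.
Qed.

Section Tame.
Variables (s T e : R).
Hypotheses (s0 : 0 <= s) (sT : s <= T) (e0 : 0 < e).
Definition strip : set R[i] := [set w | e <= Im w].

Let strip_gt0 w : strip w -> 0 < Im w.
Proof. exact: lt_le_trans. Qed.

Let strip_Im w t : strip w -> s <= t -> e <= Im (phi s t w).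
Proof.
by move=> Dw st; apply: le_trans (flow_Im_ge s0 st (strip_gt0 Dw)).
Qed.

Lemma flow_lip_space : exists2 C, 0 <= C & forall w w1 t, strip w -> strip w1 ->
  s <= t -> t <= T -> nc (phi s t w1 - phi s t w) <= C * nc (w1 - w).
Proof.
have i0 : 0 <= e ^- 2 by rewrite invr_ge0 sqr_ge0.
have T0 : 0 <= T - s by rewrite subr_ge0.
have [C C0 CP] := gronwall i0 T0.
exists C => // w w1 t Dw D1 st tT.
have w0 := strip_gt0 Dw; have w10 := strip_gt0 D1.
have := CP 0 ((nc w1 + (Im w1)^-1 * (T - s)) + (nc w + (Im w)^-1 * (T - s)))
    (flow_bad s w1 `|` flow_bad s w) (fun r => phi s r w1 - phi s r w) s T.
rewrite !flow_init // addr0; apply => //.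
- by apply: negligibleU; exact: flow_bad_null.
- by apply: cacB; exact: flow_ac.
- by move=> r ur rt; apply: le_trans (ncB _ _) _; apply: lerD; apply: flow_bound.
- move=> r sr rT Nr; exists (kap r (phi s r w1) (phi s r w) * (phi s r w1 - phi s r w)).
    by rewrite addr0 ncM ler_wpM2r ?nc_ge0 //; apply: nc_kap => //; exact: strip_Im.
  exact: flow_diff.
Qed.

Lemma kap_lip t (z w w1 : R[i]) : e <= Im z -> e <= Im w -> e <= Im w1 ->
  nc (kap t z w - kap t z w1) <= e ^- 3 * nc (w - w1).
Proof.
move=> ez ew e1; rewrite /kap /cauchy2.
have gt u : e <= Im u -> 0 < Im u by exact: lt_le_trans.
have Iz := blip_res (gt z ez); have Iw := blip_res (gt w ew); have I1 := blip_res (gt w1 e1).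
have J1 := blip_cintegrable (nu_fin t) (blipM Iz Iw).
have J2 := blip_cintegrable (nu_fin t) (blipM Iz I1).
rewrite -(cintB J1 J2).
have -> : (fun x => res z x * res w x - res z x * res w1 x) =
    (fun x => (w1 - w) * (res z x * (res w x * res w1 x))).
  by apply/funext => x; rewrite -mulrBr res_sub ?gt //; ring.
have J3 := blip_cintegrable (nu_fin t) (blipM Iz (blipM Iw I1)).
rewrite (cintZ _ J3) ncM nc_distC mulrC ler_wpM2r ?nc_ge0 //.
have := @nc_cint_mass _ _ _ (e ^- 3) 1 (nu_mass t) _ J3.
rewrite mulr1; apply; first by rewrite invr_ge0 exprn_ge0 // ltW.
move=> x; rewrite !ncM -exprVn !exprS expr0 mulr1.
by apply: ler_pM; rewrite ?nc_ge0 ?mulr_ge0 ?nc_ge0 ?nc_res //; apply: ler_pM; rewrite ?nc_ge0 ?nc_res.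
Qed.

(** The second-order difference ddiff solves the same linear equation as the
    first difference, up to a source term that the Lipschitz bounds make of the
    right order; it vanishes at time s, so Gronwall applies. *)
Lemma flow_lip2 : exists K, forall t, s <= t -> t <= T -> lip2 strip (phi s t) K.
Proof.
have [C1 C10 C1P] := flow_lip_space.
have i0 : 0 <= e ^- 2 by rewrite invr_ge0 sqr_ge0.
have T0 : 0 <= T - s by rewrite subr_ge0.
have [C C0 CP] := gronwall i0 T0.
have e3 : 0 <= e ^- 3 by rewrite invr_ge0 exprn_ge0 // ltW.
pose K2 := C * (e ^- 3 * C1 ^+ 2).
have K20 : 0 <= K2 by rewrite !mulr_ge0 // sqr_ge0.
exists (C1 + K2) => t st tT; split; first exact: addr_ge0.
move=> w w1 w2 Dw D1 D2; split.
  by apply: le_trans (C1P _ _ t Dw D1 st tT) _; rewrite ler_wpM2r ?nc_ge0 // lerDl.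
set X := nc (w1 - w) * nc (w2 - w) * nc (w1 - w2).
have X0 : 0 <= X by rewrite !mulr_ge0 ?nc_ge0.
apply: (@le_trans _ _ (K2 * X)); last by rewrite ler_wpM2r // lerDr.
have w0 := strip_gt0 Dw; have w10 := strip_gt0 D1; have w20 := strip_gt0 D2.
have := CP (e ^- 3 * C1 ^+ 2 * X)
  ((C1 * nc (w1 - w)) * nc (w2 - w) + (C1 * nc (w2 - w)) * nc (w1 - w))
  ((flow_bad s w1 `|` flow_bad s w) `|` (flow_bad s w2 `|` flow_bad s w))
  (fun r => ddiff (phi s r) w w1 w2) s T.
have -> : ddiff (phi s s) w w1 w2 = 0 by rewrite /ddiff !flow_init //; ring.
rewrite nc0 add0r [C * (_ * X)]mulrA -/K2; apply => //.
- by apply: mulr_ge0 => //; apply: mulr_ge0 => //; exact: sqr_ge0.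
- by apply: negligibleU; apply: negligibleU; exact: flow_bad_null.
- rewrite (_ : (fun r => _) = (fun r => (w2 - w) * (phi s r w1 - phi s r w) - (w1 - w) * (phi s r w2 - phi s r w))).
    by apply: cacB; apply: cacZ; apply: cacB; exact: flow_ac.
  by apply/funext => r; rewrite /ddiff; ring.
- move=> r sr rT; apply: le_trans (ncB _ _) _; rewrite !ncM.
  by apply: lerD; rewrite ler_wpM2r ?nc_ge0 // C1P.
- move=> r sr rT /not_orP[N1 N2].
  have d1 := is_CderiveZ (w2 - w) (flow_diff s0 sr s0 sr w10 w0 N1).
  have d2 := is_CderiveZ (w1 - w) (flow_diff s0 sr s0 sr w20 w0 N2).
  have := is_CderiveB d1 d2.
  rewrite (_ : (fun t => _) = (fun r => ddiff (phi s r) w w1 w2)); last first.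
    by apply/funext => q; rewrite /ddiff; ring.
  set l := (X in is_Cderive _ _ X) => dl; exists l => //.
  set k1 := kap r (phi s r w1) (phi s r w) in l dl *.
  set k2 := kap r (phi s r w2) (phi s r w) in l dl *.
  have -> : l = k1 * ddiff (phi s r) w w1 w2 + (k1 - k2) * ((phi s r w2 - phi s r w) * (w1 - w)).
    by rewrite /l /ddiff; ring.
  apply: le_trans (ncD _ _) _; rewrite !ncM; apply: lerD.
    by rewrite ler_wpM2r ?nc_ge0 //; apply: nc_kap => //; exact: strip_Im.
  have kk : nc (k1 - k2) <= e ^- 3 * nc (phi s r w1 - phi s r w2).
    have sym a b : kap r a b = kap r b a.
      by rewrite /kap /cauchy2; congr cint; apply/funext => x; rewrite mulrC.
    by rewrite /k1 /k2 ![kap _ _ (phi s r w)]sym kap_lip //; exact: strip_Im.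
  have -> : e ^- 3 * C1 ^+ 2 * X = (e ^- 3 * (C1 * nc (w1 - w2))) * ((C1 * nc (w2 - w)) * nc (w1 - w)).
    by rewrite /X; ring.
  apply: ler_pM; rewrite ?mulr_ge0 ?nc_ge0 //.
    by apply: le_trans kk _; rewrite ler_wpM2l // C1P.
  by rewrite ler_wpM2r ?nc_ge0 // C1P.
Qed.

End Tame.
End Flow.

(** * Divided differences of the flow *)

Section Extension.
Variable R : realType.
Implicit Types (f g : R[i] -> R[i]) (D : set R[i]).

Let rn n : R := n.+1%:R^-1.
Let rn_gt0 n : 0 < rn n. Proof. by rewrite invr_gt0 ltr0n. Qed.

Let real_limit (x : nat -> R) (K : R) :
  (forall n m, `|x n - x m| <= K * (rn n + rn m)) ->
  exists l, forall n, `|x n - l| <= K * rn n.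
Proof.
move=> xK; pose A := [set x n - K * rn n | n in setT].
have ub m : ubound A (x m + K * rn m).
  move=> _ [n _ <-]; have := xK n m; have := ler_norm (x n - x m).
  by rewrite mulrDr; lra.
have A0 : A !=set0 by exists (x 0%N - K * rn 0%N), 0%N.
have sA : has_sup A by split => //; exists (x 0%N + K * rn 0%N).
exists (sup A) => n; rewrite ler_norml; apply/andP; split.
  by have := ge_sup A0 (ub n); lra.
have : x n - K * rn n <= sup A by apply: ub_le_sup; [case: sA|exists n].
by lra.
Qed.

Lemma ccvg_cst (c : R[i]) : ccvg (fun _ => c) c.
Proof. by rewrite /ccvg subrr nc0; exact: cvg_cst. Qed.

Lemma ccvgB (u v : nat -> R[i]) a b : ccvg u a -> ccvg v b ->
  ccvg (fun n => u n - v n) (a - b).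
Proof.
move=> ua vb; apply: (@ccvg_le _ _ _ (fun n => nc (u n - a) + nc (v n - b))).
  apply: nearW => n; rewrite (_ : _ - _ = (u n - a) - (v n - b)) ?ncB //; ring.
by rewrite -(addr0 0); exact: cvgD.
Qed.

Lemma ccvg_nc (u : nat -> R[i]) a : ccvg u a -> nc (u n) @[n --> \oo] --> nc a.
Proof.
move=> ua; apply/cvgrPdist_le => e e0; near=> n.
have h : nc (u n - a) <= e.
  have : `|0 - nc (u n - a)| <= e by near: n; move/cvgrPdist_le: ua; apply.
  by rewrite sub0r normrN ger0_norm ?nc_ge0.
have h1 := ncD (u n - a) a; have h2 := ncB (u n) (u n - a).
rewrite subrK in h1; rewrite subKr in h2; rewrite ler_norml; lra.
Unshelve. all: by end_near. Qed.

Lemma ccvgM (u v : nat -> R[i]) a b : ccvg u a -> ccvg v b ->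
  ccvg (fun n => u n * v n) (a * b).
Proof.
move=> ua vb.
apply: (@ccvg_le _ _ _ (fun n => nc (u n - a) * nc (v n) + nc a * nc (v n - b))).
  apply: nearW => n.
  rewrite (_ : _ - _ = (u n - a) * v n + a * (v n - b)); last by ring.
  by apply: le_trans (ncD _ _) _; rewrite !ncM.
have := cvgD (cvgM ua (ccvg_nc vb)) (cvgM (cvg_cst (nc a)) vb).
by rewrite mul0r mulr0 addr0; apply.
Qed.

Let rn_cvg0 : rn n @[n --> \oo] --> (0 : R).
Proof. exact: cvg_harmonic. Qed.

(** Removal of a singularity by continuity, along z0 + 1/(n+1). It is meant for
    divided differences, which are defined away from their base point only. *)
Lemma tame_extend D f K z0 : (forall n, D (z0 + (rn n)%:C)) ->
  tame (D `\ z0) f K ->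
  exists2 g, tame D g K & forall w, w != z0 -> g w = f w.
Proof.
move=> hD [[K0 fL] fB]; pose z n := z0 + (rn n)%:C.
have zD n : (D `\ z0) (z n).
  split; first exact: hD.
  rewrite /z /= => /(congr1 (fun u : R[i] => Re u)); rewrite ReD /= => h.
  have := rn_gt0 n; lra.
have zz n m : nc (f (z n) - f (z m)) <= K * (rn n + rn m).
  have [h _] := fL _ _ _ (zD m) (zD n) (zD n); apply: le_trans h _.
  rewrite ler_wpM2l // /z opprD addrACA subrr add0r.
  by apply: le_trans (ncB _ _) _; rewrite !ncR !ger0_norm // ltW.
have [l1 l1P] := @real_limit (fun n => Re (f (z n))) K (fun n m =>
  le_trans (eq_ind _ (fun y => `|y| <= _) (Re_le_nc _) _ (ReB _ _)) (zz n m)).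
have [l2 l2P] := @real_limit (fun n => Im (f (z n))) K (fun n m =>
  le_trans (eq_ind _ (fun y => `|y| <= _) (Im_le_nc _) _ (ImB _ _)) (zz n m)).
pose l := l1 +i* l2.
pose g w := if w == z0 then l else f w.
pose ap w n := if w == z0 then z n else w.
have apD w n : D w -> (D `\ z0) (ap w n).
  by rewrite /ap; case: eqVneq => // /eqP wz Dw; split.
have apc w : ccvg (ap w) w.
  rewrite /ap; case: eqVneq => [->|_]; last exact: ccvg_cst.
  apply: (@ccvg_le _ _ _ rn) => //; apply: nearW => n.
  by rewrite /z addrC addKr ncR ger0_norm // ltW.
have fac w : ccvg (fun n => f (ap w n)) (g w).
  rewrite /ap /g; case: eqVneq => _; last exact: ccvg_cst.
  apply: (@ccvg_le _ _ _ (fun n => 2 * K * rn n)); last first.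
    by have := cvgM (cvg_cst (2 * K)) rn_cvg0; rewrite mulr0; apply.
  apply: nearW => n; apply: le_trans (nc_le_ReIm _) _; rewrite ReB ImB /=.
  have := l1P n; have := l2P n; lra.
exists g; last by move=> w wz; rewrite /g (negbTE wz).
have lec (u : nat -> R[i]) a (v : nat -> R) b : ccvg u a -> v n @[n --> \oo] --> b ->
    (forall n, nc (u n) <= v n) -> nc a <= b.
  by move=> ua vb uv; apply: (ler_cvg_to (ccvg_nc ua) vb); exact: nearW.
split; last first.
  move=> w Dw; apply: (lec _ _ _ _ (fac w) (cvg_cst K)) => n.
  exact: fB (apD w n Dw).
split=> // w w1 w2 Dw D1 D2; split.
  apply: (lec _ _ (fun n => K * nc (ap w1 n - ap w n)) _ (ccvgB (fac w1) (fac w))).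
    by apply: cvgM; [exact: cvg_cst|apply: ccvg_nc; exact: ccvgB].
  by move=> n; have [] := fL _ _ _ (apD w n Dw) (apD w1 n D1) (apD w2 n D2).
apply: (lec _ _ (fun n => K * (nc (ap w1 n - ap w n) * nc (ap w2 n - ap w n) * nc (ap w1 n - ap w2 n))) _
  (ccvgB (ccvgM (ccvgB (fac w1) (fac w)) (ccvgB (apc w2) (apc w)))
         (ccvgM (ccvgB (fac w2) (fac w)) (ccvgB (apc w1) (apc w))))).
  apply: cvgM; first exact: cvg_cst.
  by apply: cvgM; [apply: cvgM|]; apply: ccvg_nc; exact: ccvgB.
by move=> n; have [] := fL _ _ _ (apD w n Dw) (apD w1 n D1) (apD w2 n D2).
Qed.

End Extension.

Section DividedFlow.
Variable R : realType.
Variables (nu : R -> prob R) (phi : R -> R -> R[i] -> R[i]).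
Hypothesis phiP : loewner_solution nu phi.
Variables (s T e : R).
Hypotheses (s0 : 0 <= s) (sT : s <= T) (e0 : 0 < e).
Variable z0 : R[i].
Hypothesis Dz0 : strip e z0.
Notation D := (strip e).

Let strip_gt0 w : D w -> 0 < Im w.
Proof. exact: lt_le_trans. Qed.

Let strip_Im w t : D w -> s <= t -> e <= Im (phi s t w).
Proof.
by move=> Dw st; apply: le_trans (flow_Im_ge phiP s0 st (strip_gt0 Dw)).
Qed.

(* The coefficient of the equation solved by the divided difference E below.
   Its tameness is that of the resolvents of the flow, integrated over the
   pole. *)
Let k t w := kap nu t (phi s t w) (phi s t z0).

Let k_tame : exists L, forall t, s <= t -> t <= T -> tame D (k t) L.
Proof.
have [K KP] := flow_lip2 phiP s0 sT e0.
set L := e^-1 + K * e ^- 2 + K * K * e ^- 3; exists (L * e^-1) => t st tT.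
have rP x := tame_inv (KP t st tT) e0 (fun w Dw => nc_resolvent x (strip_Im Dw st)).
have L0 : 0 <= L by have [[]] := rP 0.
have e1 : 0 <= e^-1 by rewrite invr_ge0 ltW.
have Iz : blip (res (phi s t z0)).
  by apply: blip_res; apply: lt_le_trans (strip_Im Dz0 st).
have I w : D w -> blip (res (phi s t w)).
  by move=> Dw; apply: blip_res; apply: lt_le_trans (strip_Im Dw st).
have J w : D w -> cintegrable (nu t) (fun x => res (phi s t w) x * res (phi s t z0) x).
  by move=> Dw; apply: blip_cintegrable (nu_fin nu t) _; apply: blipM => //; exact: I.
have rz x : nc (res (phi s t z0) x) <= e^-1 by apply: nc_res => //; exact: strip_Im.
have bd f (B : R) : 0 <= B -> cintegrable (nu t) f -> (forall x, nc (f x) <= B) ->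
    nc (cint (nu t) f) <= B.
  move=> B0 fi fB; have := nc_cint_mass (nu_mass nu t) B0 fi fB.
  by rewrite mulr1.
split; last first.
  move=> w Dw; apply: bd; rewrite ?mulr_ge0 //; first exact: J.
  move=> x; rewrite ncM ler_pM ?nc_ge0 //; have [_] := rP x; exact.
split; first by rewrite mulr_ge0.
move=> w w1 w2 Dw D1 D2; split.
  rewrite /k /kap /cauchy2 -(cintB (J w1 D1) (J w Dw)); apply: bd.
  - by rewrite !mulr_ge0 ?nc_ge0.
  - have := cintegrableD (J w1 D1) (cintegrableZ (-1) (J w Dw)).
    by congr cintegrable; apply/funext => x; rewrite mulN1r.
  - move=> x; rewrite -mulrBl ncM -mulrA [e^-1 * _]mulrC mulrA ler_pM ?nc_ge0 //.
    have [[_ h] _] := rP x; by have [] := h _ _ _ Dw D1 D2.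
set X := nc (w1 - w) * nc (w2 - w) * nc (w1 - w2).
have X0 : 0 <= X by rewrite !mulr_ge0 ?nc_ge0.
pose rr w x := res (phi s t w) x * res (phi s t z0) x.
have M c1 c2 : cintegrable (nu t) (fun x => c1 * (rr w1 x + -1 * rr w x)) /\
   cintegrable (nu t) (fun x => c2 * (rr w2 x + -1 * rr w x)).
  by split; apply: cintegrableZ; apply: cintegrableD; try apply: cintegrableZ; exact: J.
have [M1 M2] := M (w2 - w) (w1 - w).
have -> : ddiff (k t) w w1 w2 = cint (nu t) (fun x =>
    (w2 - w) * (rr w1 x + -1 * rr w x) - (w1 - w) * (rr w2 x + -1 * rr w x)).
  rewrite (cintB M1 M2) !cintZ ?cintD ?cintZ; try (apply: cintegrableD); try (apply: cintegrableZ); try exact: J.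
  by rewrite /ddiff /k /kap /cauchy2 /rr; ring.
apply: bd; first exact: mulr_ge0 (mulr_ge0 L0 e1) X0.
  have := cintegrableD M1 (cintegrableZ (-1) M2).
  by congr cintegrable; apply/funext => x; congr (_ + _); exact: mulN1r.
move=> x; have [[_ h] _] := rP x; have [_ h2] := h _ _ _ Dw D1 D2.
have -> : (w2 - w) * (rr w1 x + -1 * rr w x) - (w1 - w) * (rr w2 x + -1 * rr w x) =
  ddiff (fun w => (phi s t w - x%:C)^-1) w w1 w2 * res (phi s t z0) x.
  by rewrite /ddiff /rr /res; ring.
by rewrite ncM -mulrA [e^-1 * _]mulrC mulrA ler_pM ?nc_ge0.
Qed.

Let E t w := (w - z0)^-1 * (phi s t w - phi s t z0).
Let D' := D `\ z0.
Let bad w := flow_bad nu phi s w `|` flow_bad nu phi s z0.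

Let D'n0 w : D' w -> w - z0 != 0.
Proof. by move=> [_ /eqP]; rewrite subr_eq0. Qed.

Let E_derive t w : D' w -> s <= t -> ~ bad w t ->
  is_Cderive (fun t => E t w) t (k t w * E t w).
Proof.
move=> [Dw _] st Nt.
have := is_CderiveZ (w - z0)^-1 (flow_diff phiP s0 st s0 st (strip_gt0 Dw) (strip_gt0 Dz0) Nt).
by congr is_Cderive; rewrite /E /k; ring.
Qed.

Let E_ac w : D' w -> absolutely_continuous_on s T (fun t => E t w).
Proof.
move=> [Dw _]; apply: cacZ; apply: cacB; apply: (flow_ac phiP) => //; exact: strip_gt0.
Qed.

Let bad_null w : D' w -> (@lebesgue_measure R).-negligible (bad w).
Proof.
by move=> [Dw _]; apply: negligibleU; apply: (flow_bad_null phiP) => //; exact: strip_gt0.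
Qed.

Let E_init w : D' w -> E s w = 1.
Proof.
move=> D'w; have [Dw _] := D'w; rewrite /E !(flow_init phiP) ?strip_gt0 //.
by rewrite mulVf // D'n0.
Qed.

(* E solves d/dt E = k E with initial value 1: Gronwall passes the bounds on k
   and on its divided differences to E. *)
Let E_tame : exists K, forall t, s <= t -> t <= T -> tame D' (E t) K.
Proof.
have [C1 C10 C1P] := flow_lip_space phiP s0 sT e0.
have i0 : 0 <= e ^- 2 by rewrite invr_ge0 sqr_ge0.
have T0 : 0 <= T - s by rewrite subr_ge0.
have [C C0 CP] := gronwall i0 T0.
have [L LP] := k_tame.
have L0 : 0 <= L by have [[]] := LP s (lexx _) sT.
have EB t w : s <= t -> t <= T -> D' w -> nc (E t w) <= C1.
  move=> st tT D'w; have [Dw _] := D'w; rewrite /E ncM ncV ler_pdivrMl ?nc_gt0 ?D'n0 //.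
  by rewrite mulrC C1P.
have kB t w : s <= t -> t <= T -> D w -> nc (k t w) <= e ^- 2.
  by move=> st tT Dw; apply: nc_kap => //; exact: strip_Im.
pose C2 := C * (L * C1).
have C20 : 0 <= C2 by rewrite !mulr_ge0.
have EL t w w1 : s <= t -> t <= T -> D' w -> D' w1 ->
    nc (E t w1 - E t w) <= C2 * nc (w1 - w).
  move=> st tT D'w D'1; have [Dw _] := D'w; have [D1 _] := D'1.
  have := CP (L * C1 * nc (w1 - w)) (C1 + C1) (bad w1 `|` bad w)
    (fun t => E t w1 - E t w) s T.
  rewrite /= !E_init // subrr nc0 add0r mulrA -/C2; apply => //.
  - by rewrite !mulr_ge0 ?nc_ge0.
  - by apply: negligibleU; exact: bad_null.
  - by apply: cacB; exact: E_ac.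
  - by move=> r sr rT; apply: le_trans (ncB _ _) _; rewrite lerD ?EB.
  - move=> r sr rT /not_orP[N1 N2].
    have := is_CderiveB (E_derive D'1 sr N1) (E_derive D'w sr N2).
    set l := (X in is_Cderive _ _ X) => dl; exists l => //.
    have -> : l = k r w1 * (E r w1 - E r w) + (k r w1 - k r w) * E r w.
      by rewrite /l; ring.
    apply: le_trans (ncD _ _) _; rewrite [nc (k r w1 * _)]ncM [nc (_ * E r w)]ncM; apply: lerD.
      by rewrite ler_wpM2r ?nc_ge0 // kB.
    have [[_ h] _] := LP r sr rT; have [h1 _] := h _ _ _ Dw D1 D1.
    rewrite -mulrA [C1 * _]mulrC mulrA.
    by apply: ler_pM; rewrite ?nc_ge0 // EB.
pose C3 := C * (L * C1 + L * C2).
have C30 : 0 <= C3 by rewrite mulr_ge0 // addr_ge0 ?mulr_ge0.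
exists (C1 + C2 + C3) => t st tT; split; last first.
  by move=> w Dw; apply: le_trans (EB t w st tT Dw) _; lra.
split; first lra.
move=> w w1 w2 D'w D'1 D'2; split.
  by apply: le_trans (EL t w w1 st tT D'w D'1) _; rewrite ler_wpM2r ?nc_ge0 //; lra.
set X := nc (w1 - w) * nc (w2 - w) * nc (w1 - w2).
have X0 : 0 <= X by rewrite !mulr_ge0 ?nc_ge0.
apply: (@le_trans _ _ (C3 * X)); last by rewrite ler_wpM2r //; lra.
have [Dw _] := D'w; have [D1 _] := D'1; have [D2 _] := D'2.
have := CP ((L * C1 + L * C2) * X)
  ((C2 * nc (w1 - w)) * nc (w2 - w) + (C2 * nc (w2 - w)) * nc (w1 - w))
  ((bad w1 `|` bad w) `|` (bad w2 `|` bad w)) (fun r => ddiff (E r) w w1 w2) s T.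
have -> : ddiff (E s) w w1 w2 = 0 by rewrite /ddiff !E_init //; ring.
rewrite nc0 add0r mulrA -/C3; apply => //.
- by apply: mulr_ge0 => //; rewrite addr_ge0 ?mulr_ge0.
- by apply: negligibleU; apply: negligibleU; exact: bad_null.
- rewrite (_ : (fun r => _) = (fun r => (w2 - w) * (E r w1 - E r w) - (w1 - w) * (E r w2 - E r w))).
    by apply: cacB; apply: cacZ; apply: cacB; exact: E_ac.
  by apply/funext => r; rewrite /ddiff; ring.
- move=> r sr rT; apply: le_trans (ncB _ _) _; rewrite !ncM.
  by apply: lerD; rewrite ler_wpM2r ?nc_ge0 // EL.
- move=> r sr rT /not_orP[/not_orP[N1 N] /not_orP[N2 _]].
  have d0 := E_derive D'w sr N.
  have d1 := is_CderiveZ (w2 - w) (is_CderiveB (E_derive D'1 sr N1) d0).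
  have d2 := is_CderiveZ (w1 - w) (is_CderiveB (E_derive D'2 sr N2) d0).
  have := is_CderiveB d1 d2.
  rewrite (_ : (fun t => _) = (fun r => ddiff (E r) w w1 w2)); last first.
    by apply/funext => q; rewrite /ddiff; ring.
  set l := (X in is_Cderive _ _ X) => dl; exists l => //.
  have -> : l = k r w1 * ddiff (E r) w w1 w2 +
      (ddiff (k r) w w1 w2 * E r w + (k r w1 - k r w2) * ((E r w2 - E r w) * (w1 - w))).
    by rewrite /l /ddiff; ring.
  apply: le_trans (ncD _ _) _; rewrite [nc (k r w1 * _)]ncM; apply: lerD.
    by rewrite ler_wpM2r ?nc_ge0 // kB.
  apply: le_trans (ncD _ _) _; rewrite [nc (_ * E r w)]ncM [nc ((k r w1 - _) * _)]ncM [nc ((E r w2 - _) * _)]ncM mulrDl.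
  have [[_ h] _] := LP r sr rT.
  apply: lerD.
    rewrite -mulrA [C1 * X]mulrC mulrA.
    apply: ler_pM; rewrite ?nc_ge0 ?EB //.
    by have [_] := h _ _ _ Dw D1 D2.
  have -> : L * C2 * X = (L * nc (w1 - w2)) * ((C2 * nc (w2 - w)) * nc (w1 - w)).
    by rewrite /X; ring.
  apply: ler_pM; rewrite ?mulr_ge0 ?nc_ge0 //.
    by have [] := h _ _ _ D2 D1 D1.
  by rewrite ler_wpM2r ?nc_ge0 // EL.
Qed.

(** This is holomorphy of the flow in space, in the form in which the
    representation theorem takes it: the divided difference is a factor that
    is tame up to its base point. *)
Lemma flow_divided : exists K g, tame D g K /\
  forall w, D w -> phi s T w - phi s T z0 = (w - z0) * g w.
Proof.
have [K KP] := E_tame.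
have hD n : D (z0 + (n.+1%:R^-1)%:C).
  by rewrite /strip /= ImD /= addr0; exact: Dz0.
have [g gK gE] := tame_extend hD (KP T sT (lexx T)).
exists K, g; split => // w Dw; have [->|wz] := eqVneq w z0.
  by rewrite !subrr mul0r.
by rewrite gE // /E mulVKf // subr_eq0.
Qed.

End DividedFlow.

(** * The flow as a family of F-transforms *)

Section ProbabilityOfMass1.
Variable R : realType.

Section Copy.
Variable mu : bmeasure R.
Hypothesis mu1 : mu setT = 1%E.
(** The phantom argument lets the hypothesis on the mass serve as data of a
    probability instance. *)
Definition mass1_measure of mu setT = 1%E : set (measurableTypeR R) -> \bar R := mu.
Let m := mass1_measure mu1.
HB.instance Definition _ := Measure.copy m mu.
HB.instance Definition _ := Measure_isProbability.Build _ _ _ m mu1.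

Lemma probability_of_mass1 : exists P : prob R, forall z, cauchy P z = cauchy mu z.
Proof. by exists m. Qed.
End Copy.

(** The total mass is the limit of - y Im G(iy). *)
Lemma cauchy_probability (mu : bmeasure R) (v : R) : (mu setT < +oo)%E ->
  (forall n, `|1 - n.+1%:R * - Im (cauchy mu (iy R n.+1))| <= v / n.+1%:R) ->
  exists P : prob R, forall z, cauchy P z = cauchy mu z.
Proof.
move=> mufin hv; apply: probability_of_mass1.
have h := mass_cvg mufin.
suff h1 : (n.+1%:R * - Im (cauchy mu (iy R n.+1)))%:E @[n --> \oo] --> 1%E.
  exact: cvg_unique h h1.
apply: cvg_EFin; first exact: nearW.
apply/cvgrPdist_le => e e0 /=.
have [N _ NP] : \forall n \near \oo, `|0 - v * n.+1%:R^-1| <= e.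
  have : v * n.+1%:R^-1 @[n --> \oo] --> (0 : R).
    by rewrite -[X in _ --> X](mulr0 v); apply: cvgM; [exact: cvg_cst|exact: cvg_harmonic].
  by move/cvgrPdist_le; apply.
exists N => // n Nn; apply: le_trans (hv n) _.
have := NP n Nn; rewrite sub0r normrN; apply: le_trans; exact: ler_norm.
Qed.

End ProbabilityOfMass1.

Section FlowTransform.
Variable R : realType.
Variables (nu : R -> prob R) (phi : R -> R -> R[i] -> R[i]).
Hypothesis phiP : loewner_solution nu phi.
Variables (s t : R).
Hypotheses (s0 : 0 <= s) (st : s <= t).
Let v := t - s.
Let v0 : 0 <= v. Proof. by rewrite subr_ge0. Qed.

Let F z := phi s t z.

Lemma flow_sub_id z : 0 < Im z -> nc (F z - z) <= v / Im z.
Proof.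
move=> z0; have := flow_lip phiP s0 (lexx s) st z0.
by rewrite (flow_init phiP) // mulrC.
Qed.

Let FIm z : 0 < Im z -> Im z <= Im (F z).
Proof. exact: (flow_Im_ge phiP). Qed.

Let nF_ge z : 0 < Im z -> Im z <= nc (F z).
Proof.
move=> z0; apply: le_trans (FIm z0) _; apply: le_trans (ler_norm _) _; exact: Im_le_nc.
Qed.

Let F_mass z : 0 < Im z -> Im z * - Im ((F z)^-1) <= 1.
Proof.
move=> z0; have h := nF_ge z0.
have n0 : 0 < nc (F z) by apply: lt_le_trans h.
apply: (@le_trans _ _ (Im z * nc (F z)^-1)).
  rewrite ler_wpM2l ?(ltW z0) //; apply: le_trans (Im_le_nc _).
  by rewrite -normrN ler_norm.
by rewrite ncV ler_pdivrMr // mul1r.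
Qed.

(** The shift by e keeps |F| above e, hence 1/F tame up to the real line; the
    decay of 1/F comes from the boundedness of F z - z there. *)
Lemma flow_shifted (e : R) : 0 < e ->
  exists2 mu : bmeasure R, (mu setT <= 1%:E)%E &
    forall z, 0 < Im z -> cauchy mu z = (F (z + 0 +i* e))^-1.
Proof.
move=> e0; pose S (w : R[i]) := w + 0 +i* e.
have SD w : uhp_closed w -> strip e (S w).
  by rewrite /uhp_closed /strip /S /= ImD /= lerDr.
have Sgt w : uhp_closed w -> 0 < Im (S w).
  by move=> /SD; exact: lt_le_trans.
have lipS f K : lip2 (strip e) f K -> lip2 (@uhp_closed R) (f \o S) K.
  move=> [K0 fK]; split => // w w1 w2 Dw D1 D2.
  have := fK _ _ _ (SD w Dw) (SD w1 D1) (SD w2 D2).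
  have E a b : S a - S b = a - b by rewrite /S; ring.
  by rewrite /ddiff !E.
have [K KP] := flow_lip2 phiP s0 st e0.
have fK := lipS _ _ (KP t st (lexx t)).
have Fe w : uhp_closed w -> e <= nc (F (S w)).
  move=> Dw; apply: le_trans (nF_ge (Sgt w Dw)); exact: SD.
have tG := tame_inv (c := 0) fK e0 (fun w Dw => eq_ind _ (fun u => e <= nc u) (Fe w Dw) _ (esym (subr0 _))).
set KG := (X in tame _ _ X) in tG.
pose G w := (F (S w))^-1.
have tG' : tame (@uhp_closed R) G KG.
  by move: tG; congr tame; apply/funext => w; rewrite subr0.
have ImG w : uhp_closed w -> Im (G w) <= 0.
  move=> Dw; rewrite /G ImV oppr_le0 divr_ge0 ?sqr_ge0 //.
  by apply: ltW; apply: (flow_Im_gt0 phiP) => //; exact: Sgt.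
pose C := 1 + (v / e + e) / e.
have C0 : 0 <= C by rewrite !addr_ge0 ?divr_ge0 ?addr_ge0 ?divr_ge0 // ltW.
have Gd w : uhp_closed w -> nc w * nc (G w) <= C.
  move=> Dw; have n0 : 0 < nc (F (S w)) by apply: lt_le_trans (Fe w Dw).
  have h : nc w <= nc (F (S w)) + (v / e + e).
    rewrite {1}(_ : w = F (S w) - ((F (S w) - S w) + 0 +i* e)); last by rewrite /S; ring.
    apply: le_trans (ncB _ _) _; rewrite lerD2l; apply: le_trans (ncD _ _) _.
    apply: lerD.
      apply: le_trans (flow_sub_id (Sgt w Dw)) _.
      by rewrite ler_wpM2l // lef_pV2 ?posrE ?Sgt //; exact: SD.
    by apply: le_trans (nc_le_ReIm _) _; rewrite /= normr0 add0r ger0_norm // ltW.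
  rewrite /G ncV ler_pdivrMr // mulrDl mul1r; apply: le_trans h _; rewrite lerD2l.
  rewrite -mulrA ler_peMr //; first by rewrite addr_ge0 ?divr_ge0 // ltW.
  by rewrite ler_pdivlMl // mulr1 Fe.
have Gdiv z : 0 < Im z -> exists g Kg, tame (@uhp_closed R) g Kg /\
    forall w, uhp_closed w -> G w - G z = (w - z) * g w.
  move=> z0; have Dz : uhp_closed z by exact: ltW.
  have [K1 [g [[gL gB] gE]]] := flow_divided phiP s0 st e0 (SD z Dz).
  have tg : tame (@uhp_closed R) (g \o S) K1.
    by split; [exact: lipS|move=> w Dw; apply: gB; exact: SD].
  have tM := tameM (tameM tg tG') (tame_cst (@uhp_closed R) (- G z)).
  exists (fun w => (g \o S) w * G w * - G z); eexists; split; first exact: tM.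
  move=> w Dw; have n1 : F (S w) != 0 by rewrite -nc_gt0 (lt_le_trans e0) ?Fe.
  have n2 : F (S z) != 0 by rewrite -nc_gt0 (lt_le_trans e0) ?Fe.
  have := gE (S w) (SD w Dw); have -> : S w - S z = w - z by rewrite /S; ring.
  rewrite -/(F _) -/(F _) => h.
  have -> : (w - z) * ((g \o S) w * G w * - G z) = - ((w - z) * g (S w)) * (G w * G z).
    by rewrite /=; ring.
  by rewrite -h /G; field; rewrite ?n1 ?n2.
have [mu mufin muP] := herglotz C0 tG' ImG Gd Gdiv.
exists mu => //.
have := mass_cvg mufin => /cvge_to_le; apply.
apply: nearW => n; rewrite lee_fin muP ?Im_iy_gt0 // /G.
have z0 : 0 < Im (S (iy R n.+1)) by apply: Sgt; apply: ltW; exact: Im_iy_gt0.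
apply: le_trans (F_mass z0); rewrite ler_wpM2r //.
  by have := ImG (iy R n.+1) (ltW (Im_iy_gt0 R n)); rewrite oppr_ge0.
by rewrite /S ImD /= lerDl ltW.
Qed.

(** The shift tends to 0. No mass is lost in the limit: F z - z = O(1 / Im z)
    makes 1/F asymptotic to 1/z along iy. *)
Lemma flow_F_transform : exists sigma : prob R,
  forall z, 0 < Im z -> phi s t z = (cauchy sigma z)^-1.
Proof.
have /choice[mu muP] n : exists m : bmeasure R, (m setT <= 1%:E)%E /\
    forall z, 0 < Im z -> cauchy m z = (F (z + 0 +i* n.+1%:R^-1))^-1.
  have n0 : 0 < n.+1%:R^-1 :> R by rewrite invr_gt0 ltr0n.
  by have [m m1 m2] := flow_shifted n0; exists m.
have cv z : 0 < Im z -> ccvg (fun n => cauchy (mu n) z) (F z)^-1.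
  move=> z0; have [K KP] := flow_lip2 phiP s0 st z0.
  have Fz w : strip (Im z) w -> Im z <= nc (F w - 0).
    move=> Dw; have w0 : 0 < Im w by exact: lt_le_trans z0 Dw.
    by rewrite subr0; apply: le_trans (nF_ge w0).
  have [[K1 tG] _] := tame_inv (KP t st (lexx t)) z0 Fz.
  set L := (X in 0 <= X) in K1 tG.
  apply: (@ccvg_le _ _ _ (fun n => L * n.+1%:R^-1)); last first.
    by rewrite -[X in _ --> X](mulr0 L); apply: cvgM; [exact: cvg_cst|exact: cvg_harmonic].
  apply: nearW => n; rewrite (muP n).2 //.
  have n0 : 0 <= n.+1%:R^-1 :> R by rewrite invr_ge0 ler0n.
  have Dz : strip (Im z) z by exact: lexx.
  have D1 : strip (Im z) (z + 0 +i* n.+1%:R^-1) by rewrite /strip /= ImD /= lerDl.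
  have [] := tG z _ _ Dz D1 D1; rewrite !subr0 => h _; apply: le_trans h _.
  rewrite ler_wpM2l // addrC addKr; apply: le_trans (nc_le_ReIm _) _.
  by rewrite /= normr0 add0r ger0_norm.
have [mu0 mu01 mu0P] := cauchy_closed (fun n => (muP n).1) cv.
have mufin : (mu0 setT < +oo)%E by apply: le_lt_trans mu01 _; rewrite ltry.
have [|P PP] := @cauchy_probability _ mu0 v mufin; last first.
  by exists P => z z0; rewrite PP mu0P // invrK.
move=> n; have z0 := Im_iy_gt0 R n; rewrite mu0P //.
set z := iy R n.+1; have zy : Im z = n.+1%:R by [].
have y0 : 0 < n.+1%:R :> R by rewrite ltr0n.
have nF := nF_ge z0.
have F0 : F z != 0 by rewrite -nc_gt0; apply: lt_le_trans nF.
have zn0 : z != 0 by apply: Im_gt0_neq0.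
have e1 : Im z^-1 = - n.+1%:R^-1.
  have zx : Re z = 0 by [].
  rewrite ImV nc_sq zx zy; move: y0; move: (n.+1%:R : R) => y y0.
  by field; rewrite gt_eqF.
have -> : 1 - n.+1%:R * - Im (F z)^-1 = n.+1%:R * Im ((F z)^-1 - z^-1).
  rewrite ImB e1 opprK mulrDr divff ?gt_eqF //; ring.
rewrite normrM ger0_norm ?ler0n //.
have -> : (F z)^-1 - z^-1 = - ((F z - z) * ((F z)^-1 * z^-1)).
  by field; rewrite ?F0 ?zn0.
apply: (@le_trans _ _ (n.+1%:R * ((v / n.+1%:R) * (n.+1%:R^-1 * n.+1%:R^-1)))).
  rewrite ler_wpM2l ?ler0n //; apply: le_trans (Im_le_nc _) _; rewrite ncN !ncM.
  apply: ler_pM; rewrite ?mulr_ge0 ?nc_ge0 //; first exact: flow_sub_id.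
  apply: ler_pM; rewrite ?nc_ge0 // ncV lef_pV2 ?posrE ?nc_gt0 //.
  by rewrite -zy; apply: le_trans (ler_norm _) (Im_le_nc _).
have y1 : 1 <= n.+1%:R :> R by rewrite ler1n.
move: y0 y1; move: (n.+1%:R : R) => y y0 y1.
have -> : y * (v / y * (y^-1 * y^-1)) = (v / y) * y^-1 by field; rewrite gt_eqF.
by rewrite ler_piMr ?divr_ge0 ?(ltW y0) // invf_le1.
Qed.

End FlowTransform.

(** * Integral bounds for absolutely continuous paths *)

Section Primitive.
Variable R : realType.
Notation leb := (@lebesgue_measure R).
Implicit Types (d : R -> R[i]) (m : R -> R).

Let leb_itv (i : interval R) : (leb : bmeasure R) [set` i] =
  (if i.1 < i.2 then (i.2 : \bar R) - i.1 else 0)%E.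
Proof. exact: lebesgue_measure_itv. Qed.

Let leb_cc (a b : R) : a <= b -> (leb : bmeasure R) `[a, b]%classic = (b - a)%:E.
Proof.
move=> ab; rewrite leb_itv /= lte_fin; case: ltP => // ba.
by rewrite (@le_anti _ _ a b) ?ab // subrr.
Qed.

Let leb_oc (a b : R) : a <= b -> (leb : bmeasure R) `]a, b]%classic = (b - a)%:E.
Proof.
move=> ab; rewrite leb_itv /= lte_fin; case: ltP => // ba.
by rewrite (@le_anti _ _ a b) ?ab // subrr.
Qed.

Lemma bounded_integrable_itv m (B a b : R) :
  measurable_fun setT (m : measurableTypeR R -> measurableTypeR R) ->
  (forall x, `|m x| <= B) -> leb.-integrable `[a, b] (EFin \o m).
Proof.
move=> mm mB; apply: measurable_bounded_integrable => //.
- by rewrite leb_itv /=; case: ifP => _; rewrite ?ltry // ltNyr.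
- exact: measurable_funTS.
- by exists B; split => [|M BM x _]; [exact: num_real|exact: le_trans (mB x) (ltW BM)].
Qed.

Section Truncated.
Variables (m : R -> R) (B s t : R).
Hypotheses (st : s <= t) (B0 : 0 <= B).
Hypothesis mm : measurable_fun setT (m : measurableTypeR R -> measurableTypeR R).
Hypothesis mB : forall x, `|m x| <= B.

(** The restriction to [s, t] is integrable over the whole line, as the
    differentiation theorem for primitives requires. *)
Definition truncated := m \_ `[s, t].
Definition primitive y := \int[leb]_(x in `[s, y]) truncated x.

Let mtr : measurable_fun setT (truncated : measurableTypeR R -> measurableTypeR R).
Proof. by apply/(measurable_restrictT m) => //; exact: measurable_funTS. Qed.

Let trB x : `|truncated x| <= B.
Proof. by rewrite /truncated patchE; case: ifP => // _; rewrite normr0. Qed.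

Lemma primitive_derive : {ae leb, forall x, s < x -> x <= t ->
  is_derive x (1 : R) primitive (m x)}.
Proof.
have I : leb.-integrable setT (EFin \o truncated).
  rewrite -restrict_EFin -integrable_mkcond //; exact: bounded_integrable_itv.
have L : locally_integrable setT truncated.
  by apply: open_integrable_locally => //; exact: openT.
have Iy (y : R) : leb.-integrable [set` Interval (BLeft s) (BRight y)] (EFin \o truncated).
  exact: integrableS I.
have := FTC1 Iy L; apply: filterS; first exact: (ae_filter_ringOfSetsType leb).
move=> x h sx xt; have sx' := ltW sx.
have [] := h; first by rewrite lte_fin.
move=> dF vF; have e : truncated x = m x.
  by rewrite /truncated patchE mem_set // /= in_itv /= sx'.
by apply: DeriveDef => //; rewrite -derive1E vF.
Qed.

Lemma primitive_lip u v : s <= u -> u <= v ->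
  `|primitive v - primitive u| <= B * (v - u).
Proof.
move=> su uv; rewrite /primitive Rintegral_itvB ?bnd_simp //; last first.
  exact: (bounded_integrable_itv _ _ mtr trB).
have I : leb.-integrable `]u, v] (EFin \o truncated).
  apply: (integrableS _ _ _ (bounded_integrable_itv u v mtr trB)) => //.
  by apply: subset_itvr; rewrite bnd_simp.
apply: le_trans (le_normr_Rintegral _ I) _ => //.
have -> : B * (v - u) = \int[leb]_(x in `]u, v]) B.
  by rewrite Rintegral_cst // leb_oc.
apply: le_Rintegral => //.
- by have := integrable_abse I; congr integrable.
- apply: (integrableS _ _ _ (bounded_integrable_itv u v (measurable_cst B) (fun=> lexx `|B|))) => //.
  by apply: subset_itvr; rewrite bnd_simp.
Qed.

Lemma primitive_init : primitive s = 0.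
Proof. by rewrite /primitive set_itv1 Rintegral_set1. Qed.

Lemma primitive_end : primitive t = \int[leb]_(x in `[s, t]) m x.
Proof.
by apply: eq_Rintegral => x xst; rewrite /truncated patchE xst.
Qed.

(** Subtracting a primitive of m reduces this to the mean value inequality with
    bound 0. *)
Lemma cac_le_integral d (c : R[i]) (N : set R) :
  absolutely_continuous_on s t d -> leb.-negligible N ->
  (forall r, s <= r -> r <= t -> ~ N r ->
    exists2 l, Re (c * l) <= m r & is_Cderive d r l) ->
  Re (c * (d t - d s)) <= \int[leb]_(x in `[s, t]) m x.
Proof.
move=> acd Nn dd.
pose e r := c * d r - (primitive r)%:C.
have ace : absolutely_continuous_on s t e.
  apply: cacB; first exact: cacZ.
  apply: (@cac_lip _ _ _ _ B) => u v su uv vt.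
  by rewrite -rmorphB ncR; exact: primitive_lip.
have s_null : leb.-negligible [set s].
  by exists [set s]; split=> //; exact: lebesgue_measure_set1.
have := @rac_le _ s t 0 _ _ st (lexx 0) (cac_rac 1 ace) (negligibleU (negligibleU Nn primitive_derive) s_null).
have -> : Re (c * (d t - d s)) = Re (c * d t) - Re (c * d s) by rewrite mulrBr ReB.
have eE : (fun r => Re (1 * e r)) = (fun r => Re (c * d r) - primitive r).
  by apply/funext => r; rewrite mul1r /e ReB.
rewrite eE !mul1r /e !ReB /= primitive_init primitive_end mul0r => h.
suff : Re (c * d t) - \int[leb]_(x in `[s, t]) m x - (Re (c * d s) - 0) <= 0 by lra.
apply: h => r sr rt /not_orP[/not_orP[Nr /contrapT dp] /eqP rs].
have /dp/(_ rt){}dp : s < r by rewrite lt_neqAle eq_sym rs.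
have [l lm dl] := dd r sr rt Nr.
exists (Re (c * l) - m r); first by rewrite subr_le0.
rewrite (_ : (fun r => Re (c * d r) - primitive r) = (fun r => Re (c * d r)) - primitive) //.
by apply: is_deriveB; exact: is_Cderive_Re.
Qed.

End Truncated.

Lemma bounded_cvg_itv (f : nat -> R -> R) (l B s t : R) : s <= t ->
  (forall n, measurable_fun setT (f n : measurableTypeR R -> measurableTypeR R)) ->
  (forall n x, `|f n x| <= B) ->
  (forall x, s <= x -> x <= t -> f n x @[n --> \oo] --> l) ->
  \int[leb]_(x in `[s, t]) f n x @[n --> \oo] --> l * (t - s).
Proof.
move=> st mf fB fl.
have mst : measurable (`[s, t] : set (measurableTypeR R)) by [].
have [|||||_ _] := @dominated_convergence _ _ R leb _ mst (fun n x => (f n x)%:E)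
  (fun _ => l%:E) (fun _ => B%:E).
- by move=> n; apply/measurable_EFinP; exact: (measurable_funTS (mf n)).
- exact: measurable_cst.
- apply/aeW => x; rewrite /= in_itv /= => /andP[sx xt].
  by apply: cvg_EFin; [exact: nearW|exact: fl].
- exact: (bounded_integrable_itv _ _ (measurable_cst B) (fun=> lexx `|B|)).
- by apply/aeW => x n _; rewrite /= lee_fin.
by rewrite integral_cst // leb_cc // => /fine_cvgP[_].
Qed.

End Primitive.

(** * Moments and growth of F-transforms *)

Section MomentsFromTransform.
Variable R : realType.
Implicit Types (mu : prob R) (F : R[i] -> R[i]).

Let inv_n (v : R) : v / n.+1%:R @[n --> \oo] --> (0 : R).
Proof.
by rewrite -[X in _ --> X](mulr0 v); apply: cvgM; [exact: cvg_cst|exact: cvg_harmonic].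
Qed.

Section Bounds.
Variables (mu : prob R) (F : R[i] -> R[i]) (v : R).
Hypothesis v0 : 0 <= v.
Hypothesis FE : forall z, 0 < Im z -> cauchy mu z = (F z)^-1.
Hypothesis FIm : forall z, 0 < Im z -> Im z <= Im (F z).
Hypothesis Fid : forall z, 0 < Im z -> nc (F z - z) <= v / Im z.

Let y n : R := n.+1%:R.
Let a n : R := Re (F (iy R n.+1)).
Let b n : R := Im (F (iy R n.+1)).

Let y1 n : 1 <= y n. Proof. by rewrite ler1n. Qed.
Let yb n : y n <= b n. Proof. exact: (FIm (Im_iy_gt0 R n)). Qed.
Let av n : `|a n| <= v / y n.
Proof.
have := Re_le_nc (F (iy R n.+1) - iy R n.+1); rewrite ReB subr0 => h.
exact: le_trans h (Fid (Im_iy_gt0 R n)).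
Qed.
Let bv n : b n - y n <= v / y n.
Proof.
have := Im_le_nc (F (iy R n.+1) - iy R n.+1); rewrite ImB => h.
by apply: le_trans (le_trans h (Fid (Im_iy_gt0 R n))); exact: ler_norm.
Qed.

Let yb2 n : y n ^+ 2 <= a n ^+ 2 + b n ^+ 2.
Proof.
apply: (@le_trans _ _ (b n ^+ 2)); last by rewrite lerDr sqr_ge0.
have y0 : 0 <= y n by apply: le_trans (y1 n).
by rewrite lerXn2r ?nnegrE // (le_trans y0).
Qed.

(* The quotient y b / |F|^2 tends to 1. *)
Let q_bound n : `|y n * b n / (a n ^+ 2 + b n ^+ 2) - 1| <= (v ^+ 2 + v * (1 + v)) / y n.
Proof.
move: (y1 n) (yb n) (av n) (bv n) (yb2 n).
move: (y n) (a n) (b n) => x p q x1 xq pv qv S.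
have x0 : 0 < x by apply: lt_le_trans x1.
have S0 : 0 < p ^+ 2 + q ^+ 2 by apply: lt_le_trans S; rewrite exprn_gt0.
have -> : x * q / (p ^+ 2 + q ^+ 2) - 1 = - ((p ^+ 2 + q * (q - x)) / (p ^+ 2 + q ^+ 2)).
  by field; rewrite gt_eqF.
have vx : v / x <= v by rewrite ler_pdivrMr // ler_peMr.
have vx0 : 0 <= v / x by rewrite divr_ge0 // ltW.
have p2 : p ^+ 2 <= v ^+ 2.
  rewrite -real_normK ?num_real // lerXn2r ?nnegrE //; exact: le_trans vx.
have q0 : 0 <= q by lra.
have qx : q <= x * (1 + v).
  have : v / x <= v * x by apply: le_trans vx _; rewrite ler_peMr.
  by lra.
have q2 : q * (q - x) <= (1 + v) * v.
  have -> : (1 + v) * v = (x * (1 + v)) * (v / x) by field; rewrite gt_eqF.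
  by apply: ler_pM => //; rewrite subr_ge0.
rewrite normrN ger0_norm; last first.
  by rewrite divr_ge0 ?(ltW S0) // addr_ge0 ?sqr_ge0 // mulr_ge0 // subr_ge0.
rewrite ler_pdivrMr // -mulrA.
apply: (@le_trans _ _ (v ^+ 2 + v * (1 + v))); first by lra.
rewrite ler_peMr ?addr_ge0 ?sqr_ge0 ?mulr_ge0 ?addr_ge0 //.
rewrite ler_pdivlMl // mulr1; apply: le_trans S.
by rewrite expr2 ler_peMr // ltW.
Qed.

Let q_cvg : y n * b n / (a n ^+ 2 + b n ^+ 2) @[n --> \oo] --> (1 : R).
Proof.
apply/cvgrPdist_le => e e0; near=> n; rewrite distrC.
apply: le_trans (q_bound n) _.
have : `|0 - (v ^+ 2 + v * (1 + v)) / n.+1%:R| <= e.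
  by near: n; have /cvgrPdist_le := inv_n (v ^+ 2 + v * (1 + v)); apply.
by rewrite sub0r normrN; apply: le_trans; exact: ler_norm.
Unshelve. all: by end_near. Qed.

Let a2_cvg : y n ^+ 2 * (a n ^+ 2 / (a n ^+ 2 + b n ^+ 2)) @[n --> \oo] --> (0 : R).
Proof.
apply/cvgrPdist_le => e e0; near=> n; rewrite sub0r normrN.
have : `|0 - (v ^+ 2) / n.+1%:R| <= e.
  by near: n; have /cvgrPdist_le := inv_n (v ^+ 2); apply.
rewrite sub0r normrN; apply: le_trans; apply: le_trans (ler_norm _).
move: (y1 n) (av n) (yb2 n); rewrite -/(y n).
move: (y n) (a n) (b n) => x p q x1 pv S.
have x0 : 0 < x by apply: lt_le_trans x1.
have S0 : 0 < p ^+ 2 + q ^+ 2 by apply: lt_le_trans S; rewrite exprn_gt0.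
rewrite ger0_norm; last by rewrite mulr_ge0 ?divr_ge0 ?sqr_ge0 // ltW.
rewrite mulrA ler_pdivrMr //.
have p2 : p ^+ 2 <= v ^+ 2 / x ^+ 2.
  rewrite -real_normK ?num_real // -expr_div_n lerXn2r ?nnegrE //.
  by rewrite divr_ge0 // ltW.
have h : x ^+ 2 * p ^+ 2 <= v ^+ 2.
  by rewrite mulrC -ler_pdivlMr // exprn_gt0.
apply: le_trans h _; rewrite -mulrA ler_peMr ?sqr_ge0 //.
rewrite ler_pdivlMl // mulr1; apply: le_trans S.
by rewrite expr2 ler_peMr // ltW.
Unshelve. all: by end_near. Qed.

(* With F(iy) = a + i b, the quantity that tends to the second moment is a
   vanishing term plus y (b - y) times a factor tending to 1. *)
Let momentE n : n.+1%:R ^+ 2 * (1 + n.+1%:R * Im (cauchy mu (iy R n.+1))) =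
  y n ^+ 2 * (a n ^+ 2 / (a n ^+ 2 + b n ^+ 2)) +
  (y n * (b n - y n)) * (y n * b n / (a n ^+ 2 + b n ^+ 2)).
Proof.
rewrite FE ?Im_iy_gt0 // ImV nc_sq -/(a n) -/(b n) -/(y n).
move: (y1 n) (yb2 n); move: (y n) (a n) (b n) => x p q x1 S.
have x0 : 0 < x by apply: lt_le_trans x1.
have S0 : 0 < p ^+ 2 + q ^+ 2 by apply: lt_le_trans S; rewrite exprn_gt0.
by field; rewrite gt_eqF.
Qed.

(** The second moment is read off the growth of Im F, where F(iy) stays within
    v / y of iy. *)
Lemma second_moment_of_transform :
  n.+1%:R * (Im (F (iy R n.+1)) - n.+1%:R) @[n --> \oo] --> v ->
  (\int[mu]_x (x ^+ 2)%:E)%E = v%:E.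
Proof.
move=> hv; apply: (cvg_unique (@ereal_hausdorff R) (@second_moment_cvg _ mu)).
apply: cvg_EFin; first exact: nearW.
rewrite (_ : _ \o _ = fun n => y n ^+ 2 * (a n ^+ 2 / (a n ^+ 2 + b n ^+ 2)) +
  (y n * (b n - y n)) * (y n * b n / (a n ^+ 2 + b n ^+ 2))).
  by rewrite -[X in _ --> X]add0r -[X in _ --> _ + X]mulr1; apply: cvgD => //; exact: cvgM.
by apply/funext => n /=; exact: momentE.
Qed.

(** The same identity, solved for y (Im F(iy) - y). *)
Lemma transform_of_second_moment :
  (\int[mu]_x (x ^+ 2)%:E)%E = v%:E ->
  n.+1%:R * (Im (F (iy R n.+1)) - n.+1%:R) @[n --> \oo] --> v.
Proof.
move=> hv; have := @second_moment_cvg _ mu; rewrite hv => /fine_cvgP[_].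
rewrite (_ : fine \o _ = fun n => y n ^+ 2 * (a n ^+ 2 / (a n ^+ 2 + b n ^+ 2)) +
  (y n * (b n - y n)) * (y n * b n / (a n ^+ 2 + b n ^+ 2))); last first.
  by apply/funext => n /=; exact: momentE.
move=> /cvgB/(_ a2_cvg) h.
have := cvgM h (cvgV (oner_neq0 R) q_cvg); rewrite subr0 invr1 mulr1 => h'.
have ooF : Filter (nbhs \oo) by exact: _.
apply: cvg_trans (h' ooF ooF); apply: near_eq_cvg; apply: nearW => n /=.
rewrite /GRing.sub_fun /= addrAC subrr add0r -/(y n) -/(b n).
have yn := y1 n; have bn := yb n; have S := yb2 n.
rewrite mulfK //; have x0 : 0 < y n by apply: lt_le_trans yn.
have b0 : 0 < b n by lra.
have S0 : 0 < a n ^+ 2 + b n ^+ 2 by apply: lt_le_trans S; rewrite exprn_gt0.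
by rewrite !mulf_neq0 ?invr_eq0 ?gt_eqF.
Qed.

Lemma integrable_sq : (\int[mu]_x (x ^+ 2)%:E)%E = v%:E ->
  mu.-integrable setT (fun x => (x ^+ 2)%:E) /\ mu.-integrable setT (fun x => x%:E).
Proof.
move=> hv.
have msq : measurable_fun setT ((fun x : R => x ^+ 2) : measurableTypeR R -> measurableTypeR R).
  by apply: continuous_measurable_fun => x; exact: exprn_continuous.
have I2 : mu.-integrable setT (fun x => (x ^+ 2)%:E).
  apply/integrableP; split; first by apply/measurable_EFinP.
  under eq_integral do rewrite gee0_abs ?lee_fin ?sqr_ge0 //.
  by rewrite hv ltry.
split=> //.
have mufin : (mu setT < +oo)%E by rewrite probability_setT ltry.
have I1 := integrableD measurableT (cst_integrable 1 mufin) I2.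
apply: (le_integrable measurableT _ _ I1); first by apply/measurable_EFinP.
move=> x _ /=; rewrite lee_fin [leRHS]ger0_norm ?addr_ge0 ?sqr_ge0 //.
have := normr_ge0 (x : R); have := sqr_ge0 (`|x : R| - 1).
rewrite sqrrB real_normK ?num_real // expr1n mulr1 -[_ *+ 2]mulr_natr; lra.
Qed.

Lemma mean_of_transform : (\int[mu]_x (x ^+ 2)%:E)%E = v%:E ->
  \int[mu]_x x = 0.
Proof.
move=> /integrable_sq[_ I1]; have := mean_cvg I1 => h.
have h0 : n.+1%:R ^+ 2 * Re (cauchy mu (iy R n.+1)) @[n --> \oo] --> (0 : R).
  apply/cvgrPdist_le => e e0; near=> n; rewrite sub0r normrN.
  have : `|0 - v / n.+1%:R| <= e.
    by near: n; have /cvgrPdist_le := inv_n v; apply.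
  rewrite sub0r normrN; apply: le_trans; apply: le_trans (ler_norm _).
  rewrite FE ?Im_iy_gt0 // ReV nc_sq -/(a n) -/(b n) -/(y n).
  move: (y1 n) (av n) (yb2 n); move: (y n) (a n) (b n) => x p q x1 pv S.
  have x0 : 0 < x by apply: lt_le_trans x1.
  have S0 : 0 < p ^+ 2 + q ^+ 2 by apply: lt_le_trans S; rewrite exprn_gt0.
  apply: le_trans pv.
  rewrite normrM (ger0_norm (sqr_ge0 x)) normrM normfV (gtr0_norm S0) mulrA ler_pdivrMr //.
  by rewrite mulrC ler_wpM2l.
have : - (\int[mu]_x x) = 0 by exact: (cvg_unique (@Rhausdorff R) h h0).
by move=> /eqP; rewrite oppr_eq0 => /eqP.
Unshelve. all: by end_near. Qed.

End Bounds.
End MomentsFromTransform.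

Section FlowMoments.
Variable R : realType.
Variables (nu : R -> prob R) (phi : R -> R -> R[i] -> R[i]).
Hypothesis phiP : loewner_solution nu phi.
Hypothesis nuM : measurable_cauchy_family nu.
Variables (s t : R).
Hypotheses (s0 : 0 <= s) (st : s <= t).
Let v := t - s.
Let v0 : 0 <= v. Proof. by rewrite subr_ge0. Qed.
Notation leb := (@lebesgue_measure R).

(* Cut off at negative times, where nothing is assumed on nu. *)
Let m n : R -> R := (fun r => n.+1%:R * - Im (cauchy (nu r) (iy R n.+1))) \_ `[0, +oo[.

Let m_measurable n : measurable_fun setT (m n : measurableTypeR R -> measurableTypeR R).
Proof.
apply/(measurable_restrictT (fun r => n.+1%:R * - Im (cauchy (nu r) (iy R n.+1)))) => //.
have [_ h] := nuM (Im_iy_gt0 R n).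
apply: measurable_funM => //; apply: measurableT_comp => //.
apply: (eq_measurable_fun _ _ h) => r _; by rewrite cauchy_transformE.
Qed.

Let m_bound n r : `|m n r| <= 1.
Proof.
rewrite /m patchE; case: ifP => _; last by rewrite normr0.
have h := nc_cauchy (nu_mass nu r) (Im_iy_gt0 R n) (lexx _).
rewrite mulr1 in h; rewrite normrM normrN ger0_norm ?ler0n //.
rewrite mulrC -ler_pdivlMr ?ltr0n // div1r.
exact: le_trans (Im_le_nc _) h.
Qed.

Let m_cvg r : s <= r -> r <= t -> m n r @[n --> \oo] --> (1 : R).
Proof.
move=> sr rt; have r0 := le_trans s0 sr.
have := eq_ind _ (fun l : \bar R =>
  (n.+1%:R * - Im (cauchy (nu r) (iy R n.+1)))%:E @[n --> \oo] --> l)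
  (mass_cvg (nu_fin nu r)) _ (probability_setT (nu r)) => /fine_cvgP[_].
apply: cvg_trans; apply: near_eq_cvg; apply: nearW => n /=.
by rewrite /m patchE mem_set // /= in_itv /= r0.
Qed.

(** The equation is integrated with the argument of M_r frozen at iy, at the
    cost of an error of order 1/y; there - y Im M_r(iy) is bounded by 1 and
    tends to 1, the mass of nu_r. *)
Lemma flow_Im_growth :
  n.+1%:R * (Im (phi s t (iy R n.+1)) - n.+1%:R) @[n --> \oo] --> v.
Proof.
pose J n := \int[leb]_(r in `[s, t]) m n r.
have Jv : J n @[n --> \oo] --> v.
  by have := bounded_cvg_itv st m_measurable m_bound m_cvg; rewrite mul1r.
have lo n : J n - v ^+ 2 / n.+1%:R <= n.+1%:R * (Im (phi s t (iy R n.+1)) - n.+1%:R).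
  have z0 := Im_iy_gt0 R n; set z := iy R n.+1 in z0 *.
  have zy : Im z = n.+1%:R by [].
  have y0 : 0 < n.+1%:R :> R by rewrite ltr0n.
  have y1 : 1 <= n.+1%:R :> R by rewrite ler1n.
  have := @cac_le_integral _ (fun r => - (m n r - v / n.+1%:R)) (1 + v) s t st _ _ _
    (fun r => phi s r z) ((n.+1%:R)%:C * 'i) (flow_bad nu phi s z).
  have E (w : R[i]) : Re ((n.+1%:R)%:C * 'i * w) = - (n.+1%:R * Im w).
    by rewrite !ReM !ImM /=; ring.
  have IE : \int[leb]_(x in `[s, t]) (- (m n x - v / n.+1%:R)) = - (J n - v ^+ 2 / n.+1%:R).
    have Im1 := bounded_integrable_itv s t (m_measurable n) (m_bound n).
    have Ic := bounded_integrable_itv s t (measurable_cst (v / n.+1%:R)) (fun=> lexx `|v / n.+1%:R|).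
    rewrite (_ : (fun x => _) = (fun x => -1 * (m n x - v / n.+1%:R))); last first.
      by apply/funext => x; rewrite mulN1r.
    rewrite RintegralZl //; last by have := integrableB _ Im1 Ic; apply.
    rewrite RintegralB // Rintegral_cst // (_ : fine _ = v) ?mulN1r; first by rewrite expr2 mulrAC.
    by rewrite [X in fine X](lebesgue_measure_itv) /= lte_fin; case: ltP => // ts; rewrite /v (@le_anti _ _ s t) ?st // subrr.
  rewrite E IE (flow_init phiP) // ImB zy => h.
  rewrite -lerN2; apply: h.
  - by rewrite addr_ge0.
  - by apply: measurableT_comp => //; apply: measurable_funB => //; exact: m_measurable.
  - move=> r; rewrite normrN; apply: le_trans (ler_normB _ _) _; apply: lerD => //.
    by rewrite ger0_norm ?divr_ge0 // ?ler_pdivrMr // ?ler_peMr // ltW.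
  - exact: (flow_ac phiP).
  - exact: (flow_bad_null phiP).
  - move=> r sr rt Nr; have dl := flow_derive sr Nr; exists (- cauchy (nu r) (phi s r z)) => //.
    have r0 := le_trans s0 sr.
    rewrite E lerN2 ImN /m patchE mem_set; last by rewrite /= in_itv /= r0.
    have := cauchy_lip (nu_mass nu r) z0 (lexx _) (flow_Im_ge phiP s0 sr z0).
    move: (flow_sub_id phiP s0 sr z0) => h1 h2.
    have h3 : nc (cauchy (nu r) (phi s r z) - cauchy (nu r) z) <= n.+1%:R ^- 2 * (v / n.+1%:R).
      rewrite nc_distC; apply: le_trans h2 _; rewrite mulr1 zy ler_wpM2l ?invr_ge0 ?sqr_ge0 // nc_distC.
      by apply: le_trans h1 _; rewrite zy ler_wpM2r ?invr_ge0 ?ler0n // lerD2r.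
    have := le_trans (Im_le_nc _) h3; rewrite ImB => /(le_trans (ler_norm _)) h4.
    move: h4 y0 y1 v0; rewrite -/z.
    move: (Im (cauchy (nu r) (phi s r z))) (Im (cauchy (nu r) z)) (n.+1%:R : R) => p q y h4 y0 y1 w0.
    have h5 : y * (p - q) <= v / y.
      apply: (@le_trans _ _ (y * (y ^- 2 * (v / y)))); first by rewrite ler_wpM2l // ltW.
      have -> : y * (y ^- 2 * (v / y)) = (v / y) * y^-1 by field; rewrite gt_eqF.
      by rewrite ler_piMr ?divr_ge0 ?(ltW y0) // invf_le1.
    lra.
have hi n : n.+1%:R * (Im (phi s t (iy R n.+1)) - n.+1%:R) <= v.
  have z0 := Im_iy_gt0 R n; have := flow_sub_id phiP s0 st z0.
  move=> /(le_trans (Im_le_nc _))/(le_trans (ler_norm _)); rewrite ImB /=.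
  by rewrite ler_pdivlMr ?ltr0n // mulrC.
apply: (@squeeze_cvgr _ _ _ _ (fun n => J n - v ^+ 2 / n.+1%:R) (fun=> v)).
- by apply: nearW => n; rewrite lo hi.
- rewrite -[X in _ --> X](subr0 v); apply: cvgB => //.
  by rewrite -[X in _ --> X](mulr0 (v ^+ 2)); apply: cvgM; [exact: cvg_cst|exact: cvg_harmonic].
- exact: cvg_cst.
Qed.

End FlowMoments.

(** * Approximation by Poisson kernels *)

Section PoissonApproximation.
Variable R : realType.
Implicit Types (f : R -> R).

Lemma heine_cantor f (L e : R) : continuous f -> 0 < e ->
  exists2 d : R, 0 < d & forall x y, `|x| <= L -> `|y - x| < d -> `|f y - f x| <= e.
Proof.
move=> fc e0.
have K : compact (`[- L, L] : set R) by exact: segment_compact.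
have e2 : 0 < e / 2 by rewrite divr_gt0.
have /(_ _ _ _ _)H := (compact_near_coveringP _).1 K.
have := H R (0%R)^'+ (fun d x => forall y, `|y - x| < d -> `|f y - f x| <= e) _.
case=> [x xK|].
  have := fc x => /cvgrPdist_le/(_ _ e2)[r /= r0 rP].
  have r2 : 0 < r / 2 by rewrite divr_gt0.
  near=> x' d; move=> /= y yx'.
  have h1 : `|x - x'| < r / 2 by near: x'; exact: nbhsx_ballx.
  have h2 : d <= r / 2 by near: d; exact: nbhs_right_le.
  have xx' := rP x' (lt_le_trans h1 _).
  have xy : `|x - y| < r.
    by have := ler_distD x' x y; rewrite (distrC x' y); lra.
  have := rP _ xy; have := ler_distD (f x) (f y) (f x'); rewrite (distrC (f y) (f x)).
  have : `|f x - f x'| <= e / 2 by apply: xx'; lra.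
  by lra.
move=> d /= d0 dP; exists (d / 2); first by rewrite divr_gt0.
move=> x y xL; apply: dP => /=.
- by rewrite sub0r normrN gtr0_norm ?divr_gt0 //; lra.
- by rewrite divr_gt0.
- by rewrite in_itv /= -ler_norml.
Unshelve. all: by end_near. Qed.

Lemma poisson_sym (x y b : R) : poisson (x +i* b) y = poisson (y +i* b) x.
Proof.
by rewrite !poissonE !nc_sq !ReB !ImB /=; congr (_ / (_ + _)); ring.
Qed.

Section Sum.
Variables (f : R -> R) (M A eta d b : R) (N : nat).
Hypotheses (fM : forall x, `|f x| <= M) (A0 : 0 < A) (eta0 : 0 <= eta)
  (d0 : 0 < d) (b0 : 0 < b) (N0 : (0 < N)%N).
Hypothesis fd : forall x y, `|x| <= A -> `|y - x| < d -> `|f y - f x| <= eta.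
Let L := 2 * A.
Let h := L / N%:R.
Let y k := gridx h N k.
Let w x k := h / pi * poisson (x +i* b) (y k).
Let g x := \sum_(k < N.*2) (f (y k) * (h / pi)) * poisson (y k +i* b) x.
Let W x := \sum_(k < N.*2) w x k.
Let S : R := (2 * L * h) * b ^- 2.

Let M0 : 0 <= M. Proof. exact: le_trans (fM 0). Qed.
Let L0 : 0 < L. Proof. by rewrite mulr_gt0. Qed.
Let NR : 0 < N%:R :> R. Proof. by rewrite ltr0n. Qed.
Let h0 : 0 < h. Proof. by rewrite divr_gt0. Qed.
Let Nh : N%:R * h = L. Proof. by rewrite /h mulrCA divff ?mulr1 // gt_eqF. Qed.
Let hpi : 0 < h / pi. Proof. by rewrite divr_gt0 // pi_gt0. Qed.
Let w0 x k : 0 <= w x k.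
Proof. by rewrite mulr_ge0 ?(ltW hpi) // poisson_ge0. Qed.
Let gE x : g x = \sum_(k < N.*2) f (y k) * w x k.
Proof. by apply: eq_bigr => k _; rewrite /w poisson_sym; ring. Qed.
Let S0 : 0 <= S. Proof. by rewrite !mulr_ge0 ?invr_ge0 ?sqr_ge0 // ltW. Qed.

Let W_sum x : `|pi * W x - (patan (x +i* b) L - patan (x +i* b) (- L))| <= S.
Proof.
have z0 : 0 < Im (x +i* b) by [].
have := poisson_sum N z0 h0; rewrite Nh.
have -> : pi * W x = h * \sum_(k < N.*2) poisson (x +i* b) (y k).
  rewrite /W /w !mulr_sumr; apply: eq_bigr => k _.
  by rewrite [h / pi * _]mulrAC [pi * _]mulrC divfK // gt_eqF // pi_gt0.
move=> /le_trans; apply; rewrite /S /= le_eqVlt; apply/orP; left; apply/eqP.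
by rewrite -Nh; ring.
Qed.

Let W_le x : pi * W x <= pi + S.
Proof.
have := ler_norm (pi * W x - (patan (x +i* b) L - patan (x +i* b) (- L))).
have := W_sum x; rewrite /patan.
have := atan_ltpi2 ((L - Re (x +i* b)) / Im (x +i* b)).
have := atan_gtNpi2 ((- L - Re (x +i* b)) / Im (x +i* b)).
lra.
Qed.

Let W_ge x : `|x| <= A -> 2 * atan (A / b) - S <= pi * W x.
Proof.
rewrite ler_norml => /andP[x1 x2].
have := ler_norm (- (pi * W x - (patan (x +i* b) L - patan (x +i* b) (- L)))).
rewrite normrN; have := W_sum x; rewrite /patan /=.
have -> : (- L - x) / b = - ((L + x) / b) by rewrite -[in RHS]mulNr opprD.
rewrite atanN.
have ib : 0 <= b^-1 by rewrite invr_ge0 ltW.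
have : atan (A / b) <= atan ((L - x) / b).
  by apply: le_atan; rewrite ler_wpM2r // /L; lra.
have : atan (A / b) <= atan ((L + x) / b).
  by apply: le_atan; rewrite ler_wpM2r // /L; lra.
lra.
Qed.

Lemma poisson_sum_bound x : S <= pi -> `|g x| <= 2 * M.
Proof.
move=> Spi; rewrite gE; apply: le_trans (ler_norm_sum _ _ _) _.
apply: (@le_trans _ _ (M * W x)).
  rewrite /W mulr_sumr; apply: ler_sum => k _.
  by rewrite normrM (ger0_norm (w0 x k)) ler_wpM2r.
rewrite mulrC ler_wpM2r // -(ler_pM2l (pi_gt0 R)); apply: le_trans (W_le x) _; lra.
Qed.

(** Far from x the kernel at height b is at most b / (y - x)^2, and the
    oscillation of f at most a multiple of (y - x)^2; near x uniform continuity
    is used, and W x - 1 measures the defect of total mass of the discretised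
    kernel. *)
Lemma poisson_sum_close x : `|x| <= A -> S <= pi ->
  pi * `|g x - f x| <= 2 * pi * eta + 4 * M * L * b / d ^+ 2
    + M * (pi - 2 * atan (A / b) + S).
Proof.
move=> xA Spi.
have -> : g x - f x = \sum_(k < N.*2) (f (y k) - f x) * w x k + f x * (W x - 1).
  rewrite gE mulrBr mulr1 /W mulr_sumr addrA -big_split /=; congr (_ - _).
  by apply: eq_bigr => k _; ring.
have osc v : `|f v - f x| <= eta + 2 * M / d ^+ 2 * (v - x) ^+ 2.
  have p0 : 0 <= 2 * M / d ^+ 2 * (v - x) ^+ 2.
    by rewrite mulr_ge0 ?sqr_ge0 // divr_ge0 ?sqr_ge0 // mulr_ge0.
  have [vd|dv] := ltP `|v - x| d.
    by apply: le_trans (fd xA vd) _; rewrite lerDl.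
  apply: (@le_trans _ _ (2 * M)).
    by apply: le_trans (ler_normB _ _) _; have := fM v; have := fM x; lra.
  apply: (@le_trans _ _ (2 * M / d ^+ 2 * (v - x) ^+ 2)); last by rewrite lerDr.
  rewrite -mulrA ler_peMr ?mulr_ge0 // ler_pdivlMl ?exprn_gt0 // mulr1.
  by rewrite -[leRHS]real_normK ?num_real // lerXn2r ?nnegrE // ltW.
have wb k : w x k * (y k - x) ^+ 2 <= h / pi * b.
  rewrite /w -mulrA ler_wpM2l ?(ltW hpi) // poissonE nc_sq ReB ImB /= subr0.
  have den : 0 < (x - y k) ^+ 2 + b ^+ 2 by rewrite ltr_wpDl ?sqr_ge0 // exprn_gt0.
  by rewrite mulrAC ler_pdivrMr // ler_wpM2l ?(ltW b0) // -sqrrN opprB lerDl sqr_ge0.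
have t1 : `|\sum_(k < N.*2) (f (y k) - f x) * w x k| <=
    eta * W x + 2 * M / d ^+ 2 * (2 * L * b / pi).
  apply: le_trans (ler_norm_sum _ _ _) _.
  have -> : 2 * L * b / pi = \sum_(k < N.*2) (h / pi * b).
    rewrite sumr_const card_ord -[_ *+ N.*2]mulr_natr -addnn natrD -Nh.
    by have := pi_gt0 R; move: (pi : R) => q q0; field; rewrite gt_eqF.
  rewrite /W !mulr_sumr -big_split /=; apply: ler_sum => k _.
  rewrite normrM (ger0_norm (w0 x k)).
  apply: (@le_trans _ _ ((eta + 2 * M / d ^+ 2 * (y k - x) ^+ 2) * w x k)).
    by rewrite ler_wpM2r.
  rewrite mulrDl lerD2l -mulrA ler_wpM2l ?[_ ^+ 2 * _]mulrC //.
  by rewrite divr_ge0 ?sqr_ge0 // mulr_ge0.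
have t2 : `|f x * (W x - 1)| * pi <= M * (pi - 2 * atan (A / b) + S).
  rewrite normrM -mulrA; apply: ler_pM => //; first by rewrite mulr_ge0 // pi_ge0.
  rewrite -{1}(ger0_norm (pi_ge0 R)) -normrM mulrBl mul1r [W x * _]mulrC ler_norml.
  have := W_le x; have := W_ge xA.
  have := atan_ltpi2 (A / b); lra.
have p0 := pi_gt0 R.
rewrite mulrC; apply: (@le_trans _ _ ((eta * W x + 2 * M / d ^+ 2 * (2 * L * b / pi)) * pi + `|f x * (W x - 1)| * pi)).
  rewrite -mulrDl ler_wpM2r ?pi_ge0 //; apply: le_trans (ler_normD _ _) _.
  by rewrite lerD2r.
apply: lerD => //; rewrite mulrDl.
have -> : 2 * M / d ^+ 2 * (2 * L * b / pi) * pi = 4 * M * L * b / d ^+ 2.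
  by move: p0; move: (pi : R) => q q0; field; rewrite !gt_eqF.
rewrite lerD2r -mulrA [W x * _]mulrC.
have := ler_wpM2l eta0 (W_le x); have := ler_wpM2l eta0 Spi; lra.
Qed.

End Sum.

(** The combinations are Riemann sums of the Poisson integral of f at height b
    over [-2 A, 2 A]: b is chosen first, then a mesh that is small compared
    with b^2. *)
Lemma poisson_approx f (M A e : R) : continuous f -> (forall x, `|f x| <= M) ->
  0 < A -> 0 < e ->
  exists (n : nat) (c : nat -> R) (z : nat -> R[i]), (forall k, 0 < Im (z k)) /\
    (forall x, `|x| <= A -> `|\sum_(k < n) c k * poisson (z k) x - f x| <= e) /\
    (forall x, `|\sum_(k < n) c k * poisson (z k) x| <= 2 * M).
Proof.
move=> fc fM A0 e0.
have M0 : 0 <= M by exact: le_trans (fM 0).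
have p0 := pi_gt0 R.
pose q := e * pi / 8.
have q0 : 0 < q by rewrite divr_gt0 ?mulr_gt0.
have eta0 : 0 < e / 8 by rewrite divr_gt0.
have [d d0 dP] := heine_cantor A fc eta0.
pose L := 2 * A.
have [b [b0 b1 b2]] : exists b, [/\ 0 < b, 4 * M * L * b / d ^+ 2 <= q &
    M * (pi - 2 * atan (A / b)) <= q].
  have inv_n : n.+1%:R^-1 @[n --> \oo] --> (0 : R) by exact: cvg_harmonic.
  have c1 : 4 * M * L * n.+1%:R^-1 / d ^+ 2 @[n --> \oo] --> (0 : R).
    have -> : (0 : R) = 4 * M * L * 0 / d ^+ 2 by rewrite mulr0 mul0r.
    by apply: cvgM; [apply: cvgM => //; exact: cvg_cst|exact: cvg_cst].
  have c2 : M * (pi - 2 * atan (A / n.+1%:R^-1)) @[n --> \oo] --> (0 : R).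
    have -> : (0 : R) = M * (pi - 2 * (pi / 2)) by rewrite mulrCA divff // mulr1 subrr mulr0.
    apply: cvgM; first exact: cvg_cst.
    apply: cvgB; first exact: cvg_cst.
    apply: cvgM; first exact: cvg_cst.
    apply: (cvg_comp _ _ _ (@cvgy_atan R)).
    apply/cvgryPge => B; near=> n; rewrite invrK mulrC -ler_pdivrMr //.
    apply: (@le_trans _ _ n%:R); last by rewrite ler_nat.
      by near: n; exact: nbhs_infty_ger.
  near (\oo : set_system nat) => n.
  exists n.+1%:R^-1; split; first by rewrite invr_gt0.
  - apply: le_trans (ler_norm _) _; rewrite -normrN -sub0r.
    by near: n; move/cvgrPdist_le: c1; apply.
  - apply: le_trans (ler_norm _) _; rewrite -normrN -sub0r.
    by near: n; move/cvgrPdist_le: c2; apply.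
have [N [N0 N1 N2]] : exists N, [/\ (0 < N)%N, 2 * L * (L / N%:R) * b ^- 2 <= pi &
    M * (2 * L * (L / N%:R) * b ^- 2) <= q].
  have inv_n : n.+1%:R^-1 @[n --> \oo] --> (0 : R) by exact: cvg_harmonic.
  have c1 : 2 * L * (L / n.+1%:R) * b ^- 2 @[n --> \oo] --> (0 : R).
    have -> : (0 : R) = 2 * L * (L * 0) * b ^- 2 by rewrite !mulr0 mul0r.
    by apply: cvgM; [apply: cvgM; [exact: cvg_cst|apply: cvgM => //; exact: cvg_cst]|exact: cvg_cst].
  have c2 : M * (2 * L * (L / n.+1%:R) * b ^- 2) @[n --> \oo] --> (0 : R).
    by rewrite -[X in _ --> X](mulr0 M); apply: cvgM => //; exact: cvg_cst.
  near (\oo : set_system nat) => n.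
  exists n.+1; split => //.
  - apply: le_trans (ler_norm _) _; rewrite -normrN -sub0r.
    by near: n; move/cvgrPdist_le: c1; apply.
  - apply: le_trans (ler_norm _) _; rewrite -normrN -sub0r.
    by near: n; move/cvgrPdist_le: c2; apply.
exists N.*2, (fun k => f (gridx (L / N%:R) N k) * (L / N%:R / pi)).
exists (fun k => gridx (L / N%:R) N k +i* b); split => //; split => x.
  move=> xA; have := poisson_sum_close fM A0 (ltW eta0) d0 b0 N0 dP xA N1.
  move=> h; rewrite -(ler_pM2l p0); apply: le_trans h _.
  have -> : pi * e = 8 * q by rewrite /q; field.
  have -> : 2 * pi * (e / 8) = 2 * q by rewrite /q; field.
  by move: b1 b2 N2 q0; rewrite -/L !mulrDr; lra.
exact: poisson_sum_bound.
Unshelve. all: by end_near. Qed.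

End PoissonApproximation.

(** * Weak convergence, and the evolution family of a flow *)

Section WeakConvergence.
Variable R : realType.

Lemma integral_poisson_sum (mu : prob R) (c : nat -> R) (z : nat -> R[i]) n :
  (forall k, 0 < Im (z k)) ->
  mu.-integrable setT (EFin \o (fun x => \sum_(k < n) c k * poisson (z k) x)) /\
  \int[mu]_x (\sum_(k < n) c k * poisson (z k) x) =
    \sum_(k < n) c k * - Im (cauchy mu (z k)).
Proof.
move=> z0; have mufin : (mu setT < +oo)%E by rewrite probability_setT ltry.
have I k : mu.-integrable setT (EFin \o (fun x => (- c k) * Im (res (z k) x))).
  have [_ h] := res_cintegrable mufin (z0 k).
  by have := @integrableZl _ _ _ mu setT measurableT (- c k) _ h.
elim: n => [|n [IH1 IH2]].
  under [X in EFin \o X]eq_fun do rewrite big_ord0.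
  under eq_Rintegral do rewrite big_ord0.
  by rewrite big_ord0 Rintegral_cst // mul0r; split => //; exact: cst_integrable.
have E : (fun x => \sum_(k < n.+1) c k * poisson (z k) x) =
  (fun x => \sum_(k < n) c k * poisson (z k) x + (- c n) * Im (res (z n) x)).
  by apply/funext => x; rewrite big_ord_recr /= /poisson; congr (_ + _); rewrite mulNr mulrN.
split.
  rewrite E; have := integrableD measurableT IH1 (I n).
  by congr integrable; apply/funext => x.
rewrite E RintegralD // IH2 big_ord_recr /=; congr (_ + _).
have [_ h] := res_cintegrable mufin (z0 n).
by rewrite RintegralZl // mulNr mulrN.
Qed.

Lemma Rintegral_close (mu : prob R) (f g : R -> R) (e K C : R) : 0 <= K ->
  mu.-integrable setT (EFin \o f) -> mu.-integrable setT (EFin \o g) ->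
  (\int[mu]_x (x ^+ 2)%:E <= C%:E)%E ->
  (forall x, `|f x - g x| <= e + K * x ^+ 2) ->
  `|\int[mu]_x f x - \int[mu]_x g x| <= e + K * C.
Proof.
move=> K0 fi gi m2 fg; have mufin : (mu setT < +oo)%E by rewrite probability_setT ltry.
have m0 : (0 <= \int[mu]_x (x ^+ 2)%:E)%E by apply: integral_ge0 => x _; rewrite lee_fin sqr_ge0.
have fin : (\int[mu]_x (x ^+ 2)%:E)%E \is a fin_num.
  by rewrite ge0_fin_numE // (le_lt_trans m2) // ltry.
have [I2 _] : mu.-integrable setT (fun x => (x ^+ 2)%:E) /\ mu.-integrable setT (fun x => x%:E).
  by apply: (@integrable_sq _ mu (fine (\int[mu]_x (x ^+ 2)%:E)%E)); rewrite fineK.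
rewrite -RintegralB //; apply: le_trans (le_normr_Rintegral _ _) _ => //.
  by have := integrableB measurableT fi gi; congr integrable; apply/funext => x.
have IK : mu.-integrable setT (EFin \o (fun x => K * x ^+ 2)).
  by have := @integrableZl _ _ _ mu setT measurableT K _ I2.
apply: (@le_trans _ _ (\int[mu]_x (e + K * x ^+ 2))).
  apply: le_Rintegral => //.
  - have := integrable_abse (integrableB measurableT fi gi).
    by congr integrable; apply/funext => x.
  - have := integrableD measurableT (cst_integrable e mufin) IK.
    by congr integrable; apply/funext => x.
rewrite RintegralD //; last exact: cst_integrable.
rewrite Rintegral_cst // [X in fine X](@probability_setT _ _ _ mu) mulr1 lerD2l.
rewrite RintegralZl // ler_wpM2l // /Rintegral -lee_fin fineK //.
Qed.

(** A bounded continuous function is a combination of Poisson kernels, whose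
    integrals are imaginary parts of transforms, up to an error that is small on
    [-A, A] and that the second moments control elsewhere. *)
Lemma weak_cvg (F : set_system R) (FF : Filter F) (sig : R -> prob R) (tau : prob R)
    (C : R) (f : R -> R) :
  (forall z, 0 < Im z -> nc (cauchy (sig u) z - cauchy tau z) @[u --> F] --> (0 : R)) ->
  (\forall u \near F, (\int[sig u]_x (x ^+ 2)%:E <= C%:E)%E) ->
  (\int[tau]_x (x ^+ 2)%:E <= C%:E)%E ->
  continuous f -> bounded_fun f ->
  \int[sig u]_x f x @[u --> F] --> \int[tau]_x f x.
Proof.
move=> cz s2 t2 fc [M0 [_ M0P]].
have fM x : `|f x| <= M0 + 1 by apply: M0P => //; rewrite ltrDl.
set M := M0 + 1 in fM.
have M00 : 0 <= M by exact: le_trans (fM 0).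
have C0 : 0 <= C.
  rewrite -lee_fin; apply: le_trans t2; apply: integral_ge0 => x _; rewrite lee_fin sqr_ge0 //.
apply/cvgrPdist_le => e e0.
have e8 : 0 < e / 8 by rewrite divr_gt0.
pose A := 3 * M * C / (e / 8) + 1.
have A1 : 1 <= A by rewrite lerDr divr_ge0 ?mulr_ge0 // ltW.
have A0 : 0 < A by lra.
have [n [c [z [z0 [gA gB]]]]] := poisson_approx fc fM A0 e8.
pose g x := \sum_(k < n) c k * poisson (z k) x.
have gi mu := @integral_poisson_sum mu c z n z0.
have fi (mu : prob R) : mu.-integrable setT (EFin \o f).
  have mf : (mu setT < +oo)%E by rewrite probability_setT ltry.
  have mm : measurable_fun setT (f : measurableTypeR R -> measurableTypeR R).
    exact: continuous_measurable_fun.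
  exact: (bounded_integrable mf mm fM).
have fg x : `|f x - g x| <= e / 8 + (3 * M / A ^+ 2) * x ^+ 2.
  have K0 : 0 <= 3 * M / A ^+ 2 * x ^+ 2.
    by rewrite mulr_ge0 ?sqr_ge0 // divr_ge0 ?sqr_ge0 // mulr_ge0.
  have [xA|Ax] := leP `|x| A.
    by rewrite distrC; apply: le_trans (gA x xA) _; rewrite lerDl.
  apply: (@le_trans _ _ (3 * M)).
    by apply: le_trans (ler_normB _ _) _; have := fM x; have := gB x; rewrite -/(g x); lra.
  apply: (@le_trans _ _ (3 * M / A ^+ 2 * x ^+ 2)); last by rewrite lerDr ltW.
  rewrite -mulrA ler_peMr ?mulr_ge0 // ler_pdivlMl ?exprn_gt0 // mulr1.
  by rewrite -[leRHS]real_normK ?num_real // lerXn2r ?nnegrE ?(ltW A0) // ltW.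
have KA : 3 * M / A ^+ 2 * C <= e / 8.
  rewrite mulrAC ler_pdivrMr ?exprn_gt0 //.
  apply: (@le_trans _ _ (e / 8 * A)).
    by rewrite [e / 8 * A]mulrC -ler_pdivrMr // /A lerDl.
  by rewrite ler_pM2l // expr2 ler_peMr // ltW.
have close (mu : prob R) : (\int[mu]_x (x ^+ 2)%:E <= C%:E)%E ->
    `|\int[mu]_x f x - \int[mu]_x g x| <= e / 4.
  move=> m2; have := Rintegral_close _ (fi mu) (gi mu).1 m2 fg.
  have p0 : 0 <= 3 * M / A ^+ 2 by rewrite divr_ge0 ?sqr_ge0 // mulr_ge0.
  move=> /(_ p0) /le_trans; apply; lra.
have gcv : \int[sig u]_x g x @[u --> F] --> \int[tau]_x g x.
  rewrite (gi tau).2 (_ : (fun u => _) = (fun u => \sum_(k < n) c k * - Im (cauchy (sig u) (z k)))); last first.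
    by apply/funext => u; rewrite (gi (sig u)).2.
  clear - cz FF z0; elim: n => [|m IH].
    by rewrite big_ord0; under eq_fun do rewrite big_ord0; exact: cvg_cst.
  rewrite big_ord_recr; under eq_fun do rewrite big_ord_recr.
  apply: cvgD => //; apply: cvgM; first exact: cvg_cst.
  apply: cvgN; apply/cvgrPdist_le => q q0; near=> u.
  rewrite distrC -ImB; apply: le_trans (Im_le_nc _) _.
  have : `|0 - nc (cauchy (sig u) (z m) - cauchy tau (z m))| <= q.
    by near: u; have /cvgrPdist_le := cz (z m) (z0 m); apply.
  by rewrite sub0r normrN ger0_norm ?nc_ge0.
have e2 : 0 < e / 2 by rewrite divr_gt0.
near=> u.
have h1 := close _ t2.
have h2 : `|\int[sig u]_x f x - \int[sig u]_x g x| <= e / 4.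
  by apply: close; near: u.
have h3 : `|\int[tau]_x g x - \int[sig u]_x g x| <= e / 2.
  by near: u; move/cvgrPdist_le: gcv; apply.
have := ler_distD (\int[tau]_x g x) (\int[tau]_x f x) (\int[sig u]_x f x).
have := ler_distD (\int[sig u]_x g x) (\int[tau]_x g x) (\int[sig u]_x f x).
rewrite (distrC (\int[sig u]_x g x) (\int[sig u]_x f x)).
move: h1 h2 h3; lra.
Unshelve. all: by end_near. Qed.

End WeakConvergence.

Section Dirac.
Variable R : realType.

Definition dirac0 : prob R := @dirac _ (measurableTypeR R) 0 R.

Lemma cauchy_dirac0 z : 0 < Im z -> cauchy dirac0 z = z^-1.
Proof.
move=> z0; have I (h : R -> R) : lipfun h -> \int[dirac0]_x h x = h 0.
  move=> hl; rewrite /Rintegral integral_dirac //; last by apply/measurable_EFinP; exact: lipfun_measurable.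
  by rewrite diracT mul1e.
have [B [_ rL]] := blip_res z0.
have e : res z 0 = z^-1 by rewrite /res subr0.
apply: ceq; rewrite /cauchy /cint /= I ?e //.
- by exists B => x y; rewrite -ReB; apply: le_trans (Re_le_nc _) _.
- by exists B => x y; rewrite -ImB; apply: le_trans (Im_le_nc _) _.
Qed.

End Dirac.

Lemma nc_invB (R : realType) (a b : R[i]) (e : R) : 0 < e -> e <= nc a -> e <= nc b ->
  nc (a^-1 - b^-1) <= e ^- 2 * nc (a - b).
Proof.
move=> e0 ea eb.
have a0 : a != 0 by rewrite -nc_gt0 (lt_le_trans e0).
have b0 : b != 0 by rewrite -nc_gt0 (lt_le_trans e0).
have -> : a^-1 - b^-1 = (a^-1 * b^-1) * (b - a) by field; rewrite a0 b0.
rewrite !ncM [nc (b - a)]nc_distC ler_wpM2r ?nc_ge0 // -exprVn expr2.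
by apply: ler_pM; rewrite ?nc_ge0 // nc_inv_le.
Qed.

Section FlowEvolution.
Variable R : realType.
Variables (nu : R -> prob R) (phi : R -> R -> R[i] -> R[i]).
Hypothesis phiP : loewner_solution nu phi.
Hypothesis nuM : measurable_cauchy_family nu.

Lemma F_transformE (mu : prob R) z : F_transform mu z = (cauchy mu z)^-1.
Proof. by rewrite /F_transform cauchy_transformE div1r. Qed.

(** On the diagonal the Dirac mass is chosen outright, as the transform alone
    would leave its identification to an inversion formula. *)
Lemma flow_sigma : exists sigma : R -> R -> prob R,
  (forall t, sigma t t = dirac0 R) /\
  forall s t, 0 <= s -> s <= t -> forall z, 0 < Im z -> phi s t z = (cauchy (sigma s t) z)^-1.
Proof.
have /choice[sg sgP] (p : R * R) : exists P : prob R, (p.1 = p.2 -> P = dirac0 R) /\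
    (0 <= p.1 -> p.1 <= p.2 -> forall z, 0 < Im z -> phi p.1 p.2 z = (cauchy P z)^-1).
  case: p => s t /=; have [->|neq] := eqVneq s t.
    exists (dirac0 R); split=> // t0 _ z z0.
    by rewrite cauchy_dirac0 // invrK (flow_init phiP).
  have [s0|s0] := leP 0 s; last first.
    by exists (dirac0 R); split=> // s0'; move: (lt_le_trans s0 s0'); rewrite ltxx.
  have [{}st|ts] := leP s t; last first.
    by exists (dirac0 R); split=> // _ st'; move: (lt_le_trans ts st'); rewrite ltxx.
  have [P PP] := flow_F_transform phiP s0 st.
  by exists P; split=> // e; move: neq; rewrite e eqxx.
exists (fun s t => sg (s, t)); split.
  by move=> t; have [-> //] := sgP (t, t).
by move=> s t s0 st z z0; have [_ ->] := sgP (s, t).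
Qed.

Lemma flow_evolution : exists sigma : R -> R -> prob R,
  (forall s t : R, 0 <= s -> s <= t -> is_F_transform (phi s t) (sigma s t)) /\
  normal_monotone_evolution_family sigma.
Proof.
have [sigma [sig0 sigP]] := flow_sigma.
have sigG s t z : 0 <= s -> s <= t -> 0 < Im z -> cauchy (sigma s t) z = (phi s t z)^-1.
  by move=> s0 st z0; rewrite (sigP s t) // invrK.
have m2 s t : 0 <= s -> s <= t -> (\int[sigma s t]_x (x ^+ 2)%:E)%E = (t - s)%:E.
  move=> s0 st; apply: (@second_moment_of_transform _ (sigma s t) (phi s t)).
  - by rewrite subr_ge0.
  - by move=> z z0; rewrite sigG.
  - by move=> z z0; exact: (flow_Im_ge phiP).
  - by move=> z z0; exact: (flow_sub_id phiP).
  - exact: (flow_Im_growth phiP nuM).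
exists sigma; split.
  by move=> s t s0 st z z0; rewrite F_transformE; exact: sigP.
split; first split.
- by move=> t t0 A mA; rewrite sig0.
- move=> s u t s0 su ut z z0; have u0 := le_trans s0 su; have st := le_trans su ut.
  rewrite !F_transformE -!sigP //; first by rewrite (flow_semigroup phiP).
  exact: (flow_Im_gt0 phiP).
- move=> s t s0 st f fc fb.
  apply: (@weak_cvg _ _ _ _ _ (t - s + 1)) => //.
  + move=> z z0; apply/cvgrPdist_le => e e0.
    have q0 : 0 < e * Im z ^+ 3 by rewrite mulr_gt0 // exprn_gt0.
    near=> u; have su : s <= u by near: u; exact: withinT.
    rewrite sub0r normrN ger0_norm ?nc_ge0 // !sigG //.
    have ge w r : s <= r -> 0 < Im w -> Im w <= nc (phi s r w).
      move=> sr w0; apply: le_trans (flow_Im_ge phiP s0 sr w0) _.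
      by apply: le_trans (ler_norm _) _; exact: Im_le_nc.
    apply: le_trans (nc_invB z0 (ge z u su z0) (ge z t st z0)) _.
    have lip : nc (phi s u z - phi s t z) <= (Im z)^-1 * `|t - u|.
      have [ut|tu] := leP u t.
        by rewrite nc_distC ger0_norm ?subr_ge0 //; exact: (flow_lip phiP).
      by rewrite distrC gtr0_norm ?subr_gt0 //; apply: (flow_lip phiP) => //; exact: ltW.
    apply: (@le_trans _ _ (Im z ^- 2 * ((Im z)^-1 * `|t - u|))).
      by rewrite ler_wpM2l // invr_ge0 sqr_ge0.
    have : `|t - u| <= e * Im z ^+ 3.
      near: u; apply: cvg_within; apply: filterS (nbhsx_ballx t _ q0) => v; exact: ltW.
    by rewrite mulrA -invfM -exprSr ler_pdivrMl ?exprn_gt0 // [_ * e]mulrC.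
  + near=> u; have su : s <= u by near: u; exact: withinT.
    rewrite m2 // lee_fin.
    have : `|t - u| <= 1. near: u; apply: cvg_within; apply: filterS (nbhsx_ballx t _ ltr01) => v; exact: ltW.
    by rewrite ler_norml; lra.
  + by rewrite m2 // lee_fin lerDl.
- by move=> s t s0 st; have [] := integrable_sq (m2 s t s0 st).
- by move=> s t s0 st; have [] := integrable_sq (m2 s t s0 st).
- move=> s t s0 st; apply: (@mean_of_transform _ (sigma s t) (phi s t) (t - s)).
  - by move=> z z0; rewrite sigG.
  - by move=> z z0; exact: (flow_Im_ge phiP).
  - by move=> z z0; exact: (flow_sub_id phiP).
  - exact: m2.
- by move=> s t s0 st; rewrite /Rintegral m2.
Unshelve. all: by end_near. Qed.

End FlowEvolution.

(** * F-transforms of centered measures *)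

Section WeightedMeasure.
Variable R : realType.
Variables (mu : prob R) (w : R -> R).
Hypotheses (w0 : forall x, 0 <= w x) (wi : mu.-integrable setT (EFin \o w)).

(** The phantom arguments let the hypotheses serve as data of measure
    instances. *)
Definition weighted of (forall x, 0 <= w x) & mu.-integrable setT (EFin \o w) :
  set (measurableTypeR R) -> \bar R := fun A => (\int[mu]_(x in A) (w x)%:E)%E.
Let rho := weighted w0 wi.

Let rho0 : rho set0 = 0%E. Proof. by rewrite /rho /weighted integral_set0. Qed.
Let rho_ge0 A : (0 <= rho A)%E.
Proof. by apply: integral_ge0 => x _; rewrite lee_fin. Qed.
Let rho_additive : semi_sigma_additive rho.
Proof.
move=> /= A mA tA mUA; rewrite /rho /weighted integral_bigcup //=; last first.
  by apply: (integrableS _ _ (@subsetT _ _) wi).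
apply: is_cvg_ereal_nneg_natsum_cond => n _ _.
by apply: integral_ge0 => /= x ?; rewrite lee_fin.
Qed.
HB.instance Definition _ := isMeasure.Build _ _ _ rho rho0 rho_ge0 rho_additive.

Let rho_fin : fin_num_fun rho.
Proof.
move=> A mA; rewrite ge0_fin_numE //.
have := integrableS measurableT mA (@subsetT _ _) wi => /integrableP[_].
by under eq_integral do rewrite gee0_abs ?lee_fin //.
Qed.
HB.instance Definition _ := Measure_isFinite.Build _ _ _ rho rho_fin.

Let w_measurable : measurable_fun setT (EFin \o w).
Proof. exact: measurable_int wi. Qed.

Let rho_dom : rho `<< mu.
Proof.
apply/null_content_dominatesP => A mA muA0.
apply: null_set_integral => //; exact: measurable_funTS.
Qed.

Let g := Radon_Nikodym_SigmaFinite.f rho mu.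
Let g_ae : ae_eq mu setT g (EFin \o w).
Proof.
apply: integral_ae_eq => //.
- exact: Radon_Nikodym_SigmaFinite.f_integrable.
- by move=> A _ mA; rewrite -Radon_Nikodym_SigmaFinite.f_integral.
Qed.

Let ge0_weighted (f : R -> R) : (forall x, 0 <= f x) ->
  measurable_fun setT (f : measurableTypeR R -> measurableTypeR R) ->
  (\int[rho]_x (f x)%:E = \int[mu]_x (w x * f x)%:E)%E.
Proof.
move=> f0 mf; have mF : measurable_fun setT (EFin \o f : measurableTypeR R -> \bar R).
  exact/measurable_EFinP.
rewrite -(Radon_Nikodym_SigmaFinite.change_of_variables rho_dom _ measurableT mF) //.
have mg : measurable_fun setT g.
  exact: measurable_int (Radon_Nikodym_SigmaFinite.f_integrable rho_dom).
apply: ae_eq_integral => //.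
- exact: emeasurable_funM.
- by under eq_fun do rewrite EFinM; exact: emeasurable_funM.
- apply: filterS g_ae => x gx _.
  by rewrite /= [X in (_ * X)%E](gx I) /= -EFinM mulrC.
Qed.

(** For nonnegative functions this is the change of variables for a
    Radon-Nikodym derivative, here almost everywhere equal to w; a bounded
    function is shifted by its bound. *)
Lemma weighted_measure : exists2 rho : bmeasure R,
  rho setT = (\int[mu]_x (w x)%:E)%E &
  forall (f : R -> R) (B : R),
    measurable_fun setT (f : measurableTypeR R -> measurableTypeR R) ->
    (forall x, `|f x| <= B) ->
    mu.-integrable setT (EFin \o (fun x => w x * f x)) /\
    \int[rho]_x f x = \int[mu]_x (w x * f x).
Proof.
exists rho => // f B mf fB; have B0 : 0 <= B by exact: le_trans (fB 0).
have fB0 x : 0 <= f x + B by have := fB x; rewrite ler_norml => /andP[h _]; lra.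
have mw : measurable_fun setT (w : measurableTypeR R -> measurableTypeR R).
  exact/measurable_EFinP.
have I1 : mu.-integrable setT (EFin \o (fun x => w x * f x)).
  have IB : mu.-integrable setT (EFin \o (fun x => B * w x)).
    by have := @integrableZl _ _ _ mu setT measurableT B _ wi.
  apply: (le_integrable measurableT _ _ IB).
    by apply/measurable_EFinP; exact: measurable_funM.
  move=> x _; rewrite /= lee_fin normrM mulrC [leRHS]ger0_norm ?mulr_ge0 //.
  by rewrite (ger0_norm (w0 x)) ler_wpM2r.
split=> //.
have mfB : measurable_fun setT ((fun x => f x + B) : measurableTypeR R -> measurableTypeR R).
  exact: measurable_funD.
have rfin : (rho setT < +oo)%E by rewrite ltey_eq rho_fin.
have IB : mu.-integrable setT (EFin \o (fun x => B * w x)).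
  by have := @integrableZl _ _ _ mu setT measurableT B _ wi.
have h : \int[rho]_x (f x + B) = \int[mu]_x (w x * (f x + B)).
  by rewrite /Rintegral ge0_weighted.
move: h; rewrite RintegralD //; last 2 first.
- exact: (bounded_integrable rfin mf fB).
- exact: cst_integrable.
rewrite Rintegral_cst // (_ : fine (rho setT) = \int[mu]_x w x) //.
rewrite (_ : (fun x => w x * (f x + B)) = (fun x => w x * f x + B * w x)); last first.
  by apply/funext => x; ring.
by rewrite RintegralD // RintegralZl // => /addIr.
Qed.

End WeightedMeasure.

(** Integrated in a and k, and optimised over la, this is the Cauchy-Schwarz
    inequality. *)
Lemma amgm (R : realType) (la a k : R) : 0 < la ->
  a * k <= la / 2 * a ^+ 2 + (2 * la)^-1 * k ^+ 2.
Proof.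
move=> la0; rewrite -subr_ge0.
have -> : la / 2 * a ^+ 2 + (2 * la)^-1 * k ^+ 2 - a * k = (2 * la)^-1 * (la * a - k) ^+ 2.
  by field; rewrite gt_eqF.
by rewrite mulr_ge0 ?sqr_ge0 // invr_ge0 mulr_ge0 // ltW.
Qed.

Section CenteredTransform.
Variable R : realType.
Variables (mu : prob R) (v : R).
Hypotheses (I1 : mu.-integrable setT (fun x => x%:E))
  (I2 : mu.-integrable setT (fun x => (x ^+ 2)%:E))
  (mean0 : \int[mu]_x x = 0) (var : \int[mu]_x (x ^+ 2) = v).
Notation G := (cauchy mu).
Let mufin : (mu setT < +oo)%E. Proof. by rewrite probability_setT ltry. Qed.
Let cstE (c : R) : \int[mu]_x c = c.
Proof. by rewrite Rintegral_cst // [X in fine X](@probability_setT _ _ _ mu) mulr1. Qed.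

Let xZ (c : R) : mu.-integrable setT (EFin \o (fun x => c * x)).
Proof. by have := @integrableZl _ _ _ mu setT measurableT c _ I1. Qed.
Let x2Z (c : R) : mu.-integrable setT (EFin \o (fun x => c * x ^+ 2)).
Proof. by have := @integrableZl _ _ _ mu setT measurableT c _ I2. Qed.
Let iD (f g : R -> R) : mu.-integrable setT (EFin \o f) ->
  mu.-integrable setT (EFin \o g) -> mu.-integrable setT (EFin \o (fun x => f x + g x)).
Proof. by move=> fi gi; have := integrableD measurableT fi gi. Qed.
Let iZ (c : R) (f : R -> R) : mu.-integrable setT (EFin \o f) ->
  mu.-integrable setT (EFin \o (fun x => c * f x)).
Proof. by move=> fi; have := @integrableZl _ _ _ mu setT measurableT c _ fi. Qed.

(* The variance of the resolvent under mu. *)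
Let Q z := - Im (G z) / Im z - nc (G z) ^+ 2.
Let q z x := nc (res z x - G z) ^+ 2.

Let qE z x : 0 < Im z -> q z x = - (Im z)^-1 * Im (res z x) +
  (- (2 * Re (G z)) * Re (res z x) + (- (2 * Im (G z)) * Im (res z x) + nc (G z) ^+ 2)).
Proof.
move=> z0; have e : - (Im z)^-1 * Im (res z x) = nc (res z x) ^+ 2.
  by rewrite Im_res /res ncV mulrNN exprVn mulrA mulVf ?mul1r // gt_eqF.
by rewrite e /q !nc_sq ReB ImB; ring.
Qed.

Let q_int z : 0 < Im z -> mu.-integrable setT (EFin \o q z) /\ \int[mu]_x q z x = Q z.
Proof.
move=> z0; have [Ir Ii] := res_cintegrable mufin z0.
have -> : q z = (fun x => - (Im z)^-1 * Im (res z x) +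
  (- (2 * Re (G z)) * Re (res z x) + (- (2 * Im (G z)) * Im (res z x) + nc (G z) ^+ 2))).
  by apply/funext => x; exact: qE.
have Ic := cst_integrable (nc (G z) ^+ 2) mufin.
have J1 := iD (iZ (- (2 * Im (G z))) Ii) Ic.
have J2 := iD (iZ (- (2 * Re (G z))) Ir) J1.
have J3 := iD (iZ (- (Im z)^-1) Ii) J2.
split=> //; rewrite (RintegralD measurableT (iZ _ Ii) J2) (RintegralD measurableT (iZ _ Ir) J1).
rewrite (RintegralD measurableT (iZ _ Ii) Ic) cstE !RintegralZl //.
rewrite -[\int[mu]_x Im (res z x)]/(Im (G z)) -[\int[mu]_x Re (res z x)]/(Re (G z)).
by rewrite /Q !nc_sq; field; rewrite gt_eqF.
Qed.

Let Q_ge0 z : 0 < Im z -> 0 <= Q z.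
Proof.
by move=> z0; rewrite -(q_int z0).2; apply: Rintegral_ge0 => x _; exact: sqr_ge0.
Qed.

(** The imaginary part of the resolvent is negative everywhere. *)
Lemma cauchy_neq0 z : 0 < Im z -> G z != 0.
Proof.
move=> z0; apply/eqP => g0.
have [Ir Ii] := res_cintegrable mufin z0.
have : (\int[mu]_x (- Im (res z x))%:E = 0)%E.
  have I : mu.-integrable setT (EFin \o (fun x => -1 * Im (res z x))) by exact: iZ.
  have : \int[mu]_x (-1 * Im (res z x)) = 0.
    rewrite RintegralZl // -[\int[mu]_x Im (res z x)]/(Im (G z)) g0 mulr0 //.
  rewrite /Rintegral => h; rewrite (_ : (fun x => _) = EFin \o (fun x => -1 * Im (res z x))).
    by rewrite -[LHS]fineK ?h //; exact: integrable_fin_num.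
  by apply/funext => x; rewrite /= mulN1r.
have mi : measurable_fun setT (fun x : measurableTypeR R => (- Im (res z x))%:E).
  have I : mu.-integrable setT (EFin \o (fun x => -1 * Im (res z x))) by exact: iZ.
  have := measurable_int mu I; congr measurable_fun.
  by apply/funext => x; rewrite /= mulN1r.
move=> h; have : (\int[mu]_x `|(- Im (res z x))%:E| = 0)%E.
  rewrite -h; apply: eq_integral => x _; rewrite gee0_abs // lee_fin oppr_ge0.
  by apply: Im_res_le0; exact: ltW.
move=> /(ae_eq_integral_abs mu measurableT mi).1 [N [mN N0 NN]].
have : mu setT = 0%E.
  apply/eqP; rewrite eq_le measure_ge0 andbT -N0.
  apply: le_measure; rewrite ?inE //.
  move=> x _; apply: NN => /= /(_ I) -[] /eqP; rewrite oppr_eq0 Im_res oppr_eq0.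
  by rewrite mulf_eq0 invr_eq0 sqrf_eq0 gt_eqF //= gt_eqF // nc_gt0 resolvent_neq0.
by rewrite probability_setT => /eqP; rewrite onee_eq0.
Qed.

Let F z := (G z)^-1.

(** This says that the variance of the resolvent is nonnegative. *)
Lemma transform_Im z : 0 < Im z -> Im z <= Im (F z).
Proof.
move=> z0; have := Q_ge0 z0; have g0 := cauchy_neq0 z0.
have n0 : 0 < nc (G z) ^+ 2 by rewrite exprn_gt0 // nc_gt0.
rewrite /F ImV /Q subr_ge0 -mulNr ler_pdivlMr // ler_pdivlMr //.
by rewrite mulrC.
Qed.

Let xC_int (c : R[i]) : cintegrable mu (fun x : R => x%:C * c) /\
  cint mu (fun x : R => x%:C * c) = 0.
Proof.
case: c => p r.
have e1 : (fun x : R => Re (x%:C * (p +i* r))) = (fun x => p * x).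
  by apply/funext => x; rewrite ReM /=; ring.
have e2 : (fun x : R => Im (x%:C * (p +i* r))) = (fun x => r * x).
  by apply/funext => x; rewrite ImM /=; ring.
split; first by split; rewrite ?e1 ?e2; exact: xZ.
by rewrite /cint e1 e2 !RintegralZl // mean0 !mulr0.
Qed.

Let c_int (c : R[i]) : cintegrable mu (fun _ : R => c) /\ cint mu (fun _ : R => c) = c.
Proof.
split; first by split; exact: cst_integrable.
by apply: ceq => /=; rewrite cstE.
Qed.

(* Since x is centered, subtracting G from the resolvent changes nothing. *)
Let zG z : 0 < Im z -> z * G z - 1 = cint mu (fun x => x%:C * (res z x - G z)).
Proof.
move=> z0; have rI := res_cintegrable mufin z0.
have E : (fun x => x%:C * (res z x - G z)) = (fun x => (z * res z x + (- 1)) + x%:C * (- G z)).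
  apply/funext => x; have h := resolvent_neq0 x z0; rewrite /res.
  by field; rewrite h.
have [C1 E1] := c_int (-1); have [C2 E2] := xC_int (- G z).
rewrite E (cintD (cintegrableD (cintegrableZ z rI) C1) C2) (cintD (cintegrableZ z rI) C1).
by rewrite (cintZ z rI) E1 E2 addr0.
Qed.

(** Cauchy-Schwarz in the integral of x (res z x - G) gives
    |G|^2 |F - z|^2 <= v Q, while Q = |G|^2 (Im F - Im z) / Im z by its
    definition; hence |F - z|^2 <= (v / Im z) |F - z|. *)
Lemma transform_sub_id z : 0 < Im z -> nc (F z - z) <= v / Im z.
Proof.
move=> z0; have g0 := cauchy_neq0 z0; set b := Im z in z0 *.
have n0 : 0 < nc (G z) by rewrite nc_gt0.
set D := nc (F z - z).
have GD : nc (z * G z - 1) = nc (G z) * D.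
  by rewrite /D nc_distC -ncM; congr nc; rewrite mulrBr /F mulfV // mulrC.
have QD : Q z <= nc (G z) ^+ 2 * D / b.
  have e : Q z = nc (G z) ^+ 2 * (Im (F z) - b) / b.
    rewrite /Q /F ImV -/b; move: n0; move: (nc (G z)) => g n0; field.
    by rewrite !gt_eqF.
  rewrite e ler_wpM2r ?invr_ge0 ?(ltW z0) // ler_wpM2l ?sqr_ge0 //.
  by rewrite /D -ImB; apply: le_trans (ler_norm _) (Im_le_nc _).
(* The optimal weight when D = v / b, the extremal case. *)
pose la := nc (G z) / b.
have la0 : 0 < la by rewrite divr_gt0.
have [qi qE'] := q_int z0.
have cs : nc (z * G z - 1) <= (la / 2) * v + (2 * la)^-1 * Q z.
  rewrite (zG z0) -var -qE'.
  have h1 := iZ (la / 2) I2; have h2 := iZ (2 * la)^-1 qi.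
  rewrite -(RintegralZl (la / 2) measurableT I2) -(RintegralZl (2 * la)^-1 measurableT qi).
  rewrite -(RintegralD measurableT h1 h2).
  have rI := res_cintegrable mufin z0.
  apply: nc_cint.
  - have [C1 _] := c_int (-1); have [C2 _] := xC_int (- G z).
    have := cintegrableD (cintegrableD (cintegrableZ z rI) C1) C2.
    congr cintegrable; apply/funext => x; have h := resolvent_neq0 x z0; rewrite /res.
    by field; rewrite h.
  - exact: iD.
  - move=> x; rewrite ncM ncR /q -(real_normK (num_real x)); exact: amgm.
have : nc (G z) * D <= nc (G z) * ((v / b + D) / 2).
  rewrite -GD; apply: le_trans cs _.
  apply: (@le_trans _ _ (la / 2 * v + (2 * la)^-1 * (nc (G z) ^+ 2 * D / b))).
    by rewrite lerD2l ler_wpM2l // invr_ge0 mulr_ge0 // ltW.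
  rewrite le_eqVlt /la; apply/orP; left; apply/eqP.
  by field; rewrite !gt_eqF.
by rewrite ler_pM2l //; lra.
Qed.

(** The measure is x^2 mu(dx) / v. Dividing, x^2 / (z - x) = z^2 / (z - x) - z - x,
    where the last term has integral 0. *)
Lemma centered_measure : 0 < v -> exists2 rho : bmeasure R, rho setT = 1%E &
  forall z, 0 < Im z -> cauchy rho z = (v^-1)%:C * (z * (z * G z - 1)).
Proof.
move=> vp; have vi : 0 <= v^-1 by rewrite invr_ge0 ltW.
pose w (x : R) := v^-1 * x ^+ 2.
have w0 x : 0 <= w x by rewrite mulr_ge0 ?sqr_ge0.
have [rho rhoT rhoI] := weighted_measure w0 (x2Z v^-1).
exists rho.
  rewrite rhoT -[LHS]fineK; last exact: integrable_fin_num (x2Z v^-1).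
  by rewrite -[fine _]/(\int[mu]_x (v^-1 * x ^+ 2)) RintegralZl // var mulVf // gt_eqF.
move=> z z0; have rI := res_cintegrable mufin z0.
have [B [rB rL]] := blip_res z0.
have bR x : `|Re (res z x)| <= B by apply: le_trans (Re_le_nc _) _.
have bI x : `|Im (res z x)| <= B by apply: le_trans (Im_le_nc _) _.
have mR : measurable_fun setT ((fun x => Re (res z x)) : measurableTypeR R -> measurableTypeR R).
  by apply: lipfun_measurable; exists B => x y; rewrite -ReB; apply: le_trans (Re_le_nc _) _.
have mI : measurable_fun setT ((fun x => Im (res z x)) : measurableTypeR R -> measurableTypeR R).
  by apply: lipfun_measurable; exists B => x y; rewrite -ImB; apply: le_trans (Im_le_nc _) _.
have E : cauchy rho z = cint mu (fun x => (w x)%:C * res z x).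
  rewrite /cauchy /cint (rhoI _ B mR bR).2 (rhoI _ B mI bI).2.
  by apply: ceq; apply: eq_Rintegral => x _; rewrite ?ReM ?ImM /=; ring.
have E2 : (fun x => (w x)%:C * res z x) =
    (fun x => (v^-1)%:C * (z ^+ 2 * res z x + - z + x%:C * (-1))).
  apply/funext => x; have h := resolvent_neq0 x z0; rewrite /res /w rmorphM rmorphXn /=.
  by move: (v^-1)%:C x%:C h => c y h; field; rewrite h.
have [C1 E1] := c_int (- z); have [C2 E2'] := xC_int (-1).
rewrite E E2 (cintZ _ (cintegrableD (cintegrableD (cintegrableZ _ rI) C1) C2)).
rewrite (cintD (cintegrableD (cintegrableZ _ rI) C1) C2) (cintD (cintegrableZ _ rI) C1).
by rewrite (cintZ _ rI) E1 E2'; congr (_ * _); rewrite -/(cauchy mu z); ring.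
Qed.

End CenteredTransform.

(** * Almost everywhere differentiability of Lipschitz functions *)

Section Stieltjes.
Variable R : realType.
Notation leb := (@lebesgue_measure R).

Lemma is_derive_cvg (f : R -> R) x l :
  h^-1 *: (f (h *: (1 : R) + x) - f x) @[h --> 0^'] --> l -> is_derive x (1 : R) f l.
Proof.
move=> h; apply: DeriveDef; first by apply/cvg_ex; exists l.
by apply/cvg_lim.
Qed.

Lemma is_derive_near (f g : R -> R) x l r : 0 < r ->
  (forall y, `|y - x| < r -> g y - g x = f y - f x) ->
  is_derive x (1 : R) f l -> is_derive x (1 : R) g l.
Proof.
move=> r0 fg [df vf]; apply: is_derive_cvg.
have fl : h^-1 *: (f (h *: (1 : R) + x) - f x) @[h --> 0^'] --> l.
  by rewrite -vf; exact: df.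
apply: cvg_trans fl; apply: near_eq_cvg; near=> h.
rewrite fg // addrK scaler1.
have : `|0 - h| < r by near: h; apply: (cvg_within (F := nbhs (0 : R))); exact: nbhsx_ballx.
by rewrite sub0r normrN.
Unshelve. all: by end_near. Qed.

Section Measure.
Variables (f : R -> R) (K : R).
Hypotheses (f_mono : forall x y, x <= y -> f x <= f y)
  (fK : forall x y, `|f x - f y| <= K * `|x - y|).

(** The phantom arguments let the hypotheses serve as data of a cumulative
    instance. *)
Definition lip_mono of (forall x y, x <= y -> f x <= f y)
  & (forall x y, `|f x - f y| <= K * `|x - y|) := f.
Let g := lip_mono f_mono fK.
Let g_right x : g y @[y --> x^'+] --> g x.
Proof.
apply: cvg_within_filter; apply: (@lipfun_continuous _ f).
by exists K.
Qed.
HB.instance Definition _ := isCumulative.Build R _ R g (fun x y => @f_mono x y) g_right.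

Lemma stieltjes_exists : exists mu : {sigma_finite_measure set (measurableTypeR R) -> \bar R},
  forall x y, x <= y -> mu `]x, y]%classic = (f y - f x)%:E.
Proof.
exists (lebesgue_stieltjes_measure (g : cumulative R R)) => x y xy.
rewrite /= /lebesgue_stieltjes_measure /measure_extension measurable_mu_extE /=; last exact: is_ocitv.
by rewrite wlength_itv_bnd.
Qed.

End Measure.

(** The Stieltjes measures of f and of K x - f add up to K times Lebesgue
    measure, so that of f has a density, and the differentiation theorem for
    primitives applies to this density. *)
Lemma mono_lipschitz_derivable (f : R -> R) (K : R) : 0 < K ->
  (forall x y, x <= y -> f x <= f y) ->
  (forall x y, x <= y -> f y - f x <= K * (y - x)) ->
  {ae leb, forall x, exists l, is_derive x (1 : R) f l}.
Proof.
move=> K0 fm fK; have Ki : 0 <= K^-1 by rewrite invr_ge0 ltW.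
have K2 : 0 <= 2 * K by rewrite mulr_ge0 // ltW.
have fL x y : `|f x - f y| <= (2 * K) * `|x - y|.
  wlog xy : x y / x <= y.
    by move=> h; case/orP: (le_total x y) => xy; [|rewrite distrC (distrC x)]; exact: h.
  rewrite distrC (distrC x) !ger0_norm ?subr_ge0 ?fm //.
  by apply: le_trans (fK _ _ xy) _; rewrite ler_wpM2r ?subr_ge0 //; lra.
pose f' x := K * x - f x.
have fm' x y : x <= y -> f' x <= f' y.
  by move=> xy; have := fK _ _ xy; rewrite /f'; lra.
have fL' x y : `|f' x - f' y| <= (2 * K) * `|x - y|.
  wlog xy : x y / x <= y.
    by move=> h; case/orP: (le_total x y) => xy; [|rewrite distrC (distrC x)]; exact: h.
  rewrite distrC (distrC x) !ger0_norm ?subr_ge0 ?fm' //.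
  have h : 0 <= K * (y - x) by rewrite mulr_ge0 ?(ltW K0) // subr_ge0.
  by have := fm _ _ xy; rewrite /f'; lra.
have [mu muE] := stieltjes_exists fm fL.
have [mu' muE'] := stieltjes_exists fm' fL'.
pose la : bmeasure R := mscale (NngNum Ki) (measure_add mu mu').
have laD B : la B = (K^-1%:E * (mu B + mu' B))%E by rewrite -measure_addE.
have laE A : measurable A -> leb A = la A.
  apply: lebesgue_measure_unique => X [[a b]] _ <-.
  rewrite laD; have [ab|ba] := leP a b.
    rewrite muE // muE' // -EFinD -EFinM lebesgue_measure_itv /= lte_fin.
    case: ltP => h; congr EFin.
      by rewrite /f'; field; rewrite gt_eqF.
    by rewrite /f' (@le_anti _ _ a b) ?ab // !subrr addr0 mulr0.
  rewrite set_itv_ge ?bnd_simp -?leNgt ?ltW // !measure0 //.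
  by rewrite adde0 mule0.
have dom : mu `<< leb.
  apply/null_content_dominatesP => A mA.
  move=> A0; have : la A = 0%E by rewrite -(laE _ mA).
  rewrite laD => /eqP; rewrite mule_eq0 eqe invr_eq0 gt_eqF //= padde_eq0 ?measure_ge0 //.
  by case/andP => /eqP.
have key (n : nat) : leb.-negligible [set x | `|x| < n%:R /\ ~ exists l, is_derive x (1 : R) f l].
  pose D : set (measurableTypeR R) := `]- n%:R, n%:R]%classic.
  have mD : measurable D by exact: measurable_itv.
  have nn : - n%:R <= n%:R :> R by have := ler0n R n; lra.
  have Dfin : (mu D < +oo)%E by rewrite /D muE // ltry.
  pose rho := mfrestr mD Dfin.
  have rdom : rho `<< leb.
    apply/null_content_dominatesP => A mA A0; rewrite /rho /= /mfrestr /= /mrestr.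
    apply/eqP; rewrite eq_le measure_ge0 andbT.
    have <- : mu A = 0%E by move/null_content_dominatesP: dom; apply.
    by apply: le_measure; rewrite ?inE //; exact: measurableI.
  have [g [g0 gfin gi gE]] := radon_nikodym_sigma_finite rdom.
  pose w x := fine (g x).
  have wE : EFin \o w = g by apply/funext => x; rewrite /= fineK.
  have wi : leb.-integrable setT (EFin \o w) by rewrite wE.
  have wloc : locally_integrable setT w by apply: open_integrable_locally => //; exact: openT.
  have wy y : leb.-integrable `]-oo, y] (EFin \o w) by exact: integrableS wi.
  have := FTC1Ny wy wloc; set F := fun x => _ => Fd.
  have FE x y : `|x| < n%:R -> `|y| < n%:R -> x <= y -> F y - F x = f y - f x.
    move=> xn yn xy; rewrite /F Rintegral_itvB ?bnd_simp //.
    have mxy : measurable (`]x, y] : set (measurableTypeR R)) by exact: measurable_itv.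
    have := gE _ mxy; rewrite /rho /= /mfrestr /= /mrestr setIidl; last first.
      move=> z /=; rewrite /D /= !in_itv /= => /andP[xz zy].
      move: xn yn; rewrite !ltr_norml => /andP[a1 _] /andP[_ a2].
      by rewrite (lt_trans a1 xz) (le_trans zy (ltW a2)).
    rewrite muE // => h; rewrite /Rintegral (_ : (fun z => _) = g) -?h //.
  case: Fd => N [mN N0 NN]; exists N; split => // x /= [xn nd]; apply: NN => /= -[dF _].
  apply: nd; exists ('D_1 F x).
  apply: (@is_derive_near F f x _ (n%:R - `|x|)).
  - by rewrite subr_gt0.
  - move=> y yx; have yn : `|y| < n%:R.
      by have := ler_normD (y - x) x; rewrite subrK; move: yx; lra.
    have [xy|/ltW yx'] := leP x y; first by rewrite FE.
    by apply: oppr_inj; rewrite !opprB FE.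
  - exact: DeriveDef.
have : leb.-negligible (\bigcup_n [set x | `|x| < n%:R /\ ~ exists l, is_derive x (1 : R) f l]).
  by apply: negligible_bigcup => n; exact: key.
apply: negligibleS => x /= nd; exists (Num.bound `|x|) => //=; split => //.
by apply: archi_boundP.
Qed.

Lemma lipschitz_derivable (f : R -> R) (K : R) : 0 <= K ->
  (forall x y, x <= y -> `|f y - f x| <= K * (y - x)) ->
  {ae leb, forall x, exists l, is_derive x (1 : R) f l}.
Proof.
move=> K0 fK; pose K1 := K + 1.
have K1p : 0 < K1 by rewrite ltr_wpDl.
pose g x := f x + K1 * x.
have gm x y : x <= y -> g x <= g y.
  move=> xy; have := fK _ _ xy; rewrite ler_norml => /andP[h _].
  by rewrite /g /K1; move: xy; rewrite -subr_ge0; lra.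
have gK x y : x <= y -> g y - g x <= (2 * K1) * (y - x).
  move=> xy; have := fK _ _ xy; rewrite ler_norml => /andP[_ h].
  by rewrite /g /K1; move: xy; rewrite -subr_ge0; lra.
have K2 : 0 < 2 * K1 by rewrite mulr_gt0.
have aeF : Filter (nbhs (almost_everywhere leb)) := ae_filter_ringOfSetsType leb.
have := mono_lipschitz_derivable K2 gm gK.
apply: filterS => x [l dl]; exists (l - K1).
have d2 : is_derive x (1 : R) (fun x => K1 * x) K1.
  by have := is_deriveZ K1 (is_derive_id x (1 : R)); rewrite /GRing.scale /= mulr1.
have := is_deriveB dl d2; congr is_derive.
by apply/funext => y; rewrite /g /=; rewrite -[(_ - _) y]/(f y + K1 * y - K1 * y) addrK.
Qed.

(** The path is extended to the left of s by its value there. *)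
Lemma lipschitz_Cderivable (d : R -> R[i]) (s K : R) : 0 <= K ->
  (forall x y, s <= x -> x <= y -> nc (d y - d x) <= K * (y - x)) ->
  {ae leb, forall x, s < x -> exists l, is_Cderive d x l}.
Proof.
move=> K0 dK; pose c x := Num.max s x.
have cm x y : x <= y -> c x <= c y /\ c y - c x <= y - x.
  by move=> xy; rewrite /c !maxEle; do !case: ifP => //; lra.
have cs x : s <= c x by rewrite /c le_max lexx.
have L x y : x <= y -> nc (d (c y) - d (c x)) <= K * (y - x).
  by move=> xy; have [h1 h2] := cm _ _ xy; apply: le_trans (dK _ _ (cs x) h1) _; rewrite ler_wpM2l.
have h1 := @lipschitz_derivable (fun x => Re (d (c x))) K K0 (fun x y xy =>
  le_trans (eq_ind _ (fun y => `|y| <= _) (Re_le_nc _) _ (ReB _ _)) (L x y xy)).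
have h2 := @lipschitz_derivable (fun x => Im (d (c x))) K K0 (fun x y xy =>
  le_trans (eq_ind _ (fun y => `|y| <= _) (Im_le_nc _) _ (ImB _ _)) (L x y xy)).
have aeF : Filter (nbhs (almost_everywhere leb)) := ae_filter_ringOfSetsType leb.
apply: filterS2 h1 h2 => x [l1 d1] [l2 d2] sx; exists (l1 +i* l2).
have r0 : 0 < x - s by rewrite subr_gt0.
have ce y : `|y - x| < x - s -> c y = y.
  rewrite ltr_norml => /andP[h _]; rewrite /c; apply/max_idPr; lra.
have cx : c x = x by apply: ce; rewrite subrr normr0.
by split; [apply: is_derive_near r0 _ d1|apply: is_derive_near r0 _ d2] => y yx; rewrite ce ?cx.
Qed.

End Stieltjes.

(** * Increments of a normal evolution family *)

Section Evolution.
Variable R : realType.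
Variables (sigma : R -> R -> prob R) (phi : R -> R -> R[i] -> R[i]).
Hypothesis sigN : normal_monotone_evolution_family sigma.
Hypothesis phiF : forall s t : R, 0 <= s -> s <= t -> is_F_transform (phi s t) (sigma s t).
Implicit Types (s t u : R) (z w : R[i]).

Lemma evolE s t z : 0 <= s -> s <= t -> 0 < Im z -> phi s t z = (cauchy (sigma s t) z)^-1.
Proof. by move=> s0 st z0; rewrite (phiF s0 st z0) F_transformE. Qed.

Lemma evol_cauchy s t z : 0 <= s -> s <= t -> 0 < Im z ->
  cauchy (sigma s t) z = (phi s t z)^-1.
Proof. by move=> s0 st z0; rewrite evolE // invrK. Qed.

Lemma evol_Im_ge s t z : 0 <= s -> s <= t -> 0 < Im z -> Im z <= Im (phi s t z).
Proof.
move=> s0 st z0; rewrite evolE //.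
by apply: (transform_Im _ z0).
Qed.

Lemma evol_Im_gt0 s t z : 0 <= s -> s <= t -> 0 < Im z -> 0 < Im (phi s t z).
Proof. by move=> s0 st z0; exact: lt_le_trans (evol_Im_ge s0 st z0). Qed.

Lemma evol_nc_ge s t z : 0 <= s -> s <= t -> 0 < Im z -> Im z <= nc (phi s t z).
Proof.
move=> s0 st z0; apply: le_trans (evol_Im_ge s0 st z0) _.
by apply: le_trans (ler_norm _) _; exact: Im_le_nc.
Qed.

Lemma evol_sub_id s t z : 0 <= s -> s <= t -> 0 < Im z ->
  nc (phi s t z - z) <= (t - s) / Im z.
Proof.
move=> s0 st z0; rewrite evolE //; apply: transform_sub_id z0.
- exact: (normal_moment1 sigN s0 st).
- exact: (normal_moment2 sigN s0 st).
- exact: (normal_mean sigN s0 st).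
- exact: (normal_variance sigN s0 st).
Qed.

Lemma evol_diag_id t z : 0 <= t -> 0 < Im z -> phi t t z = z.
Proof.
move=> t0 z0; have := evol_sub_id t0 (lexx t) z0.
rewrite subrr mul0r => h; apply/eqP; rewrite -subr_eq0; apply/eqP/nc_eq0/le_anti.
by rewrite h nc_ge0.
Qed.

Lemma evol_semigroup s u t z : 0 <= s -> s <= u -> u <= t -> 0 < Im z ->
  phi u t (phi s u z) = phi s t z.
Proof.
move=> s0 su ut z0; have u0 := le_trans s0 su; have st := le_trans su ut.
have := evol_conv (normal_evol sigN) s0 su ut z0; rewrite !F_transformE -!evolE //.
exact: evol_Im_gt0.
Qed.

Lemma evol_lip s u t z : 0 <= s -> s <= u -> u <= t -> 0 < Im z ->
  nc (phi s t z - phi s u z) <= (Im z)^-1 * (t - u).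
Proof.
move=> s0 su ut z0; have u0 := le_trans s0 su.
rewrite -(evol_semigroup s0 su ut z0).
apply: le_trans (evol_sub_id u0 ut (evol_Im_gt0 s0 su z0)) _.
rewrite mulrC ler_wpM2r ?subr_ge0 // lef_pV2 ?posrE ?evol_Im_gt0 //.
exact: evol_Im_ge.
Qed.

Lemma evol_ac s T z : 0 <= s -> s <= T -> 0 < Im z ->
  absolutely_continuous_on s T (fun t => phi s t z).
Proof.
move=> s0 sT z0; apply: (@cac_lip _ _ _ _ (Im z)^-1) => u v su uv vT.
exact: evol_lip.
Qed.

Lemma evol_growth s t : 0 <= s -> s <= t ->
  n.+1%:R * (Im (phi s t (iy R n.+1)) - n.+1%:R) @[n --> \oo] --> t - s.
Proof.
move=> s0 st; apply: (@transform_of_second_moment _ (sigma s t) (phi s t) (t - s)).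
- by rewrite subr_ge0.
- by move=> z z0; rewrite evol_cauchy.
- by move=> z z0; exact: evol_Im_ge.
- by move=> z z0; exact: evol_sub_id.
- have I2 := normal_moment2 sigN s0 st.
  by rewrite -(normal_variance sigN s0 st) /Rintegral fineK //; exact: integrable_fin_num.
Qed.

(** Continuity in t of the transforms of the increments over [t, t + h], from
    which measurability in t will follow. Moving the right end is a case of
    evol_lip; by the semigroup property, moving the left end amounts to moving
    the point z. *)
Lemma evol_cauchy_shift (h : R) z : 0 < h -> 0 < Im z -> exists2 C, 0 <= C &
  forall t t', 0 <= t -> t <= t' -> t' <= t + h ->
    nc (cauchy (sigma t' (t' + h)) z - cauchy (sigma t (t + h)) z) <= C * (t' - t).
Proof.
move=> h0 z0; set b := Im z in z0 *.
pose B := nc z + (h / b + h / b).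
have hb : 0 <= h / b by rewrite divr_ge0 // ltW.
have B0 : 0 <= B by rewrite !addr_ge0 ?nc_ge0.
have ib : 0 <= b^-1 by rewrite invr_ge0 ltW.
pose L := b ^- 2 * B ^+ 2.
have L0 : 0 <= L by rewrite mulr_ge0 ?invr_ge0 ?sqr_ge0.
exists (b ^- 2 * (b^-1 + L * b^-1)).
  by rewrite mulr_ge0 ?invr_ge0 ?sqr_ge0 // addr_ge0 // mulr_ge0.
move=> t t' t0 tt' th; have t'0 := le_trans t0 tt'.
have tth : t <= t + h by rewrite lerDl ltW.
have tth' : t' <= t' + h by rewrite lerDl ltW.
have thth : t + h <= t' + h by rewrite lerD2r.
rewrite !evol_cauchy //.
apply: le_trans (nc_invB z0 (evol_nc_ge t'0 tth' z0) (evol_nc_ge t0 tth z0)) _.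
rewrite -/b -mulrA ler_wpM2l ?invr_ge0 ?sqr_ge0 //.
set w := phi t t' z; have w0 : 0 < Im w by exact: evol_Im_gt0.
have wb : b <= Im w by exact: evol_Im_ge.
have wz : nc (w - z) <= b^-1 * (t' - t) by have := evol_sub_id t0 tt' z0; rewrite mulrC.
have -> : phi t' (t' + h) z - phi t (t + h) z =
   (phi t' (t' + h) z - phi t' (t + h) z) + (phi t' (t + h) z - phi t (t + h) z) by ring.
apply: le_trans (ncD _ _) _; rewrite mulrDl; apply: lerD.
  have := evol_lip t'0 th thth z0.
  by rewrite (_ : t' + h - (t + h) = t' - t) //; ring.
rewrite -(evol_semigroup t0 tt' th z0) -/w.
have bnd (u : R[i]) : 0 < Im u -> b <= Im u -> nc (phi t' (t + h) u) <= nc u + h / b.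
  move=> u0 bu; have := evol_sub_id t'0 th u0.
  have := ncD (phi t' (t + h) u - u) u; rewrite subrK => h1 h2.
  apply: le_trans h1 _; rewrite addrC lerD2l; apply: le_trans h2 _.
  apply: ler_pM; rewrite ?subr_ge0 ?invr_ge0 ?(ltW u0) //; first by lra.
  by rewrite lef_pV2.
have zB : nc (phi t' (t + h) z) <= B by apply: le_trans (bnd z z0 (lexx b)) _; rewrite /B; lra.
have wB : nc (phi t' (t + h) w) <= B.
  apply: le_trans (bnd w w0 wb) _; rewrite /B addrA lerD2r.
  have := ncD (w - z) z; rewrite subrK => h1; apply: le_trans h1 _; rewrite [leLHS]addrC lerD2l.
  by apply: le_trans wz _; rewrite mulrC ler_wpM2r //; lra.
have mufin : (sigma t' (t + h) setT < +oo)%E by rewrite probability_setT ltry.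
have g1 := cauchy_neq0 (sigma t' (t + h)) w0; have g2 := cauchy_neq0 (sigma t' (t + h)) z0.
have -> : phi t' (t + h) z - phi t' (t + h) w =
  (cauchy (sigma t' (t + h)) w - cauchy (sigma t' (t + h)) z) * (phi t' (t + h) z * phi t' (t + h) w).
  by rewrite !evolE //; field; rewrite g1 g2.
rewrite !ncM; apply: (@le_trans _ _ (b ^- 2 * 1 * nc (w - z) * (B * B))).
  apply: ler_pM; rewrite ?mulr_ge0 ?nc_ge0 //; last by rewrite ler_pM ?nc_ge0.
  have m1 : (sigma t' (t + h) setT <= 1%:E)%E by rewrite probability_setT.
  exact: cauchy_lip m1 z0 wb (lexx b).
rewrite /L mulr1 -expr2 mulrAC -[leRHS]mulrA ler_wpM2l // mulr_ge0 ?invr_ge0 ?sqr_ge0 //.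
Qed.

(** The measures x^2 sigma_{t,t+h}(dx) / h with h = 1/(n+1). For p = phi_{t,t+h}(w)
    their transforms at w are w/p times the difference quotient (w - p) / h, and
    w/p tends to 1. *)
Lemma increment_measure : exists rho : nat -> R -> bmeasure R, forall n t, 0 <= t ->
  rho n t setT = 1%E /\ forall z, 0 < Im z ->
    cauchy (rho n t) z = (n.+1%:R)%:C * (z * (z * cauchy (sigma t (t + n.+1%:R^-1)) z - 1)).
Proof.
have /choice[rho rhoP] (p : nat * R) : exists r : bmeasure R, 0 <= p.2 ->
    r setT = 1%E /\ forall z, 0 < Im z ->
    cauchy r z = (p.1.+1%:R)%:C * (z * (z * cauchy (sigma p.2 (p.2 + p.1.+1%:R^-1)) z - 1)).
  case: p => n t /=; have [t0|t0] := leP 0 t; last first.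
    by exists (dirac0 R).
  have h0 : 0 < n.+1%:R^-1 :> R by rewrite invr_gt0.
  have th : t <= t + n.+1%:R^-1 by rewrite lerDl ltW.
  have var : \int[sigma t (t + n.+1%:R^-1)]_x (x ^+ 2) = n.+1%:R^-1.
    by rewrite (normal_variance sigN t0 th) addrC addKr.
  have [r rT rC] := centered_measure (normal_moment1 sigN t0 th) (normal_moment2 sigN t0 th)
    (normal_mean sigN t0 th) var h0.
  by exists r => _; split => // z z0; rewrite rC // invrK.
by exists (fun n t => rho (n, t)) => n t t0; exact: (rhoP (n, t) t0).
Qed.

(** By the semigroup property the difference quotients of the flow at time t,
    started at (s, z), are those of phi_{t,t+h} at the present position
    phi_{s,t}(z). *)
Lemma increment_cvg (rho : nat -> R -> bmeasure R) s t z l :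
  (forall n t, 0 <= t -> rho n t setT = 1%E /\ forall z, 0 < Im z ->
    cauchy (rho n t) z = (n.+1%:R)%:C * (z * (z * cauchy (sigma t (t + n.+1%:R^-1)) z - 1))) ->
  0 <= s -> s <= t -> 0 < Im z -> is_Cderive (fun u => phi s u z) t l ->
  ccvg (fun n => cauchy (rho n t) (phi s t z)) (- l).
Proof.
move=> rhoP s0 st z0 [dR dI]; have t0 := le_trans s0 st.
set w := phi s t z; have w0 : 0 < Im w by exact: evol_Im_gt0.
set b := Im w in w0.
apply/cvgrPdist_le => e e0.
have b3 : 0 < b ^+ 3 by rewrite exprn_gt0.
have e4 : 0 < e / 4 by rewrite divr_gt0.
have hsmall c : 0 < c -> \forall n \near \oo, (n.+1%:R^-1 : R) <= c.
  move=> c0; have : n.+1%:R^-1 @[n --> \oo] --> (0 : R) by exact: cvg_harmonic.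
  move=> /cvgrPdist_le/(_ _ c0); apply: filterS => k.
  by rewrite sub0r normrN; apply: le_trans; exact: ler_norm.
have hq (f : R -> R) (m : R) : is_derive t (1 : R) f m ->
    \forall n \near \oo, `|n.+1%:R * (f (t + n.+1%:R^-1) - f t) - m| <= e / 4.
  move=> df; have [r r0 rP] := is_derive_local df e4.
  have r2 : 0 < r / 2 by rewrite divr_gt0.
  near=> k; have kr : k.+1%:R^-1 <= r / 2 by near: k; exact: hsmall.
  have k0 : 0 < k.+1%:R^-1 :> R by rewrite invr_gt0.
  have kn : k.+1%:R != 0 :> R by rewrite pnatr_eq0.
  have := rP (t + k.+1%:R^-1); rewrite [t + _ - t]addrAC subrr add0r (gtr0_norm k0).
  have klt : k.+1%:R^-1 < r by apply: le_lt_trans kr _; lra.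
  move=> /(_ klt) hh.
  rewrite -(ler_pM2r k0); apply: le_trans hh.
  rewrite -{2}(gtr0_norm k0) -normrM le_eqVlt; apply/orP; left; apply/eqP; congr (`|_|).
  by move: kn; move: (k.+1%:R : R) => y y0; field.
near=> n.
rewrite sub0r normrN ger0_norm ?nc_ge0 //.
have [_ ->] := rhoP n t t0; last by [].
set h : R := n.+1%:R^-1; have h0 : 0 < h by rewrite invr_gt0.
have hn : n.+1%:R = h^-1 by rewrite invrK.
have th : t <= t + h by rewrite lerDl ltW.
rewrite evol_cauchy // hn; set p := phi t (t + h) w.
have pE : p = phi s (t + h) z by rewrite /p /w evol_semigroup.
have p0 : p != 0 by rewrite -nc_gt0; apply: lt_le_trans (evol_nc_ge t0 th w0).
have pb : b <= nc p by exact: evol_nc_ge.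
have pw : nc (p - w) <= h / b.
  by have := evol_sub_id t0 th w0; rewrite addrAC subrr add0r.
have -> : (h^-1)%:C * (w * (w / p - 1)) - - l =
   (((w - p) / p) * ((h^-1)%:C * (w - p))) - ((h^-1)%:C * (p - w) - l).
  by move: ((h^-1)%:C) => c; field.
apply: le_trans (ncB _ _) _.
have h1 : nc ((w - p) / p * ((h^-1)%:C * (w - p))) <= h / b ^+ 3.
  have hi : 0 <= h^-1 by rewrite invr_ge0 ltW.
  rewrite !ncM ncR (ger0_norm hi) [nc (w - p)]nc_distC ncV.
  apply: (@le_trans _ _ ((h / b) * b^-1 * (h^-1 * (h / b)))).
    apply: ler_pM; rewrite ?mulr_ge0 ?invr_ge0 ?nc_ge0 ?(ltW h0) //.
      by apply: ler_pM; rewrite ?invr_ge0 ?nc_ge0 // lef_pV2 ?posrE // nc_gt0.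
    by rewrite ler_wpM2l.
  by rewrite le_eqVlt; apply/orP; left; apply/eqP; field; rewrite !gt_eqF.
have h2 : h / b ^+ 3 <= e / 4.
  rewrite ler_pdivrMr // /h; near: n; apply: hsmall; exact: mulr_gt0.
have hR : `|Re ((h^-1)%:C * (p - w) - l)| <= e / 4.
  rewrite ReB ReM /= mul0r subr0 ReB pE /w -hn /h; near: n; exact: hq.
have hI : `|Im ((h^-1)%:C * (p - w) - l)| <= e / 4.
  rewrite ImB ImM /= mul0r addr0 ImB pE /w -hn /h; near: n; exact: hq.
have := nc_le_ReIm ((h^-1)%:C * (p - w) - l); lra.
Unshelve. all: by end_near. Qed.

End Evolution.

(** * The driving measures of a normal evolution family *)

Section Converse.
Variable R : realType.
Notation leb := (@lebesgue_measure R).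
Variables (sigma : R -> R -> prob R) (phi : R -> R -> R[i] -> R[i]).
Hypothesis sigN : normal_monotone_evolution_family sigma.
Hypothesis phiF : forall s t : R, 0 <= s -> s <= t -> is_F_transform (phi s t) (sigma s t).
Variables (rho : nat -> R -> bmeasure R) (nu0 : R -> bmeasure R).
Hypothesis rhoP : forall n t, 0 <= t -> rho n t setT = 1%E /\ forall z, 0 < Im z ->
    cauchy (rho n t) z = (n.+1%:R)%:C * (z * (z * cauchy (sigma t (t + n.+1%:R^-1)) z - 1)).
Hypothesis nu0_mass : forall t, 0 <= t -> (nu0 t setT <= 1%:E)%E.
Hypothesis nu0P : forall t z l, 0 <= t -> 0 < Im z ->
  ccvg (fun n => cauchy (rho n t) z) l -> cauchy (nu0 t) z = l.

Definition singular_time s z : set R :=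
  ~` [set t | s < t -> exists l, is_Cderive (fun u => phi s u z) t l].

Lemma singular_time_null s z : 0 <= s -> 0 < Im z -> leb.-negligible (singular_time s z).
Proof.
move=> s0 z0; have K0 : 0 <= (Im z)^-1 by rewrite invr_ge0 ltW.
apply: (@lipschitz_Cderivable _ (fun u => phi s u z) s _ K0) => x y sx xy.
exact: (evol_lip sigN phiF).
Qed.

(** A limit exists at this one point, and nu0 t, being chosen before the
    point, must take that value there. *)
Lemma regular_derive s z t : 0 <= s -> s < t -> 0 < Im z -> ~ singular_time s z t ->
  ccvg (fun n => cauchy (rho n t) (phi s t z)) (cauchy (nu0 t) (phi s t z)) /\
  is_Cderive (fun u => phi s u z) t (- cauchy (nu0 t) (phi s t z)).
Proof.
move=> s0 st z0 /contrapT/(_ st)[l dl]; have t0 := le_trans s0 (ltW st).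
have h := increment_cvg sigN phiF rhoP s0 (ltW st) z0 dl.
have w0 := evol_Im_gt0 phiF s0 (ltW st) z0.
by rewrite (nu0P t0 w0 h) opprK.
Qed.

Let rz (p : rat * rat) : R[i] := ratr p.1 +i* ratr p.2.

(** Rational starting data are coded by natural numbers, so that the union is
    countable. *)
Definition exceptional_times : set R := \bigcup_k
  match (unpickle k : option (rat * (rat * rat))) with
  | Some (q, p) => if (0 <= ratr q :> R) && (0 < ratr p.2 :> R)
                   then singular_time (ratr q) (rz p) else set0
  | None => set0
  end.

Lemma exceptional_times_null : leb.-negligible exceptional_times.
Proof.
apply: negligible_bigcup => k; case: unpickle => [[q p]|]; last exact: negligible_set0.
case: ifP => [/andP[q0 p0]|_]; last exact: negligible_set0.
exact: singular_time_null.
Qed.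

(** Off a single null set the convergence holds on the whole half plane: it is
    known at the positions of the flow started at rational times and points,
    which are dense, and the Cauchy transforms are equicontinuous. *)
Lemma nonexceptional_cvg t w : 0 < t -> ~ exceptional_times t -> 0 < Im w ->
  ccvg (fun n => cauchy (rho n t) w) (cauchy (nu0 t) w).
Proof.
move=> t0 Nt w0; have t0' := ltW t0; set b := Im w in w0.
apply/cvgrPdist_le => e e0.
(* If the starting data are within d of (t, w), the position is within d (2 +
   1/b) of w, and the transforms are Lipschitz with constant b^-2; K d = e / 2
   leaves e / 4 for each of the two replacements of w. *)
pose K := 2 * b ^- 2 * (2 + b^-1).
have K0 : 0 < K by rewrite !mulr_gt0 ?invr_gt0 ?exprn_gt0 // addr_gt0 // invr_gt0.
pose d := e / 2 / K; have d0 : 0 < d by rewrite !divr_gt0.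
have rat_in (x y : R) : x < y -> exists q : rat, x < ratr q /\ ratr q < y.
  by move=> /rat_in_itvoo[q]; rewrite in_itv /= => /andP[]; exists q.
have [p1 [p1a p1b]] : exists q : rat, Re w < ratr q /\ ratr q < Re w + d.
  by apply: rat_in; rewrite ltrDl.
have [p2 [p2a p2b]] : exists q : rat, b < ratr q /\ ratr q < b + d.
  by apply: rat_in; rewrite ltrDl.
have [q [qa qb]] : exists q : rat, Num.max 0 (t - d) < ratr q /\ ratr q < t.
  by apply: rat_in; rewrite gt_max t0 gtrBl.
move: qa; rewrite gt_max => /andP[q0 qd].
pose z := rz (p1, p2); have zb : b < Im z by [].
have z0 : 0 < Im z by exact: lt_trans zb.
have ns : ~ singular_time (ratr q) z t.
  move=> h; apply: Nt; exists (pickle (q, (p1, p2))); first exact: I.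
  by rewrite pickleK /= (ltW q0) (lt_trans w0 p2a).
have q0' := ltW q0; have [cz _] := regular_derive q0' qb z0 ns.
set w' := phi (ratr q) t z in cz.
have bw' : b <= Im w' by apply: le_trans (ltW zb) _; exact: (evol_Im_ge phiF q0' (ltW qb) z0).
have ww' : nc (w - w') <= d * (2 + b^-1).
  have -> : w - w' = - ((w' - z) + (z - w)) by ring.
  rewrite ncN mulrDr [d * 2 + _]addrC; apply: le_trans (ncD _ _) _; apply: lerD.
    apply: le_trans (evol_sub_id sigN phiF q0' (ltW qb) z0) _.
    apply: ler_pM; rewrite ?subr_ge0 ?invr_ge0 ?(ltW qb) ?(ltW z0) //; first by lra.
    by rewrite lef_pV2 ?posrE // ltW.
  apply: le_trans (nc_le_ReIm _) _; rewrite ReB ImB /= -/b !gtr0_norm ?subr_gt0 //; lra.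
have e2 : 0 < e / 2 by rewrite divr_gt0.
near=> n; rewrite sub0r normrN ger0_norm ?nc_ge0 //.
have m1 : (rho n t setT <= 1%:E)%E by rewrite (rhoP n t0').1.
have l1 := cauchy_lip m1 w0 (lexx b) bw'.
have l2 := cauchy_lip (nu0_mass t0') w0 bw' (lexx b).
have l3 : nc (cauchy (rho n t) w' - cauchy (nu0 t) w') <= e / 2.
  have : `|0 - nc (cauchy (rho n t) w' - cauchy (nu0 t) w')| <= e / 2.
    by near: n; move/cvgrPdist_le: cz; apply.
  by rewrite sub0r normrN ger0_norm ?nc_ge0.
rewrite [nc (w' - w)]nc_distC mulr1 in l2; rewrite mulr1 in l1.
have ib : 0 <= b ^- 2 by rewrite invr_ge0 sqr_ge0.
have l4 : b ^- 2 * nc (w - w') <= e / 4.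
  apply: (@le_trans _ _ (b ^- 2 * (d * (2 + b^-1)))); first by rewrite ler_wpM2l.
  have -> : b ^- 2 * (d * (2 + b^-1)) = K * d / 2 by rewrite /K; field; rewrite gt_eqF.
  by rewrite /d [K * _]mulrC divfK ?gt_eqF //; lra.
have -> : cauchy (rho n t) w - cauchy (nu0 t) w =
  (cauchy (rho n t) w - cauchy (rho n t) w') + ((cauchy (rho n t) w' - cauchy (nu0 t) w')
    + (cauchy (nu0 t) w' - cauchy (nu0 t) w)) by ring.
have d1 := ncD (cauchy (rho n t) w - cauchy (rho n t) w') ((cauchy (rho n t) w' - cauchy (nu0 t) w')
    + (cauchy (nu0 t) w' - cauchy (nu0 t) w)).
have d2 := ncD (cauchy (rho n t) w' - cauchy (nu0 t) w') (cauchy (nu0 t) w' - cauchy (nu0 t) w).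
lra.
Unshelve. all: by end_near. Qed.

Section Measurability.
Variables (S : set (measurableTypeR R)).
Hypotheses (mS : measurable S) (SP : forall t, ~ S t -> 0 < t /\ ~ exceptional_times t).

(** Off S the transform of nu0 t is the pointwise limit of functions of t that
    are continuous. Constants k on S leave room for another choice of measure
    there, and a selects the real or the imaginary part. *)
Lemma selected_measurable (a z : R[i]) (k : R) : 0 < Im z ->
  measurable_fun setT ((fun t => k * \1_S t + Re (a * cauchy (nu0 t) z) * \1_(~` S) t) :
    measurableTypeR R -> measurableTypeR R).
Proof.
move=> z0.
pose c (t : R) : R := Num.max 0 t.
have c0 t : 0 <= c t by rewrite /c le_max lexx.
have cm t t' : t <= t' -> c t <= c t' /\ c t' - c t <= t' - t.
  by move=> tt'; rewrite /c !maxEle; do !case: ifP => //; lra.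
pose d n t := cauchy (sigma (c t) (c t + n.+1%:R^-1)) z.
have md n (A : R[i]) : measurable_fun setT ((fun t => Re (A * d n t)) :
    measurableTypeR R -> measurableTypeR R).
  have h0 : 0 < n.+1%:R^-1 :> R by rewrite invr_gt0.
  have [C C0 CP] := evol_cauchy_shift sigN phiF h0 z0.
  have L t t' : t <= t' -> t' <= t + n.+1%:R^-1 -> nc (d n t' - d n t) <= C * (t' - t).
    move=> tt' th; have [h1 h2] := cm _ _ tt'.
    apply: le_trans (CP _ _ (c0 t) h1 _) _.
      by move: th h2; move: (n.+1%:R^-1 : R) (c t) (c t') => *; lra.
    by rewrite ler_wpM2l.
  apply: continuous_measurable_fun => t; apply/cvgrPdist_le => e e0.
  have q0 : 0 < Num.min n.+1%:R^-1 (e / (nc A * C + 1)).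
    by rewrite lt_min h0 divr_gt0 // ltr_wpDl // mulr_ge0 ?nc_ge0.
  have := nbhsx_ballx t _ q0; apply: filterS => t'.
  rewrite /ball /= lt_min => /andP[b1 b2].
  rewrite -ReB -mulrBr; apply: le_trans (Re_le_nc _) _; rewrite ncM.
  have h : nc (d n t - d n t') <= C * `|t - t'|.
    move: b1; have [tt'|/ltW tt'] := leP t t'.
      by rewrite nc_distC ler0_norm ?subr_le0 // opprB => b1; apply: L => //; rewrite -lerBlDl ltW.
    by rewrite ger0_norm ?subr_ge0 // => b1; apply: L => //; rewrite -lerBlDl ltW.
  apply: (@le_trans _ _ (nc A * (C * `|t - t'|))); first by rewrite ler_wpM2l ?nc_ge0.
  rewrite mulrA; apply: (@le_trans _ _ ((nc A * C + 1) * `|t - t'|)).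
    by rewrite ler_wpM2r // lerDl.
  rewrite mulrC -ler_pdivlMr; first exact: ltW.
  by rewrite ltr_wpDl // mulr_ge0 ?nc_ge0.
have mI (U : set (measurableTypeR R)) : measurable U ->
    measurable_fun setT (\1_U : measurableTypeR R -> measurableTypeR R).
  by move=> mU; exact: measurable_indic.
pose g n t := k * \1_S t + (Re (a * (n.+1%:R)%:C * z ^+ 2 * d n t) - Re (a * (n.+1%:R)%:C * z)) * \1_(~` S) t.
apply: (@measurable_fun_cvg _ _ R setT g).
  move=> n; apply: measurable_funD; first exact: measurable_funM.
  apply: measurable_funM; last by apply: mI; exact: measurableC.
  by apply: measurable_funB => //; exact: md.
move=> t _; rewrite /g; apply: cvgD; first exact: cvg_cst.
have [St|nS] := pselect (S t).
  rewrite !indicE (memNset (_ : ~ (~` S) t)) ?mulr0; last by move=> /(_ St).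
  by under eq_fun do rewrite mulr0; exact: cvg_cst.
have [t0 Nt] := SP nS; apply: cvgM; last exact: cvg_cst.
have h := nonexceptional_cvg t0 Nt z0.
have ct : c t = t by apply/max_idPr; exact: ltW.
have := ccvg_Re (ccvgM (ccvg_cst a) h).
apply: cvg_trans; apply: near_eq_cvg; apply: nearW => n /=.
rewrite (rhoP n (ltW t0)).2 // /d ct -ReB; congr Re; ring.
Qed.

End Measurability.

(** The total masses of the limits nu0 t are at most 1. Along iy the flow grows
    no faster than they allow, whereas the variances make it grow at full rate:
    the masses have integral at least T over [0, T], so they are 1 almost
    everywhere. *)
Lemma mass1_ae : exists2 N : set (measurableTypeR R), measurable N /\ leb N = 0%E &
  forall t, 0 < t -> ~ N t -> ~ exceptional_times t /\ nu0 t setT = 1%E.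
Proof.
have [N1 [mN1 N10 N1P]] := exceptional_times_null.
have N1n : leb.-negligible N1 by exists N1; split.
pose S : set (measurableTypeR R) := N1 `|` `]-oo, 0]%classic.
have mS : measurable S by exact: measurableU.
have SP t : ~ S t -> 0 < t /\ ~ exceptional_times t.
  move=> /not_orP[h1 h2]; split; last by move=> /N1P.
  by rewrite ltNge; apply/negP => t0; apply: h2; rewrite /= in_itv.
pose mass t := fine (nu0 t setT).
pose m (t : R) : R := 1 * \1_S t + mass t * \1_(~` S) t.
have nu0fin t : 0 <= t -> (nu0 t setT < +oo)%E.
  by move=> t0; apply: le_lt_trans (nu0_mass t0) _; rewrite ltry.
have massE t : 0 <= t -> nu0 t setT = (mass t)%:E.
  by move=> t0; rewrite /mass fineK // ge0_fin_numE // nu0fin.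
have mass1 t : 0 <= t -> 0 <= mass t <= 1.
  by move=> t0; rewrite -!lee_fin -massE // measure_ge0 nu0_mass.
have mE t : ~ S t -> m t = mass t.
  by move=> St; rewrite /m !indicE memNset // mem_set // mulr0 mulr1 add0r.
have mS1 t : S t -> m t = 1.
  by move=> St; rewrite /m !indicE mem_set // memNset ?mulr1 ?mulr0 ?addr0 //= => /(_ St).
have mB t : 0 <= m t <= 1.
  have [St|St] := pselect (S t); first by rewrite mS1 // ler01 lexx.
  by rewrite mE // mass1 // ltW // (SP _ St).1.
have mm : measurable_fun setT (m : measurableTypeR R -> measurableTypeR R).
  apply: (@measurable_fun_cvg _ _ R setT (fun n t => 1 * \1_S t +
    Re (((n.+1%:R)%:C * 'i) * cauchy (nu0 t) (iy R n.+1)) * \1_(~` S) t)).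
    by move=> n; exact: (selected_measurable mS SP _ _ (Im_iy_gt0 R n)).
  move=> t _; apply: cvgD; first exact: cvg_cst.
  have [St|St] := pselect (S t).
    rewrite !indicE (memNset (_ : ~ (~` S) t)) ?mulr0; last by move=> /(_ St).
    by under eq_fun do rewrite mulr0; exact: cvg_cst.
  apply: cvgM; last exact: cvg_cst.
  have t0 := ltW (SP _ St).1.
  have := mass_cvg (nu0fin t t0); rewrite massE // => /fine_cvgP[_].
  apply: cvg_trans; apply: near_eq_cvg; apply: nearW => n /=.
  by rewrite -/(cauchy _ _) ?ReM ?ImM /=; ring.
have mB1 t : `|m t| <= 1 by have /andP[h1 h2] := mB t; rewrite ger0_norm.
have grow T : 0 <= T -> T <= \int[leb]_(r in `[0, T]) m r.
  move=> T0; have := evol_growth sigN phiF (lexx 0) T0; rewrite subr0 => h.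
  apply: (cvgr_to_le h); apply: nearW => n.
  have z0 := Im_iy_gt0 R n; set z := iy R n.+1 in z0 *.
  have zy : Im z = n.+1%:R by [].
  have y0 : 0 < n.+1%:R :> R by rewrite ltr0n.
  have E (w : R[i]) : Re ((n.+1%:R)%:C * - 'i * w) = n.+1%:R * Im w.
    by rewrite !ReM !ImM /=; ring.
  have Nz : leb.-negligible ((singular_time 0 z `|` N1) `|` [set 0]).
    apply: negligibleU; last by exists [set 0]; split=> //; exact: lebesgue_measure_set1.
    by apply: negligibleU N1n; exact: singular_time_null.
  have := @cac_le_integral _ m 1 0 T T0 ler01 mm mB1 (fun r => phi 0 r z) ((n.+1%:R)%:C * - 'i) _
    (evol_ac sigN phiF (lexx 0) T0 z0) Nz.
  rewrite E (evol_diag_id sigN phiF (lexx 0) z0) ImB zy; apply.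
  move=> r r0 rT /not_orP[/not_orP[Ns N1r] /eqP rn0].
  have rp : 0 < r by rewrite lt_neqAle eq_sym rn0.
  have Sr : ~ S r by move=> [//|]; rewrite /= in_itv /= leNgt rp.
  exists (- cauchy (nu0 r) (phi 0 r z)); last exact: (regular_derive (lexx 0) rp z0 Ns).2.
  rewrite E mE // -ler_pdivlMl //.
  have mr : (nu0 r setT <= (mass r)%:E)%E by rewrite massE.
  have := nc_cauchy mr z0 (evol_Im_ge phiF (lexx 0) r0 z0); rewrite zy; apply: le_trans.
  by rewrite -ncN; apply: le_trans (Im_le_nc _); exact: ler_norm.
have null (k : nat) : leb.-negligible [set t | (0 <= t <= k%:R) /\ m t != 1].
  have k0 : 0 <= k%:R :> R by rewrite ler0n.
  have mk : measurable (`[0, k%:R] : set (measurableTypeR R)) by exact: measurable_itv.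
  have mI := bounded_integrable_itv 0 k%:R mm mB1.
  have I1 := bounded_integrable_itv 0 k%:R (measurable_cst (1 : R)) (fun=> lexx `|1 : R|).
  have i0 : \int[leb]_(r in `[0, k%:R]) (1 - m r) = 0.
    apply/le_anti; apply/andP; split; last first.
      by apply: Rintegral_ge0 => r _; have /andP[_] := mB r; rewrite subr_ge0.
    rewrite RintegralB // Rintegral_cst // mul1r [X in fine X](lebesgue_measure_itv) /= lte_fin.
    have := grow k%:R k0; case: ltP => hk; rewrite /= ?subr0; lra.
  have ID : leb.-integrable `[0, k%:R] (EFin \o (fun r => 1 - m r)).
    by have := integrableB mk I1 mI; congr integrable; apply/funext => r.
  have ie : (\int[leb]_(r in `[0%R, k%:R]) `|(1 - m r)%:E| = 0)%E.
    rewrite (_ : (fun r => _) = EFin \o (fun r => 1 - m r)).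
      by rewrite -[LHS]fineK; [rewrite -[fine _]/(\int[leb]_(r in `[0, k%:R]) (1 - m r)) i0|exact: integrable_fin_num].
    by apply/funext => r /=; rewrite ger0_norm // subr_ge0; case/andP: (mB r).
  have mD : measurable_fun (`[0%R, k%:R]%classic : set (measurableTypeR R)) (fun r : measurableTypeR R => (1 - m r)%:E).
    exact: measurable_int ID.
  have := (ae_eq_integral_abs leb mk mD).1 ie; apply: negligibleS => t /= [tk m1] h.
  by move: m1; have [e] := h tk; rewrite -subr_eq0 -opprB e oppr0 eqxx.
have : leb.-negligible ((\bigcup_(k : nat) [set t | (0 <= t <= k%:R) /\ m t != 1]) `|` N1).
  by apply: negligibleU N1n; exact: negligible_bigcup.
move=> [N [mN N0 NP]]; exists N; first by split.
move=> t t0 Nt; have N1t : ~ N1 t by move=> h; apply: Nt; apply: NP; right.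
have St : ~ S t by move=> [//|]; rewrite /= in_itv /= leNgt t0.
split; first exact: (SP _ St).2.
rewrite (massE _ (ltW t0)) -(mE _ St); congr EFin; apply/eqP/negPn/negP => m1.
apply: Nt; apply: NP; left; exists (Num.bound t) => //=; split=> //.
by rewrite (ltW t0) ltW // archi_boundP // ltW.
Qed.

(** On a null set of times, and at negative ones, where nu0 may fail to be a
    probability or to depend measurably on t, it is replaced by the Dirac mass
    at 0. *)
Lemma evolution_loewner : exists nu : R -> prob R,
  measurable_cauchy_family nu /\ loewner_solution nu phi.
Proof.
have [N [mN N0] NP] := mass1_ae.
have Nn : leb.-negligible N by exists N; split.
pose S : set (measurableTypeR R) := N `|` `]-oo, 0]%classic.
have mS : measurable S by exact: measurableU.
have S0 t : ~ S t -> 0 < t /\ ~ N t.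
  move=> /not_orP[h1 h2]; split => //.
  by rewrite ltNge; apply/negP => t0; apply: h2; rewrite /= in_itv.
have SP t : ~ S t -> 0 < t /\ ~ exceptional_times t.
  by move=> /S0[t0 Nt]; split => //; have [] := NP t t0 Nt.
have /choice[nu nuP] t : exists P : prob R, (S t -> P = dirac0 R) /\
    (~ S t -> forall z, cauchy P z = cauchy (nu0 t) z).
  have [St|St] := pselect (S t); first by exists (dirac0 R).
  have [t0 Nt] := S0 t St; have [P PP] := probability_of_mass1 (NP t t0 Nt).2.
  by exists P.
exists nu; split.
  move=> z z0.
  have part (a : R[i]) : measurable_fun (`[0%R, +oo[%classic : set (measurableTypeR R)) ((fun t => Re (a * cauchy_transform (nu t) z)) :
      measurableTypeR R -> measurableTypeR R).
    apply: measurable_funTS.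
    have := selected_measurable mS SP a (Re (a * z^-1)) z0.
    congr measurable_fun; apply/funext => t; rewrite cauchy_transformE.
    have [St|St] := pselect (S t).
      rewrite ((nuP t).1 St) cauchy_dirac0 // !indicE mem_set // memNset ?mulr1 ?mulr0 ?addr0 //=.
    by rewrite ((nuP t).2 St) !indicE memNset // mem_set // mulr0 add0r mulr1.
  split.
    by have := part 1; congr measurable_fun; apply/funext => t; rewrite mul1r.
  have := part (- 'i); congr measurable_fun; apply/funext => t.
  by case: (cauchy_transform _ _) => x y; rewrite ReM /=; ring.
split.
- by move=> s t z s0 st z0; exact: (evol_Im_gt0 phiF).
- by move=> s z s0 z0; exact: (evol_diag_id sigN phiF).
- by move=> s T z s0 sT z0; exact: (evol_ac sigN phiF).
- move=> s z s0 z0.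
  have : leb.-negligible ((singular_time s z `|` N) `|` [set s]).
    apply: negligibleU; last by exists [set s]; split=> //; exact: lebesgue_measure_set1.
    by apply: negligibleU Nn; exact: singular_time_null.
  apply: negligibleS => t /= h; apply: contrapT => /not_orP[/not_orP[Ns Nt] /eqP ts].
  apply: h => st; have st' : s < t by rewrite lt_neqAle eq_sym ts.
  have t0 : 0 < t by exact: le_lt_trans st'.
  have St : ~ S t by move=> [//|]; rewrite /= in_itv /= leNgt t0.
  rewrite cauchy_transformE ((nuP t).2 St).
  exact: (regular_derive s0 st' z0 Ns).2.
Qed.

End Converse.

Lemma evolution_is_loewner (R : realType) (sigma : R -> R -> prob R)
    (phi : R -> R -> R[i] -> R[i]) :
  normal_monotone_evolution_family sigma ->
  (forall s t : R, 0 <= s -> s <= t -> is_F_transform (phi s t) (sigma s t)) ->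
  exists nu : R -> prob R, measurable_cauchy_family nu /\ loewner_solution nu phi.
Proof.
move=> sigN phiF; have [rho rhoP] := increment_measure sigN.
have /choice[nu0 nu0P] t : exists m : bmeasure R, 0 <= t -> (m setT <= 1%:E)%E /\
    forall z l, 0 < Im z -> ccvg (fun n => cauchy (rho n t) z) l -> cauchy m z = l.
  have [t0|t0] := leP 0 t; last by exists (dirac0 R).
  have r1 n : (rho n t setT <= 1%:E)%E by rewrite (rhoP n t t0).1.
  by have [m m1 mP] := helly_cauchy r1; exists m.
apply: (evolution_loewner sigN phiF rhoP (nu0 := nu0)).
- by move=> t t0; exact: (nu0P t t0).1.
- by move=> t z l t0 z0; exact: (nu0P t t0).2.
Qed.

Theorem theorem3p6 (R : realType) :
  (forall nu : R -> prob R,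
     measurable_cauchy_family nu ->
     forall phi : R -> R -> R[i] -> R[i],
       loewner_solution nu phi ->
       exists sigma : R -> R -> prob R,
         (forall s t : R, 0 <= s -> s <= t ->
            is_F_transform (phi s t) (sigma s t)) /\
         normal_monotone_evolution_family sigma) /\
  (forall sigma : R -> R -> prob R,
     normal_monotone_evolution_family sigma ->
     forall phi : R -> R -> R[i] -> R[i],
       (forall s t : R, 0 <= s -> s <= t ->
          is_F_transform (phi s t) (sigma s t)) ->
       exists nu : R -> prob R,
         measurable_cauchy_family nu /\ loewner_solution nu phi).
Proof.
split=> [nu nuM phi phiP|sigma sigN phi phiF].
  exact: flow_evolution phiP nuM.
exact: evolution_is_loewner sigN phiF.
Qed.
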